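(* Let $\mu=\mu_1\times\dots\times\mu_K$ be a product-form probability distribution on $(S,\mathcal{S})$, let $X^1,X^2,\dots$ be i.i.d. with law $\mu$, and for each integer $N>0$ let $\mu^N_\times(\varphi):=N^{-K}\sum_{\mathbf{n}\in[N]^K}\varphi(X^{\mathbf{n}})$ be the product-form estimator. (i) If $\varphi:S\to\mathbb{R}$ is $\mu$-integrable, then $\mathbb{E}[\mu^N_\times(\varphi)]=\mu(\varphi)$ for all $N>0$. (ii) If, furthermore, $\varphi\in L^2_\mu$, then $\mu_{A^c}(\varphi)\in L^2_{\mu_A}$ for all subsets $A$ of $[K]$, and for every $N>0$ $$\mathrm{Var}(\mu^N_\times(\varphi))=\sum_{\emptyset\neq A\subseteq[K]}\frac{1}{N^{|A|}}\sum_{B\subseteq A}(-1)^{|A|-|B|}\sigma^2_{A,B}(\mu_{A^c}(\varphi)),$$ where $\sigma^2_{A,B}(\psi):=\mu_B([\mu_{A\setminus B}(\psi)-\mu_A(\psi)]^2)$ for all $\psi\in L^2_{\mu_A}$ and $B\subseteq A\subseteq[K]$. Furthermore, $\mu^N_\times(\varphi)$ is strongly consistent and asymptotically normal: $$\lim_{N\to\infty}\mu^N_\times(\varphi)=\mu(\varphi)\ \text{ almost surely},\qquad N^{1/2}[\mu^N_\times(\varphi)-\mu(\varphi)]\Rightarrow\mathcal{N}(0,\sigma^2_\times(\varphi))\ \text{ as }N\to\infty,$$ where $\Rightarrow$ denotes convergence in distribution and $\sigma^2_\times(\varphi):=\sum_{k=1}^K\sigma^2_k(\varphi)$ with $\sigma^2_k(\varphi):=\mu_k([\mu_{\{k\}^c}(\varphi)-\mu(\varphi)]^2)$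 for all $k\in[K]$.
   Context: $K>1$ is an integer, $[K]:=\{1,\dots,K\}$. For $k\in[K]$, $\mu_k$ is a probability distribution on a measurable space $(S_k,\mathcal{S}_k)$; $S:=S_1\times\dots\times S_K$, $\mathcal{S}$ is the product sigma-algebra, $\mu:=\mu_1\times\dots\times\mu_K$. $\mu(\varphi):=\int\varphi\,d\mu$, and $L^2_\mu$ is the space of square $\mu$-integrable real-valued (measurable) functions. For non-empty $A\subseteq[K]$: $\mu_A:=\prod_{k\in A}\mu_k$; $A^c:=[K]\setminus A$; $|A|$ is the cardinality of $A$; and $\mu_A(\varphi)$ denotes the function on $\prod_{k\notin A}S_k$ obtained by integrating out the arguments indexed by $A$: $\mu_A(\varphi)(x_{A^c}):=\int\varphi(x_A,x_{A^c})\mu_A(dx_A)$. These partial integrals are assumed to be well-defined for every $x_{A^c}$. The same notation applies to functions $\psi$ on $\prod_{k\in A}S_k$ and subsets of $A$ (e.g. for $B\subseteq A$, $\mu_{A\setminus B}(\psi)$ is a function on $\prod_{k\in B}S_k$ and $\mu_A(\psi)$ is a number). If $A=\emptyset$, $\mu_A(\varphi):=\varphi$. Writing $X^n=(X^n_1,\dots,X^n_K)$, for $\mathbf{n}=(n_1,\dots,n_K)\in[N]^K$ set $X^{\mathbf{n}}:=(X^{n_1}_1,\dots,X^{n_K}_K)$. A normal law with variance $0$ is a Dirac mass. *)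

(* Defs.v *)
From HB Require Import structures.
From mathcomp Require Import all_boot all_order all_algebra.
From mathcomp Require Import all_classical all_reals all_analysis.

Set Implicit Arguments.
Unset Strict Implicit.
Unset Printing Implicit Defensive.

Import Order.TTheory GRing.Theory Num.Theory.
Import numFieldNormedType.Exports.

Local Open Scope classical_set_scope.
Local Open Scope ring_scope.

(** * Finite products of measurable spaces and of probability measures *)

Definition prod_space (I : finType) (d : I -> measure_display)
  (T : forall i, measurableType (d i)) : Type := forall i, T i.

Definition prod_display (I : finType) (d : I -> measure_display) :
  measure_display.
Proof. exact. Qed.

Section prod_space.
Context (I : finType) (d : I -> measure_display).
Variable T : forall i, measurableType (d i).

Definition prod_generator : set (set (prod_space T)) :=
  \bigcup_(i in [set: I])
    preimage_set_system setT (fun x : prod_space T => x i) measurable.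

HB.instance Definition _ := gen_eqMixin (prod_space T).
HB.instance Definition _ := gen_choiceMixin (prod_space T).
HB.instance Definition _ :=
  isPointed.Build (prod_space T) (fun i => point : T i).

HB.instance Definition _ := @isMeasurable.Build (prod_display d)
  (prod_space T) <<s prod_generator >>
  (@sigma_algebra0 _ setT prod_generator)
  (@sigma_algebraC _ prod_generator)
  (@sigma_algebra_bigcup _ setT prod_generator).

Lemma measurable_coord i :
  measurable_fun setT (fun x : prod_space T => x i).
Proof.
move=> _ A mA; apply: sub_sigma_algebra; exists i => //.
by exists A.
Qed.

Lemma measurable_to_prod d' (U : measurableType d') (f : U -> prod_space T) :
  (forall i, measurable_fun setT (fun u => f u i)) -> measurable_fun setT f.
Proof.
move=> mf; apply: (measurability _ (erefl : measurable = <<s prod_generator >>)).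
move=> _ [_ [i _ [A mA <-]] <-]; rewrite !setTI.
by have := mf i measurableT A mA; rewrite setTI.
Qed.

Definition update i (p : T i * prod_space T) : prod_space T :=
  dfwith p.2 i p.1.

Lemma measurable_update i : measurable_fun setT (@update i).
Proof.
apply: measurable_to_prod => j; rewrite /update /dfwith.
case: eqP => [ij|_]; first by case: _ / ij; exact: (@measurable_fst _ _ (T i) (prod_space T)).
exact: (measurableT_comp (@measurable_coord j)
  (@measurable_snd _ _ (T i) (prod_space T))).
Qed.

HB.instance Definition _ i :=
  isMeasurableFun.Build _ _ _ _ (@update i) (@measurable_update i).

End prod_space.

Section prod_prob.
Context (R : realType) (I : finType) (d : I -> measure_display).
Context (T : forall i, measurableType (d i)).
Variable mu : forall i, probability (T i) R.
Local Open Scope ereal_scope.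

(* The coordinates listed in [s] are drawn independently from the [mu i]; the
   remaining ones are frozen at [point]. *)
Fixpoint prod_prob_seq (s : seq I) : probability (prod_space T) R :=
  if s is i :: s' then
    distribution (mu i \x prod_prob_seq s') (@update _ _ T i)
  else \d_(point : prod_space T).

(* \prod_i mu i; see [prod_probE] for its value on measurable rectangles. *)
Definition prod_prob : probability (prod_space T) R := prod_prob_seq (enum I).


Let rect (A : forall i, set (T i)) : set (prod_space T) :=
  [set x | forall i, A i (x i)].

Let measurable_rect A : (forall i, measurable (A i)) -> measurable (rect A).
Proof.
move=> mA; have -> : rect A =
    \big[setI/setT]_(i : I) ((fun x : prod_space T => x i) @^-1` A i).
  rewrite -bigcap_seq_cond; apply/seteqP; split => x.
    by move=> Ax i _; exact: Ax.
  by move=> Ax i; apply: Ax; rewrite /= mem_index_enum.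
apply: bigsetI_measurable => i _.
by rewrite -[X in measurable X]setTI; exact: measurable_coord.
Qed.

Let prod_prob_seqE s A : uniq s -> (forall i, measurable (A i)) ->
  prod_prob_seq s (rect A) =
  \prod_(i <- s) mu i (A i) *
    (\1_[set x : prod_space T | forall i, i \notin s -> A i (x i)] point)%:E.
Proof.
elim: s A => [|i s IHs] A /=.
  move=> _ mA.
  rewrite big_nil mul1e /dirac; congr (\1_ _ _)%:E.
  by apply/seteqP; split => x Ax j *; exact: Ax.
move=> /andP[iNs us] mA.
pose B j : set (T j) := if j == i then setT else A j.
have mB j : measurable (B j) by rewrite /B; case: ifP.
rewrite /distribution /pushforward.
have -> : @update _ _ T i @^-1` rect A = A i `*` rect B.
  apply/seteqP; split => -[t x] /=.
    move=> Atx; split => [|j]; first by have := Atx i; rewrite /update dfwithin.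
    rewrite /B; case: eqP => // /eqP ji; have := Atx j.
    by rewrite /update dfwithout // eq_sym.
  move=> [At Bx] j; rewrite /update /=; case: dfwithP => // k ik.
  by have := Bx k; rewrite /B eq_sym (negbTE ik).
rewrite product_measure1E //; last exact: measurable_rect.
rewrite [X in _ * X](IHs B us mB) big_cons -muleA; congr (_ * (_ * _)).
  rewrite [LHS]big_seq [RHS]big_seq; apply: eq_bigr => j js.
  by rewrite /B; case: eqP js iNs => // -> ->.
congr (\1_ _ _)%:E; apply/seteqP; split => x Bx j.
  rewrite inE negb_or => /andP[ji js].
  by have := Bx j js; rewrite /B (negbTE ji).
move=> js; rewrite /B; case: eqP => // /eqP ji.
by apply: Bx; rewrite inE negb_or ji.
Qed.

Lemma prod_probE (A : forall i, set (T i)) : (forall i, measurable (A i)) ->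
  prod_prob [set x | forall i, A i (x i)] = \prod_i mu i (A i).
Proof.
move=> mA; rewrite [LHS](prod_prob_seqE (enum_uniq I) mA) big_enum /=.
rewrite indicE mem_set ?mule1 // => i.
by rewrite mem_enum.
Qed.

End prod_prob.

(** * Blocks of coordinates and partial integrals *)

Section partial_integrals.
Context (R : realType) (K : nat) (d : 'I_K -> measure_display).
Context (S : forall k, measurableType (d k)).
Variable mu : forall k, probability (S k) R.

Definition block (A : {set 'I_K}) :=
  prod_space (fun k : {k : 'I_K | k \in A} => S (val k)).

Definition block_prob (A : {set 'I_K}) : probability (block A) R :=
  prod_prob (fun k : {k : 'I_K | k \in A} => mu (val k)).

Definition restr (A : {set 'I_K}) (x : prod_space S) : block A :=
  fun k => x (val k).

(* The point (x_A, y_B); it is only used for disjoint [A] and [B], and the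
   coordinates outside of [A :|: B], set to [point], are never looked at. *)
Definition merge (A B : {set 'I_K}) (x : block A) (y : block B) :
    prod_space S := fun k =>
  match @idP (k \in A), @idP (k \in B) with
  | ReflectT kA, _ => x (exist _ k kA)
  | _, ReflectT kB => y (exist _ k kB)
  | _, _ => point
  end.

Lemma merge_restr (A : {set 'I_K}) (x : prod_space S) :
  merge (@restr (~: A) x) (@restr A x) = x.
Proof.
apply: functional_extensionality_dep => k; rewrite /merge.
case: {-}_ / idP => // kNA; case: {-}_ / idP => // kA.
by case: kNA; rewrite finset.in_setC; apply/negP.
Qed.

(* mu_{A^c}(phi), a function on the block indexed by A *)
Definition marginal (A : {set 'I_K}) (phi : prod_space S -> R)
    (x : block A) : R :=
  \int[block_prob (~: A)]_y phi (merge y x).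

Lemma marginal_setT (phi : prod_space S -> R) (x : prod_space S) :
  marginal phi (@restr [set: 'I_K]%SET x) = phi x.
Proof.
have -> : marginal phi (@restr [set: 'I_K]%SET x) =
    \int[block_prob (~: [set: 'I_K]%SET)]_y phi x.
  congr fine; apply: eq_integral => y _; congr (phi _)%:E.
  rewrite -[RHS](@merge_restr [set: 'I_K]%SET) /merge.
  apply: functional_extensionality_dep => k.
  by case: {-}_ / idP => // kT; exfalso; move: kT; rewrite !inE.
by rewrite /Rintegral integral_cst //= probability_setT mule1.
Qed.

(* mu_{A \ B}(psi) for B \subset A, a function on the block indexed by B *)
Definition block_marginal (A B : {set 'I_K}) (psi : block A -> R)
    (x : block B) : R :=
  \int[block_prob (A :\: B)]_y psi (@restr A (merge y x)).

Definition partially_integrable (phi : prod_space S -> R) : Prop :=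
  forall (A : {set 'I_K}) (x : block (~: A)),
    (block_prob A).-integrable setT (fun y => (phi (merge y x))%:E).

Definition sigma2_block (A B : {set 'I_K}) (psi : block A -> R) : R :=
  \int[block_prob B]_x
    (block_marginal psi x - \int[block_prob A]_y psi y) ^+ 2.

(* the identification of S_k with the block indexed by {k} *)
Definition block1 (k : 'I_K) (t : S k) : block [set k] :=
  @restr [set k] (dfwith (point : prod_space S) k t).

Definition sigma2_coord (k : 'I_K) (phi : prod_space S -> R) : R :=
  \int[mu k]_t
    (marginal phi (block1 t) - \int[prod_prob mu]_x phi x) ^+ 2.

Definition sigma2_prod (phi : prod_space S -> R) : R :=
  \sum_(k < K) sigma2_coord k phi.

End partial_integrals.

(** * Random sequences *)

Section random_sequences.
Context (R : realType) (dO : measure_display) (Omega : measurableType dO).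
Variable P : probability Omega R.

Definition independent_seq d (T : measurableType d)
    (X : nat -> {RV P >-> T}) : Prop :=
  forall (J : seq nat) (A : nat -> set T), uniq J ->
    (forall n, measurable (A n)) ->
    P (\bigcap_(n in [set` J]) (X n @^-1` A n)) =
    (\prod_(n <- J) P (X n @^-1` A n))%E.

Definition iid_with_law d (T : measurableType d)
    (X : nat -> {RV P >-> T}) (nu : probability T R) : Prop :=
  (forall n A, measurable A -> distribution P (X n) A = nu A) /\
  independent_seq X.

Definition cvg_in_distribution (Y : nat -> Omega -> R)
    (nu : probability (measurableTypeR R) R) : Prop :=
  forall f : R -> R, continuous f -> (exists M, forall x, `|f x| <= M) ->
    ('E_P[f \o Y N] @[N --> \oo] --> \int[nu]_x (f x)%:E)%E.

End random_sequences.

(* The normal law with mean [m] and variance [v]; the library's [normal_prob]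
   takes the standard deviation and is not a Dirac mass when it is [0]. *)
Definition normal_law (R : realType) (m v : R) :
    probability (measurableTypeR R) R :=
  if v == 0 then \d_(m : measurableTypeR R) : probability (measurableTypeR R) R
  else normal_prob m (Num.sqrt v) : probability (measurableTypeR R) R.

(* The sample X^1, X^2, ... is indexed from 0. *)
Definition prod_estimator (R : realType) (K : nat)
    (d : 'I_K -> measure_display) (S : forall k, measurableType (d k))
    (Omega : Type) (X : nat -> Omega -> prod_space S)
    (N : nat) (phi : prod_space S -> R) (omega : Omega) : R :=
  N%:R ^- K * \sum_(n : {ffun 'I_K -> 'I_N}) phi (fun k => X (n k) omega k).

(* Main.v *)
Require Import Defs.
From mathcomp Require Import all_boot all_order all_algebra.
From mathcomp Require Import all_classical all_reals all_analysis.
From HB Require Import structures.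
From mathcomp Require Import measurable_realfun.
From Stdlib Require PeanoNat.
From mathcomp Require Import ring lra.

Set Implicit Arguments.
Unset Strict Implicit.
Unset Printing Implicit Defensive.

Import Order.TTheory GRing.Theory Num.Theory.
Import numFieldNormedType.Exports.

Local Open Scope classical_set_scope.
Local Open Scope ring_scope.

Import Defs.

(** Write a for the mean of phi and X^n for the point whose k-th coordinate is
    that of the n_k-th sample.

    Moments.  Every X^n has law mu, so the estimator is unbiased.  Two
    multi-indices n and m that agree exactly on the set C give a pair
    (X^n, X^m) distributed as two points that share their C-block and have
    independent blocks outside of C ([same_law_sample_pair]).  Integrating the
    independent blocks first, E[phi(X^n) phi(X^m)] is the second moment of
    mu_{C^c}(phi) ([marginal_sqr]), so the covariance of phi(X^n) and phi(X^m)
    is the variance v(C) of mu_{C^c}(phi) ([block_variance]), and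
    v(B) = sigma^2_{A,B}(mu_{A^c}(phi)) whenever B is a subset of A
    ([sigma2_blockE]).  The proportion of the pairs (n, m) that agree exactly
    on C is the product of 1/N over k in C and of 1 - 1/N over the other k;
    expanding the factors 1 - 1/N turns the double sum of the v(C) into the
    stated formula ([sum_agree]).

    Strong law.  The variance is O(1/N), hence summable along the squares
    N = j^2, and the estimator converges almost surely along the squares.  When
    phi >= 0, the sum over [N]^K is nondecreasing in N; as the ratio of
    consecutive squares tends to 1, convergence along the squares implies
    convergence ([cvg_monotone_averages]).  In general, take the positive and
    the negative parts of phi.

    Central limit theorem.  Split phi - a into its projection, the sum over k of
    h_k(x_k) with h_k = mu_{k^c}(phi) - a, and a residual.  The variances v(C)
    of the residual vanish for |C| <= 1, so the variance formula for the
    residual starts at the order N^-2 ([block_variance_residual]) and the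
    residual is negligible after multiplication by the square root of N.  The
    estimator of the projection is an ordinary empirical mean of i.i.d.
    variables with variance sigma^2_times(phi) ([estimator_projection]).

    The i.i.d. central limit theorem is obtained by Trotter's operator method.
    A law m on the line and a scale c define the operator
    T_c g (x) = int g(x + c t) m(dt) ([smear]), and E g(c (Z_1 + ... + Z_N)) is
    T_c^N g (0) for i.i.d. Z_i of law m.  For two centered laws with the same
    variance and for c = N^(-1/2), the second order Taylor formula bounds the
    distance of the two operators on g by o(1/N), uniformly ([generator]); as
    the operators commute and are contractions, their N-th powers are at
    distance o(1) ([iid_test_function_cvg]).  When the second law is normal, its
    N-th power does not depend on N, because normal laws are stable under
    convolution ([normal_stable]).  This handles twice differentiable g; a
    bounded continuous function is within e (1 + x^2) of such a g
    ([test_function_approx]), which suffices because the second moments are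
    bounded. *)

(** * Integrable and square integrable real functions *)

Notation rintegrable m f := ((m).-integrable setT (EFin \o f)).

Section rintegrable.
Context d (T : measurableType d) (R : realType).
Variable m : {measure set T -> \bar R}.
Implicit Types f g : T -> R.

Lemma rintegrable_measurable f : rintegrable m f -> measurable_fun setT f.
Proof. by move=> /(measurable_int m) /measurable_EFinP. Qed.

Lemma eq_rintegrable f g : f =1 g -> rintegrable m f -> rintegrable m g.
Proof. by move=> /funext ->. Qed.

Lemma rintegrable_le f g : measurable_fun setT f ->
  (forall x, `|f x| <= g x) -> rintegrable m g -> rintegrable m f.
Proof.
move=> mf fg; apply: le_integrable => //; first exact/measurable_EFinP.
by move=> x _; rewrite /= lee_fin (le_trans (fg x))// ler_norm.
Qed.

Lemma rintegrableD f g : rintegrable m f -> rintegrable m g ->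
  rintegrable m (fun x => f x + g x).
Proof. by move=> fi gi; apply: (integrableD measurableT fi gi). Qed.

Lemma rintegrableB f g : rintegrable m f -> rintegrable m g ->
  rintegrable m (fun x => f x - g x).
Proof. by move=> fi gi; apply: (integrableB measurableT fi gi). Qed.

Lemma rintegrableZl c f : rintegrable m f -> rintegrable m (fun x => c * f x).
Proof. by move=> fi; apply: (integrableZl measurableT c fi). Qed.

Lemma rintegrable_norm f : rintegrable m f -> rintegrable m (fun x => `|f x|).
Proof. exact: integrable_norm. Qed.

Lemma rintegrable_sum (I : Type) (s : seq I) (Q : pred I) (h : I -> T -> R) :
  (forall i, Q i -> rintegrable m (h i)) ->
  rintegrable m (fun x => \sum_(i <- s | Q i) h i x).
Proof.
move=> hi; have := integrable_sum measurableT s (h := fun i x => (h i x)%:E) hi.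
by apply: eq_integrable => // x _ /=; rewrite sumEFin.
Qed.

Lemma Rintegral_sum (I : Type) (s : seq I) (h : I -> T -> R) :
  (forall i, rintegrable m (h i)) ->
  \int[m]_x (\sum_(i <- s) h i x) = \sum_(i <- s) \int[m]_x h i x.
Proof.
move=> hi; elim: s => [|i s IHs].
  under eq_Rintegral do rewrite big_nil.
  by rewrite big_nil /Rintegral integral0.
under eq_Rintegral do rewrite big_cons.
rewrite big_cons RintegralD ?IHs//.
exact: rintegrable_sum.
Qed.

Lemma EFin_Rintegral f : rintegrable m f ->
  (\int[m]_x (f x)%:E = (\int[m]_x f x)%:E)%E.
Proof. by move=> fi; rewrite fineK//; exact: integrable_fin_num. Qed.

Lemma Rintegral_eq0 f : (forall x, f x = 0) -> \int[m]_x f x = 0.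
Proof.
move=> f0; under eq_Rintegral do rewrite f0.
by rewrite /Rintegral integral0.
Qed.

Definition square_integrable f :=
  measurable_fun setT f /\ rintegrable m (fun x => f x ^+ 2).

Lemma square_integrableM f g : square_integrable f -> square_integrable g ->
  rintegrable m (fun x => f x * g x).
Proof.
move=> [mf f2] [mg g2].
apply: (rintegrable_le _ _ (rintegrableD f2 g2)).
  exact: measurable_funM.
move=> x; have h1 := sqr_ge0 (f x - g x); have h2 := sqr_ge0 (f x + g x).
have h3 := sqr_ge0 (f x); have h4 := sqr_ge0 (g x).
rewrite sqrrB sqrrD !mulr2n in h1 h2.
by rewrite ler_norml; apply/andP; split; lra.
Qed.

Lemma square_integrableZl c f : square_integrable f ->
  square_integrable (fun x => c * f x).
Proof.
move=> [mf f2]; split; first exact: measurable_funM.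
under eq_fun do rewrite exprMn.
exact: rintegrableZl.
Qed.

Lemma square_integrableD f g : square_integrable f -> square_integrable g ->
  square_integrable (fun x => f x + g x).
Proof.
move=> fi gi; have [mf f2] := fi; have [mg g2] := gi.
split; first exact: measurable_funD.
under eq_fun do rewrite sqrrD.
apply: rintegrableD => //; apply: rintegrableD => //.
under eq_fun do rewrite -mulr_natl.
exact/rintegrableZl/square_integrableM.
Qed.

Lemma square_integrableB f g : square_integrable f -> square_integrable g ->
  square_integrable (fun x => f x - g x).
Proof.
move=> fi gi; under eq_fun do rewrite -mulN1r.
by apply: square_integrableD => //; exact: square_integrableZl.
Qed.

Lemma square_integrable_sum (I : Type) (s : seq I) (h : I -> T -> R) :
  (forall i, square_integrable (h i)) ->
  square_integrable (fun x => \sum_(i <- s) h i x).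
Proof.
move=> hi; elim: s => [|i s IHs].
  under eq_fun do rewrite big_nil.
  split => //; under eq_fun do rewrite expr0n/=; exact: integrable0.
under eq_fun do rewrite big_cons.
exact: square_integrableD.
Qed.

Lemma square_integrable_le f g : measurable_fun setT f ->
  (forall x, `|f x| <= `|g x|) -> square_integrable g -> square_integrable f.
Proof.
move=> mf fg [mg g2]; split => //; apply: (rintegrable_le _ _ g2).
  exact: measurable_funX.
by move=> x; rewrite normrX -[leRHS]real_normK ?num_real// lerXn2r ?nnegrE.
Qed.

Lemma Lfun2P f : f \in Lfun m 2%:E <-> square_integrable f.
Proof.
split=> [fL|[mf /integrableP[_ f2]]].
  split; last exact: Lfun2_integrable_sqr.
  by move: fL; rewrite inE => /andP[]; rewrite inE.
rewrite inE; apply/andP; split; rewrite inE//= /finite_norm unlock.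
apply: poweR_lty; apply: le_lt_trans f2.
rewrite le_eqVlt; apply/orP; left; apply/eqP; apply: eq_integral => x _ /=.
by rewrite powR_mulrn// -normrX.
Qed.

End rintegrable.

Section rintegrable_probability.
Context d (T : measurableType d) (R : realType) (m : probability T R).
Implicit Types f g : T -> R.

Lemma rintegrable_cst (c : R) : rintegrable m (fun=> c).
Proof. exact: finite_measure_integrable_cst. Qed.

Lemma rintegrable_bounded f M : measurable_fun setT f ->
  (forall x, `|f x| <= M) -> rintegrable m f.
Proof. by move=> mf fM; apply: rintegrable_le (rintegrable_cst M). Qed.

Lemma square_integrable_cst (c : R) : square_integrable m (fun=> c).
Proof. by split => //; exact: rintegrable_cst. Qed.

Lemma square_integrable_rintegrable f :
  square_integrable m f -> rintegrable m f.
Proof.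
move=> fi; have := square_integrableM fi (square_integrable_cst 1).
by under eq_fun do rewrite mulr1.
Qed.

Lemma Rintegral_prob_cst (c : R) : \int[m]_x c = c.
Proof. by rewrite Rintegral_cst// [X in fine X]probability_setT mulr1. Qed.

Lemma le_Rintegral_bound f M : measurable_fun setT f ->
  (forall x, `|f x| <= M) -> `|\int[m]_x f x| <= M.
Proof.
move=> mf fM; have fi := rintegrable_bounded mf fM.
apply: (le_trans (le_normr_Rintegral measurableT fi)).
rewrite -[leRHS]Rintegral_prob_cst; apply: le_Rintegral => //.
  exact: rintegrable_norm.
exact: rintegrable_cst.
Qed.

Lemma variance_Rintegral f : square_integrable m f ->
  \int[m]_x (f x - \int[m]_x f x) ^+ 2 =
  \int[m]_x f x ^+ 2 - (\int[m]_x f x) ^+ 2.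
Proof.
move=> fi; set a := \int[m]_x f x.
have fi1 := square_integrable_rintegrable fi.
have -> : \int[m]_x (f x - a) ^+ 2 = \int[m]_x (f x ^+ 2 - ((2 * a) * f x - a ^+ 2)).
  by apply: eq_Rintegral => x _; ring.
case: fi => mf f2.
have i1 := rintegrableZl (2 * a) fi1; have i2 := rintegrable_cst (a ^+ 2).
rewrite RintegralB//; last exact: rintegrableB.
by rewrite RintegralB// RintegralZl// Rintegral_prob_cst -/a; ring.
Qed.

Lemma sqr_Rintegral_le f : square_integrable m f ->
  (\int[m]_x f x) ^+ 2 <= \int[m]_x f x ^+ 2.
Proof.
move=> fi; rewrite -subr_ge0 -variance_Rintegral//.
by apply: Rintegral_ge0 => x _; exact: sqr_ge0.
Qed.

Lemma variance_EFin f : square_integrable m f ->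
  'V_m[f] = (\int[m]_x f x ^+ 2 - (\int[m]_x f x) ^+ 2)%:E.
Proof.
move=> fi; have fi1 := square_integrable_rintegrable fi.
rewrite varianceE; last exact/Lfun2P.
rewrite !unlock EFinB -EFin_Rintegral; last by case: fi.
by rewrite EFin_expe -EFin_Rintegral.
Qed.

End rintegrable_probability.

Section rintegrable_product.
Context d1 d2 (T1 : measurableType d1) (T2 : measurableType d2) (R : realType).
Variables (m1 : probability T1 R) (m2 : probability T2 R).

Lemma rintegrable_tensor (f : T1 -> R) (g : T2 -> R) :
  rintegrable m1 f -> rintegrable m2 g ->
  rintegrable (m1 \x m2)%E (fun u => f u.1 * g u.2).
Proof.
move=> fi gi; have mf := rintegrable_measurable fi.
have mg := rintegrable_measurable gi.
apply/integrable12ltyP.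
  apply/measurable_EFinP; apply: measurable_funM.
    exact: (measurableT_comp mf measurable_fst).
  exact: (measurableT_comp mg measurable_snd).
have /integrableP[_ fy] := fi; have /integrableP[_ gy] := gi.
under eq_integral => x _.
  under eq_integral => y _ do rewrite /= normrM EFinM.
  rewrite ge0_integralZl//; last exact/measurable_EFinP/measurableT_comp.
  over.
rewrite ge0_integralZr//; last 2 first.
- exact/measurable_EFinP/measurableT_comp.
- by apply: integral_ge0.
apply: lte_mul_pinfty => //; first exact: integral_ge0.
by rewrite ge0_fin_numE//; exact: integral_ge0.
Qed.

(** Integrability on the product only makes almost every section integrable,
    whereas a real-valued inner integral is meaningful at each point only if
    every section is. *)
Lemma Rintegral_fubini (F : T1 * T2 -> R) : rintegrable (m1 \x m2)%E F ->
  (forall x, rintegrable m2 (fun y => F (x, y))) ->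
  rintegrable m1 (fun x => \int[m2]_y F (x, y)) /\
  \int[(m1 \x m2)%E]_u F u = \int[m1]_x \int[m2]_y F (x, y).
Proof.
move=> Fi F2.
have E x : (fubini_F m2 (EFin \o F) x = (\int[m2]_y F (x, y))%:E)%E.
  by rewrite /fubini_F /= EFin_Rintegral.
split.
  have := integrable_fubini_F Fi.
  by apply: eq_integrable => // x _; rewrite E.
congr fine; rewrite -(integral12_prod_meas1 Fi).
by apply: eq_integral => x _; rewrite E.
Qed.

End rintegrable_product.

(** * Variables with the same law *)

Section laws.
Context (R : realType) d1 d2 d (T1 : measurableType d1) (T2 : measurableType d2)
  (U : measurableType d).
Variables (m1 : {measure set T1 -> \bar R}) (m2 : {measure set T2 -> \bar R}).
Variables (h1 : T1 -> U) (h2 : T2 -> U).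

(** Two variables may be defined on different measure spaces; a change of
    variables from one to the other only requires this relation. *)
Definition same_law := [/\ measurable_fun setT h1, measurable_fun setT h2 &
  forall B, measurable B -> m1 (h1 @^-1` B) = m2 (h2 @^-1` B)].

Hypothesis h12 : same_law.

Let mh1 : measurable_fun setT h1. Proof. by case: h12. Qed.
Let mh2 : measurable_fun setT h2. Proof. by case: h12. Qed.
#[local] HB.instance Definition _ := isMeasurableFun.Build _ _ _ _ h1 mh1.
#[local] HB.instance Definition _ := isMeasurableFun.Build _ _ _ _ h2 mh2.

Lemma same_law_ge0_integral (f : U -> \bar R) :
  measurable_fun setT f -> (forall x, 0 <= f x)%E ->
  (\int[m1]_x f (h1 x) = \int[m2]_x f (h2 x))%E.
Proof.
move=> mf f0.
rewrite -[LHS](@ge0_integral_pushforward _ _ _ _ _ h1 mh1 m1 setT f)//.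
rewrite -[RHS](@ge0_integral_pushforward _ _ _ _ _ h2 mh2 m2 setT f)//.
by apply: eq_measure_integral => A mA _; case: h12 => _ _ /(_ _ mA).
Qed.

Lemma same_law_integrable (f : U -> \bar R) : measurable_fun setT f ->
  m1.-integrable setT (f \o h1) -> m2.-integrable setT (f \o h2).
Proof.
move=> mf /integrableP[_ i1]; apply/integrableP; split.
  exact: measurableT_comp.
rewrite -(@same_law_ge0_integral (fun x => `|f x|%E))//.
exact: measurableT_comp.
Qed.

Lemma same_law_integral (f : U -> \bar R) : measurable_fun setT f ->
  (\int[m1]_x f (h1 x) = \int[m2]_x f (h2 x))%E.
Proof.
move=> mf; rewrite [LHS]integralE [RHS]integralE; congr (_ - _)%E.
  rewrite (funepos_comp f h1) (funepos_comp f h2).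
  exact: (same_law_ge0_integral (measurable_funepos mf) (funepos_ge0 f)).
rewrite (funeneg_comp f h1) (funeneg_comp f h2).
exact: (same_law_ge0_integral (measurable_funeneg mf) (funeneg_ge0 f)).
Qed.

Lemma same_law_Rintegral (f : U -> R) : measurable_fun setT f ->
  \int[m1]_x f (h1 x) = \int[m2]_x f (h2 x).
Proof.
move=> /measurable_EFinP mf; congr fine; exact: (same_law_integral mf).
Qed.

Lemma same_law_square_integrable (f : U -> R) : measurable_fun setT f ->
  square_integrable m1 (f \o h1) -> square_integrable m2 (f \o h2).
Proof.
move=> mf [_ f2]; split; first exact: measurableT_comp.
apply: (same_law_integrable (f := fun x => (f x ^+ 2)%:E)) f2.
by apply/measurable_EFinP; exact: measurable_funX.
Qed.

End laws.

Lemma same_law_sym (R : realType) d1 d2 d (T1 : measurableType d1)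
  (T2 : measurableType d2) (U : measurableType d)
  (m1 : {measure set T1 -> \bar R}) (m2 : {measure set T2 -> \bar R})
  (h1 : T1 -> U) (h2 : T2 -> U) :
  same_law m1 m2 h1 h2 -> same_law m2 m1 h2 h1.
Proof. by case=> ? ? h; split => // B mB; rewrite h. Qed.

Section rectangles.
Context (R : realType) (I : finType) (d : I -> measure_display).
Context (T : forall i, measurableType (d i)).

Definition rectangle (A : forall i, set (T i)) : set (prod_space T) :=
  [set x | forall i, A i (x i)].

Lemma rectangleE A : rectangle A =
  \big[setI/setT]_(i : I) ((fun x : prod_space T => x i) @^-1` A i).
Proof.
rewrite -bigcap_seq_cond; apply/seteqP; split => x.
  by move=> Ax i _; exact: Ax.
by move=> Ax i; apply: Ax; rewrite /= mem_index_enum.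
Qed.

Lemma measurable_rectangle A : (forall i, measurable (A i)) ->
  measurable (rectangle A).
Proof.
move=> mA; rewrite rectangleE; apply: bigsetI_measurable => i _.
by rewrite -[X in measurable X]setTI; exact: measurable_coord.
Qed.

(** Rectangles are stable under intersection and generate the product
    sigma-algebra. *)
Lemma rectangle_measure_unique (m1 m2 : probability (prod_space T) R) :
  (forall A, (forall i, measurable (A i)) ->
     m1 (rectangle A) = m2 (rectangle A)) ->
  forall B, measurable B -> m1 B = m2 B.
Proof.
move=> m12.
pose G : set (set (prod_space T)) :=
  [set rectangle A | A in [set A | forall i, measurable (A i)]].
apply: (@measure_unique _ _ _ G (fun=> setT)).
- apply/seteqP; split.
    apply: smallest_sub; first exact: smallest_sigma_algebra.
    move=> _ [i _ [A mA <-]]; apply: sub_sigma_algebra.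
    exists (dfwith (fun j => [set: T j]) i A).
      by move=> j; case: dfwithP.
    rewrite setTI; apply/seteqP; split => x /=.
      by move=> /(_ i); rewrite dfwithin.
    by move=> Ax j; case: dfwithP.
  apply: smallest_sub; first exact: sigma_algebra_measurable.
  by move=> _ [A mA <-]; exact: measurable_rectangle.
- move=> _ _ [A mA <-] [B mB <-]; exists (fun i => A i `&` B i).
    by move=> i; exact: measurableI.
  by apply/seteqP; split => x /=; [move=> H; split => i; have [] := H i|move=> [? ?]].
- move=> _; exists (fun=> setT); first by move=> i /=.
  by apply/seteqP.
- by rewrite bigcup_const.
- by move=> _ [A mA <-]; exact: m12.
- by move=> _; rewrite [X in (X < _)%E]probability_setT ltry.
Qed.

End rectangles.

(** * Two points sharing a block of coordinates *)

Lemma same_law_rectangle (R : realType) d1 d2 (T1 : measurableType d1)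
    (T2 : measurableType d2) (I : finType) (d : I -> measure_display)
    (T : forall i, measurableType (d i))
    (m1 : probability T1 R) (m2 : probability T2 R)
    (h1 : T1 -> prod_space T) (h2 : T2 -> prod_space T) :
  measurable_fun setT h1 -> measurable_fun setT h2 ->
  (forall A, (forall i, measurable (A i)) ->
    m1 (h1 @^-1` rectangle A) = m2 (h2 @^-1` rectangle A)) ->
  same_law m1 m2 h1 h2.
Proof.
move=> mh1 mh2 h12; split => // B mB.
pose b1 := isMeasurableFun.Build _ _ _ _ h1 mh1.
pose b2 := isMeasurableFun.Build _ _ _ _ h2 mh2.
pose H1 : {mfun T1 >-> prod_space T} := HB.pack h1 b1.
pose H2 : {mfun T2 >-> prod_space T} := HB.pack h2 b2.
exact: (@rectangle_measure_unique _ _ _ _ (distribution m1 H1)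
  (distribution m2 H2) h12 B mB).
Qed.

Lemma measurable_coord_comp d' (U : measurableType d') (I : finType)
    (d : I -> measure_display) (T : forall i, measurableType (d i))
    (f : U -> prod_space T) i :
  measurable_fun setT f -> measurable_fun setT (fun u => f u i).
Proof. exact: (measurableT_comp (@measurable_coord _ _ T i)). Qed.

Section merge.
Context (R : realType) (K : nat) (d : 'I_K -> measure_display).
Context (S : forall k, measurableType (d k)).

Lemma mergeL (A B : {set 'I_K}) (x : block S A) (y : block S B) k
  (kA : k \in A) : merge x y k = x (exist _ k kA).
Proof.
rewrite /merge; case: {-}_ / idP => // kA'.
by congr (x (exist _ k _)); exact: bool_irrelevance.
Qed.

Lemma mergeR (A B : {set 'I_K}) (x : block S A) (y : block S B) k
  (kB : k \in B) : k \notin A -> merge x y k = y (exist _ k kB).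
Proof.
move=> /negP kA; rewrite /merge; case: {-}_ / idP => // kA'.
case: {-}_ / idP => // kB'.
by congr (y (exist _ k _)); exact: bool_irrelevance.
Qed.

Lemma mergeN (A B : {set 'I_K}) (x : block S A) (y : block S B) k :
  k \notin A -> k \notin B -> merge x y k = point.
Proof.
move=> /negP kA /negP kB; rewrite /merge; case: {-}_ / idP => // kA'.
by case: {-}_ / idP.
Qed.

Lemma measurable_merge d' (U : measurableType d') (A B : {set 'I_K})
    (f : U -> block S A) (g : U -> block S B) :
  measurable_fun setT f -> measurable_fun setT g ->
  measurable_fun setT (fun u => merge (f u) (g u)).
Proof.
move=> mf mg; apply: measurable_to_prod => k; rewrite /merge.
case: {-}_ / idP => [kA|_].
  exact: (measurable_coord_comp (i := exist _ k kA) mf).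
case: {-}_ / idP => [kB|_].
  exact: (measurable_coord_comp (i := exist _ k kB) mg).
exact: measurable_cst.
Qed.

End merge.

Section pairs.
Context (K : nat) (d : 'I_K -> measure_display).
Context (S : forall k, measurableType (d k)).

(** A pair of points of the product is itself a point of a product, indexed by
    ['I_K * bool]: laws of pairs can then be compared on rectangles, coordinate
    by coordinate. *)
Definition pair_space := prod_space (fun s : 'I_K * bool => S s.1).

Definition pair_point (x y : prod_space S) : pair_space :=
  fun s => if s.2 then x s.1 else y s.1.

Definition pair_proj (b : bool) (u : pair_space) : prod_space S :=
  fun k => u (k, b).

Lemma measurable_pair_proj b : measurable_fun setT (pair_proj b).
Proof.
by apply: measurable_to_prod => k; exact: (@measurable_coord _ _ _ (k, b)).
Qed.

Lemma measurable_pair_point d' (U : measurableType d') (f g : U -> prod_space S) :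
  measurable_fun setT f -> measurable_fun setT g ->
  measurable_fun setT (fun u => pair_point (f u) (g u)).
Proof.
move=> mf mg; apply: measurable_to_prod => -[k []] /=.
  exact: (measurable_coord_comp (i := k) mf).
exact: (measurable_coord_comp (i := k) mg).
Qed.

Context (R : realType) (mu : forall k, probability (S k) R).
Local Open Scope ereal_scope.

(** The first component is the block shared by the two points, the other two
    are their own blocks on the complement. *)
Definition glue_blocks (C : {set 'I_K})
    (u : (block S C * (block S (~: C) * block S (~: C)))%type) :
    pair_space :=
  pair_point (merge u.2.1 u.1) (merge u.2.2 u.1).

Definition glue_prob (C : {set 'I_K}) :
    probability (block S C * (block S (~: C) * block S (~: C)))%type R :=
  (block_prob mu C \x (block_prob mu (~: C) \x block_prob mu (~: C)))%E.

Lemma measurable_glue_blocks C : measurable_fun setT (@glue_blocks C).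
Proof.
apply: measurable_pair_point; apply: measurable_merge.
- exact: (measurableT_comp measurable_fst measurable_snd).
- exact: measurable_fst.
- exact: (measurableT_comp measurable_snd measurable_snd).
- exact: measurable_fst.
Qed.

Lemma block_probE (C : {set 'I_K}) (A : forall k, set (S k)) :
  (forall k, measurable (A k)) ->
  block_prob mu C [set x | forall k : {k | k \in C}, A (val k) (x k)] =
  \prod_(k in C) mu k (A k).
Proof.
move=> mA; rewrite /block_prob (@prod_probE _ _ _ _ _ (fun k => A (val k)))//.
by rewrite -(big_sub _ (fun k => mu k (A k))).
Qed.

Lemma glue_prob_rectangle C (A : forall s : 'I_K * bool, set (S s.1)) :
  (forall s, measurable (A s)) ->
  glue_prob C (@glue_blocks C @^-1` rectangle A) =
  \prod_(k < K) if k \in C then mu k (A (k, true) `&` A (k, false))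
    else mu k (A (k, true)) * mu k (A (k, false)).
Proof.
move=> mA.
pose rect C' (B : forall k, set (S k)) : set (block S C') :=
  [set x | forall k : {k | k \in C'}, B (val k) (x k)].
have mrect C' B : (forall k, measurable (B k)) -> measurable (rect C' B).
  move=> mB; exact: (@measurable_rectangle _ _ _ (fun k => B (val k))).
have mI k : measurable (A (k, true) `&` A (k, false)).
  exact: (measurableI _ _ (mA (k, true)) (mA (k, false))).
have -> : @glue_blocks C @^-1` rectangle A =
   rect C (fun k => A (k, true) `&` A (k, false)) `*`
   (rect (~: C) (fun k => A (k, true)) `*` rect (~: C) (fun k => A (k, false))).
  apply/seteqP; split => -[z [y y']] /=.
    move=> H; split; last split.
    - move=> [k kC]; have kNC : k \notin ~: C by rewrite inE kC.
      split; [have := H (k, true)|have := H (k, false)];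
        by rewrite /glue_blocks /pair_point /= (mergeR _ _ kC kNC).
    - by move=> [k kC]; have := H (k, true); rewrite /glue_blocks /pair_point /= mergeL.
    - by move=> [k kC]; have := H (k, false); rewrite /glue_blocks /pair_point /= mergeL.
  move=> [Hz [Hy Hy']] [k b]; rewrite /glue_blocks /pair_point /=.
  have [kC|kC] := boolP (k \in ~: C).
    case: b; rewrite mergeL.
      exact: (Hy (exist _ k kC)).
    exact: (Hy' (exist _ k kC)).
  have kC' : k \in C by move: kC; rewrite inE negbK.
  have [Ht Hf] := Hz (exist _ k kC').
  by case: b; rewrite (mergeR _ _ kC').
rewrite [LHS]product_measure1E//; last 2 first.
- exact: mrect.
- by apply: measurableX; apply: mrect => k; exact: mA.
rewrite [X in _ * X]product_measure1E//; last 2 first.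
- by apply: mrect => k; exact: mA.
- by apply: mrect => k; exact: mA.
have mA1 k : measurable (A (k, true)) by exact: mA.
have mA2 k : measurable (A (k, false)) by exact: mA.
rewrite [X in X * _](block_probE C mI) [X in _ * (X * _)](block_probE _ mA1).
rewrite [X in _ * (_ * X)](block_probE _ mA2) -big_split /=.
rewrite [RHS](bigID (mem C)) /=; congr (_ * _).
  by apply: eq_bigr => k ->.
by apply: eq_big => k; rewrite ?inE// => /negbTE ->.
Qed.

Lemma same_law_glue (C : {set 'I_K}) b :
  same_law (glue_prob C) (prod_prob mu)
    (fun u => pair_proj b (glue_blocks u)) id.
Proof.
apply: same_law_rectangle; [|exact: measurable_id|].
  exact: (measurableT_comp (measurable_pair_proj b) (@measurable_glue_blocks C)).
move=> A mA; rewrite preimage_id [RHS]prod_probE//.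
pose B (s : 'I_K * bool) : set (S s.1) := if s.2 == b then A s.1 else setT.
have mB s : measurable (B s).
  by rewrite /B; case: ifP => _; [exact: mA|exact: measurableT].
have := glue_prob_rectangle C mB.
have -> : @glue_blocks C @^-1` rectangle B =
    (fun u => pair_proj b (@glue_blocks C u)) @^-1` rectangle A.
  apply/seteqP; split => u /= H.
    by move=> k; have := H (k, b); rewrite /B /= eqxx.
  by move=> [k b']; rewrite /B /=; case: eqP => [->|//]; exact: H.
move=> ->; apply: eq_bigr => k _; rewrite /B /=.
by case: (b); rewrite /= ?setIT ?setTI probability_setT ?mule1 ?mul1e; case: ifP.
Qed.

End pairs.

(** * Laws of the points built from the sample *)

Section sample.
Context (R : realType) (K : nat) (d : 'I_K -> measure_display).
Context (S : forall k, measurableType (d k)).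
Variable mu : forall k, probability (S k) R.
Context (dO : measure_display) (Omega : measurableType dO).
Context (P : probability Omega R) (X : nat -> {RV P >-> prod_space S}).
Hypothesis hX : iid_with_law X (prod_prob mu).

Definition sample_point (n : 'I_K -> nat) (omega : Omega) : prod_space S :=
  fun k => X (n k) omega k.

Lemma measurable_sample_point n : measurable_fun setT (sample_point n).
Proof.
apply: measurable_to_prod => k.
by apply: (measurable_coord_comp (f := X (n k)) (i := k)).
Qed.

(** The independence of the samples and the product form of [mu] make all the
    cells [X i omega k] independent. *)
Lemma sample_cells N (A : nat -> forall k, set (S k)) :
  (forall i k, measurable (A i k)) ->
  P [set omega | forall i, (i < N)%N -> forall k, A i k (X i omega k)] =
  (\prod_(i < N) \prod_(k < K) mu k (A i k))%E.
Proof.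
move=> mA; case: hX => law indep.
have mr i : measurable (rectangle (A i)).
  by apply: measurable_rectangle => k; exact: mA.
transitivity (P (\bigcap_(n in [set` iota 0 N]) (X n @^-1` rectangle (A n)))).
  congr (P _); apply/seteqP; split => w /=.
    by move=> H i /=; rewrite mem_iota add0n => /andP[_ iN]; exact: H.
  by move=> H i iN; apply: H; rewrite /= mem_iota add0n leq0n.
rewrite indep ?iota_uniq// -(big_mkord xpredT (fun i => \prod_(k < K) mu k (A i k))%E).
rewrite /index_iota subn0; apply: eq_bigr => i _.
by rewrite -prod_probE; [exact: law|exact: mA].
Qed.

(** On a rectangle, a coordinate where [n] and [m] agree constrains a single
    cell of the sample twice, the others constrain two different cells: this
    is what the gluing of two points along the agreement set gives. *)
Lemma same_law_sample_pair (n m : 'I_K -> nat) :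
  same_law P (glue_prob mu [set k | n k == m k]%SET)
    (fun omega => pair_point (sample_point n omega) (sample_point m omega))
    (@glue_blocks _ _ S _).
Proof.
apply: same_law_rectangle.
- by apply: measurable_pair_point; exact: measurable_sample_point.
- exact: measurable_glue_blocks.
move=> A mA; rewrite glue_prob_rectangle//.
(* only the first N samples are involved *)
pose N := (\max_(k < K) maxn (n k) (m k)).+1.
have nN k : (n k < N)%N.
  rewrite ltnS; exact: (leq_trans (leq_maxl _ _) (leq_bigmax (F := fun k => maxn (n k) (m k)) k)).
have mN k : (m k < N)%N.
  rewrite ltnS; exact: (leq_trans (leq_maxr _ _) (leq_bigmax (F := fun k => maxn (n k) (m k)) k)).
pose B i k := (if i == n k then A (k, true) else setT) `&`
              (if i == m k then A (k, false) else setT).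
have mB i k : measurable (B i k).
  apply: measurableI.
    by case: (i == n k); [exact: (mA (k, true))|exact: measurableT].
  by case: (i == m k); [exact: (mA (k, false))|exact: measurableT].
transitivity (P [set omega | forall i, (i < N)%N ->
    forall k, B i k (X i omega k)]).
  congr (P _); apply/seteqP; split => w /=.
    move=> H i iN k; split; case: eqP => // ->.
      exact: (H (k, true)).
    exact: (H (k, false)).
  move=> H [k []]; rewrite /pair_point /sample_point /=.
    by have [+ _] := H _ (nN k) k; rewrite eqxx.
  by have [_ +] := H _ (mN k) k; rewrite eqxx.
rewrite sample_cells// exchange_big/=; apply: eq_bigr => k _; rewrite inE.
rewrite (bigD1 (Ordinal (nN k)))//= /B eqxx.
case: eqP => [nm|/eqP nm].
  rewrite big1 ?mule1// => i; rewrite -val_eqE /= => /negbTE iN.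
  by rewrite -nm iN setIT probability_setT.
rewrite setIT (bigD1 (Ordinal (mN k)))/=; last by rewrite -val_eqE /= eq_sym.
rewrite eqxx eq_sym (negbTE nm) setTI big1 ?mule1//.
move=> i /andP[]; rewrite -!val_eqE /= => /negbTE -> /negbTE ->.
by rewrite setIT probability_setT.
Qed.

Lemma same_law_sample_point (n : 'I_K -> nat) :
  same_law P (prod_prob mu) (sample_point n) id.
Proof.
apply: same_law_rectangle; [exact: measurable_sample_point|exact: measurable_id|].
move=> A mA; rewrite preimage_id [RHS]prod_probE//.
pose N := (\max_(k < K) n k).+1.
have nN k : (n k < N)%N.
  rewrite ltnS; exact: leq_bigmax.
pose B i k := if i == n k then A k else setT.
have mB i k : measurable (B i k) by rewrite /B; case: ifP.
transitivity (P [set omega | forall i, (i < N)%N ->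
    forall k, B i k (X i omega k)]).
  congr (P _); apply/seteqP; split => w /=.
    by move=> H i iN k; rewrite /B; case: eqP => // ->; exact: H.
  by move=> H k; have := H _ (nN k) k; rewrite /B eqxx.
rewrite sample_cells// exchange_big/=; apply: eq_bigr => k _.
rewrite (bigD1 (Ordinal (nN k)))//= /B eqxx big1 ?mule1// => i.
by rewrite -val_eqE /= => /negbTE ->; rewrite probability_setT.
Qed.

End sample.

Lemma same_law_merge (R : realType) (K : nat) (d : 'I_K -> measure_display)
    (S : forall k, measurableType (d k)) (mu : forall k, probability (S k) R)
    (C : {set 'I_K}) :
  same_law (block_prob mu C \x block_prob mu (~: C))%E (prod_prob mu)
    (fun u : (block S C * block S (~: C))%type => merge u.2 u.1) id.
Proof.
apply: same_law_rectangle; [|exact: measurable_id|].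
  by apply: measurable_merge; [exact: measurable_snd|exact: measurable_fst].
move=> A mA; rewrite preimage_id [RHS]prod_probE//.
pose rect C' : set (block S C') :=
  [set x | forall k : {k | k \in C'}, A (val k) (x k)].
have mrect C' : measurable (rect C').
  exact: (@measurable_rectangle _ _ _ (fun k : {k | k \in C'} => A (val k))).
have -> : (fun u : (block S C * block S (~: C))%type => merge u.2 u.1) @^-1`
    rectangle A = rect C `*` rect (~: C).
  apply/seteqP; split => -[z y] /=.
    move=> H; split => -[k kC] /=; have := H k; last by rewrite mergeL.
    by rewrite (mergeR _ _ kC)// inE kC.
  move=> [Hz Hy] k; have [kC|kC] := boolP (k \in ~: C)%SET.
    by rewrite mergeL; exact: (Hy (exist _ k kC)).
  have kC' : k \in C by move: kC; rewrite inE negbK.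
  by rewrite (mergeR _ _ kC')//; exact: (Hz (exist _ k kC')).
rewrite [LHS]product_measure1E// [X in (X * _)%E](block_probE mu C mA).
rewrite [X in (_ * X)%E](block_probE mu (~: C)%SET mA).
by rewrite [RHS](bigID (mem C)) /=; congr (_ * _)%E; apply: eq_bigl => k; rewrite inE.
Qed.

(** * Marginals and their variances *)

Section marginals.
Context (R : realType) (K : nat) (d : 'I_K -> measure_display).
Context (S : forall k, measurableType (d k)).
Variable mu : forall k, probability (S k) R.
Variable phi : prod_space S -> R.
Hypothesis mphi : measurable_fun setT phi.
Hypothesis pphi : partially_integrable mu phi.

(** [partially_integrable] speaks of blocks indexed by a complement, marginals
    of blocks indexed by a set: the types [block S B] and [block S (~: ~: B)]
    are not convertible, so points are transported through [prod_space S]. *)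
Lemma merge_setCK (B : {set 'I_K}) (x : block S B) :
  exists x' : block S (~: ~: B), forall y : block S (~: B),
    merge y x' = merge y x.
Proof.
exists (@restr _ _ S (~: ~: B)%SET (merge x x)) => y.
apply: functional_extensionality_dep => k.
have [kB|kB] := boolP (k \in (~: B)%SET); first by rewrite !mergeL.
have kB' : k \in B by move: kB; rewrite inE negbK.
have kB2 : k \in (~: ~: B)%SET by rewrite inE.
by rewrite (mergeR _ _ kB2)// (mergeR _ _ kB')// /restr /= mergeL.
Qed.

Lemma rintegrable_section (B : {set 'I_K}) (x : block S B) :
  rintegrable (block_prob mu (~: B)) (fun y => phi (merge y x)).
Proof.
have [x' xE] := merge_setCK x.
by apply: eq_rintegrable (pphi x') => y; rewrite xE.
Qed.

Hypothesis iphi : rintegrable (prod_prob mu) phi.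

Let rintegrable_merge (B : {set 'I_K}) :
  rintegrable (block_prob mu B \x block_prob mu (~: B))%E
    (fun u : (block S B * block S (~: B))%type => phi (merge u.2 u.1)).
Proof.
apply: (same_law_integrable (same_law_sym (same_law_merge mu B))
  (f := EFin \o phi)) => //.
exact/measurable_EFinP.
Qed.

Lemma rintegrable_marginal (B : {set 'I_K}) :
  rintegrable (block_prob mu B) (marginal mu phi : block S B -> R).
Proof.
by have [] := Rintegral_fubini (@rintegrable_merge B)
  (fun x => rintegrable_section x).
Qed.

Lemma Rintegral_marginal (B : {set 'I_K}) :
  \int[block_prob mu B]_x marginal mu phi x = \int[prod_prob mu]_x phi x.
Proof.
have [_ <-] := Rintegral_fubini (@rintegrable_merge B)
  (fun x => rintegrable_section x).
exact: (same_law_Rintegral (same_law_merge mu B) mphi).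
Qed.

Let same_law_tower (A B : {set 'I_K}) : B \subset A ->
  same_law (block_prob mu (A :\: B) \x block_prob mu (~: A))%E
    (block_prob mu (~: B))
    (fun u : (block S (A :\: B) * block S (~: A))%type =>
       @restr _ _ S (~: B)%SET (merge u.2 u.1)) id.
Proof.
move=> BA; apply: same_law_rectangle; [|exact: measurable_id|].
  apply: measurable_to_prod => k; apply: (measurable_coord_comp
    (f := fun u : (block S (A :\: B) * block S (~: A))%type => merge u.2 u.1)
    (i := val k)).
  by apply: measurable_merge; [exact: measurable_snd|exact: measurable_fst].
move=> D mD; rewrite preimage_id [RHS]prod_probE//.
pose E (k : 'I_K) : set (S k) :=
  match @idP (k \in (~: B)%SET) with
  | ReflectT kB => D (exist _ k kB)
  | _ => setT
  end.
have EE (k : {k | k \in (~: B)%SET}) : E (val k) = D k.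
  case: k => k kB; rewrite /E /=; case: {-}_ / idP => // kB'.
  by congr (D (exist _ k _)); exact: bool_irrelevance.
have mE k : measurable (E k).
  by rewrite /E; case: {-}_ / idP => // kB; exact: mD.
pose rect C' : set (block S C') :=
  [set x | forall k : {k | k \in C'}, E (val k) (x k)].
have mrect C' : measurable (rect C').
  exact: (@measurable_rectangle _ _ _ (fun k : {k | k \in C'} => E (val k))
    (fun k => mE (val k))).
have AB k : (k \in ~: B)%SET -> (k \notin ~: A)%SET -> (k \in A :\: B)%SET.
  by rewrite !inE negbK => -> ->.
have -> : (fun u : (block S (A :\: B) * block S (~: A))%type =>
       @restr _ _ S (~: B)%SET (merge u.2 u.1)) @^-1`
    rectangle D = rect (A :\: B)%SET `*` rect (~: A)%SET.
  apply/seteqP; split => -[z y] /=.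
    move=> H; split => -[k kC] /=.
      have kB : (k \in ~: B)%SET by move: kC; rewrite !inE => /andP[].
      have kA : (k \notin ~: A)%SET by move: kC; rewrite !inE negbK => /andP[].
      have := H (exist _ k kB); rewrite /restr /= (mergeR _ _ kC)//.
      by rewrite -(EE (exist _ k kB)).
    have kB : (k \in ~: B)%SET.
      by move: kC; rewrite !inE; apply: contra; exact: (fintype.subsetP BA).
    have := H (exist _ k kB); rewrite /restr /= mergeL.
    by rewrite -(EE (exist _ k kB)).
  move=> [Hz Hy] [k kB]; rewrite -EE /restr /=.
  have [kA|kA] := boolP (k \in ~: A)%SET.
    by rewrite mergeL; exact: (Hy (exist _ k kA)).
  have kC := AB k kB kA.
  by rewrite (mergeR _ _ kC)//; exact: (Hz (exist _ k kC)).
rewrite [LHS]product_measure1E// [X in (X * _)%E](block_probE mu _ mE).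
rewrite [X in (_ * X)%E](block_probE mu (~: A)%SET mE).
under [RHS]eq_bigr do rewrite -EE.
rewrite -(big_sub _ (fun k => mu k (E k))) [RHS](bigID (mem A)) /=.
congr (_ * _)%E; apply: eq_bigl => k; rewrite !inE//.
by have /implyP := fintype.subsetP BA k; case: (k \in A); case: (k \in B).
Qed.

(** Integrating out the complement of [A] and then [A :\: B] amounts to
    integrating out the complement of [B]. *)
Lemma block_marginal_marginal (A B : {set 'I_K}) (x : block S B) :
  B \subset A ->
  block_marginal mu (marginal mu phi : block S A -> R) x = marginal mu phi x.
Proof.
move=> BA; rewrite /block_marginal /marginal.
have law := same_law_tower BA.
have msec : measurable_fun setT (fun v : block S (~: B) => phi (merge v x)).
  apply: measurableT_comp => //; apply: measurable_merge => //.
rewrite -(same_law_Rintegral law msec).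
have isec := same_law_integrable (same_law_sym law)
  (f := EFin \o (fun v : block S (~: B) => phi (merge v x)))
  _ (rintegrable_section x).
have E (y : block S (A :\: B)) (w : block S (~: A)) :
    merge (@restr _ _ S (~: B)%SET (merge w y)) x =
    merge w (@restr _ _ S A (merge y x)).
  apply: functional_extensionality_dep => k.
  have [kA|kA] := boolP (k \in (~: A)%SET).
    have kB : (k \in ~: B)%SET.
      by move: kA; rewrite !inE; apply: contra; exact: (fintype.subsetP BA).
    by rewrite (mergeL _ _ kB) (mergeL _ _ kA) /restr /= (mergeL _ _ kA).
  have kA' : k \in A by move: kA; rewrite inE negbK.
  rewrite [RHS](mergeR _ _ kA')// /restr /=.
  have [kB|kB] := boolP (k \in B).
    have kNB : k \notin (~: B)%SET by rewrite inE kB.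
    have kD : k \notin (A :\: B)%SET by rewrite inE kB.
    by rewrite !(mergeR _ _ kB).
  have kNB : k \in (~: B)%SET by rewrite inE.
  have kD : k \in (A :\: B)%SET by rewrite inE kB.
  by rewrite (mergeL _ _ kNB) (mergeL _ _ kD) /restr /= (mergeR _ _ kD).
have [|y|_ ->] := Rintegral_fubini (m1 := block_prob mu (A :\: B))
  (m2 := block_prob mu (~: A))
  (F := fun u : (block S (A :\: B) * block S (~: A))%type =>
     phi (merge (@restr _ _ S (~: B)%SET (merge u.2 u.1)) x)).
- by apply: isec; exact/measurable_EFinP.
- have := rintegrable_section (@restr _ _ S A (merge y x)).
  by apply: eq_rintegrable => w; rewrite /= E.
by apply: eq_Rintegral => y _; apply: eq_Rintegral => w _; rewrite /= E.
Qed.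

Hypothesis phi2 : square_integrable (prod_prob mu) phi.

(** Given the shared block, the two glued points are independent with the same
    law, so the conditional mean of the product of the values of [phi] is the
    square of the marginal.  The product is integrable as a product of two
    square integrable functions, whence the first part. *)
Lemma marginal_sqr (C : {set 'I_K}) :
  rintegrable (block_prob mu C) (fun x : block S C => marginal mu phi x ^+ 2) /\
  \int[glue_prob mu C]_u
     (phi (pair_proj true (glue_blocks u)) * phi (pair_proj false (glue_blocks u))) =
  \int[block_prob mu C]_x marginal mu phi x ^+ 2.
Proof.
have sq b : square_integrable (glue_prob mu C)
    (fun u => phi (pair_proj b (glue_blocks u))).
  exact: (same_law_square_integrable (same_law_sym (same_law_glue mu C b)) mphi phi2).
have Fi := square_integrableM (sq true) (sq false).
have inner (z : block S C) :
    rintegrable (block_prob mu (~: C) \x block_prob mu (~: C))%E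
      (fun v : (block S (~: C) * block S (~: C))%type => phi (merge v.1 z) * phi (merge v.2 z)) /\
    \int[(block_prob mu (~: C) \x block_prob mu (~: C))%E]_v
      (phi (merge v.1 z) * phi (merge v.2 z)) = marginal mu phi z ^+ 2.
  have i0 := rintegrable_section z.
  have i1 := rintegrable_tensor i0 i0; split => //.
  have [y|_ ->] := Rintegral_fubini (F := fun v : (block S (~: C) * block S (~: C))%type =>
    phi (merge v.1 z) * phi (merge v.2 z)) i1.
    exact: (rintegrableZl (phi (merge y z)) i0).
  under eq_Rintegral do rewrite /= RintegralZl//.
  by rewrite RintegralZr.
have [z|H1 H2] := Rintegral_fubini Fi; first by case: (inner z).
split; first by apply: eq_rintegrable H1 => z; have [_ ->] := inner z.
by rewrite H2; apply: eq_Rintegral => z _; have [_ ->] := inner z.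
Qed.

Lemma square_integrable_marginal (C : {set 'I_K}) :
  square_integrable (block_prob mu C) (marginal mu phi : block S C -> R).
Proof.
split; last by case: (marginal_sqr C).
exact: rintegrable_measurable (rintegrable_marginal C).
Qed.

(** The variance of the marginal, which has the same mean as [phi]. *)
Definition block_variance (C : {set 'I_K}) : R :=
  \int[block_prob mu C]_x marginal mu phi x ^+ 2 -
  (\int[prod_prob mu]_x phi x) ^+ 2.

Lemma sigma2_blockE (A B : {set 'I_K}) : B \subset A ->
  sigma2_block mu B (marginal mu phi : block S A -> R) = block_variance B.
Proof.
move=> BA; rewrite /sigma2_block Rintegral_marginal.
under eq_Rintegral do rewrite block_marginal_marginal//.
rewrite /block_variance -(Rintegral_marginal B).
by rewrite variance_Rintegral//; exact: square_integrable_marginal.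
Qed.

Lemma block_variance_set0 : block_variance finset.set0 = 0.
Proof.
have cst (x y : block S finset.set0) : marginal mu phi x = marginal mu phi y.
  apply: eq_Rintegral => z _; congr phi; apply: functional_extensionality_dep => k.
  have kT : k \in (~: finset.set0)%SET by rewrite !inE.
  by rewrite !(mergeL _ _ kT).
have x0 : block S finset.set0 := point.
rewrite /block_variance -(Rintegral_marginal finset.set0).
have -> : \int[block_prob mu finset.set0]_x marginal mu phi x = marginal mu phi x0.
  rewrite -[RHS](Rintegral_prob_cst (block_prob mu finset.set0)).
  by apply: eq_Rintegral => x _; exact: cst.
have -> : \int[block_prob mu finset.set0]_x marginal mu phi x ^+ 2 =
    marginal mu phi x0 ^+ 2.
  rewrite -[RHS](Rintegral_prob_cst (block_prob mu finset.set0)).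
  by apply: eq_Rintegral => x _; rewrite (cst x x0).
by rewrite subrr.
Qed.

End marginals.

(** * Counting the pairs of multi-indices by agreement set *)

Section counting.
Context (R : numFieldType) (K : nat).

Definition agree (N : nat) (n m : {ffun 'I_K -> 'I_N}) : {set 'I_K} :=
  [set k | n k == m k]%SET.

(** The number of pairs is a sum of products over the coordinates, which
    distributes: given [n], the coordinate [k] of [m] is forced when [k] is in
    [C] and has [N - 1] possible values otherwise. *)
Lemma card_agree N (C : {set 'I_K}) : (0 < N)%N ->
  \sum_(n : {ffun 'I_K -> 'I_N}) \sum_(m | agree n m == C) (1 : R) =
  N%:R ^+ K * \prod_k (if k \in C then 1 else N.-1%:R).
Proof.
move=> N0.
transitivity (\sum_(n : {ffun 'I_K -> 'I_N}) \sum_(m : {ffun 'I_K -> 'I_N})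
    \prod_k ((n k == m k) == (k \in C))%:R : R).
  apply: eq_bigr => n _; rewrite big_mkcond; apply: eq_bigr => m _ /=.
  case: ifPn => [/eqP <-|/eqP nC].
    by rewrite big1// => k _; rewrite /agree inE eqxx.
  have [k kC] : exists k, (n k == m k) != (k \in C).
    apply/existsP; apply: contra_notT nC => /existsPn H.
    apply/setP => k; rewrite /agree inE.
    by have := H k; rewrite negbK => /eqP.
  by rewrite (bigD1 k)//= (negbTE kC) mul0r.
transitivity (\sum_(n : {ffun 'I_K -> 'I_N})
   (\prod_k (if k \in C then 1 else N.-1%:R)) : R).
  apply: eq_bigr => n _.
  rewrite -(bigA_distr_bigA (fun k j => ((n k == j) == (k \in C))%:R)) /=.
  apply: eq_bigr => k _.
  rewrite -natr_sum; case: ifP => kC.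
    rewrite (bigD1 (n k))//= eqxx big1 ?addn0// => j /negbTE.
    by rewrite eq_sym => ->.
  rewrite (bigD1 (n k))//= eqxx add0n.
  rewrite (eq_bigr (fun=> 1%N)); last by move=> j /negbTE; rewrite eq_sym => ->.
  by rewrite sum1_card cardC1 card_ord.
by rewrite sumr_const card_ffun !card_ord -natrX mulr_natl.
Qed.

(** The weight of [C] is the product of [N^-1] over [C] and of [1 - N^-1] over
    its complement.  Choosing in each factor [1 - N^-1] either term amounts to
    choosing the superset [A] of [C] of the coordinates that contribute a power
    of [N^-1], with the sign [(-1) ^+ (#|A| - #|C|)]. *)
Lemma sum_agree N (v : {set 'I_K} -> R) : (0 < N)%N ->
  N%:R ^- K * (N%:R ^- K *
    \sum_(n : {ffun 'I_K -> 'I_N}) \sum_m v (agree n m)) =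
  \sum_(A : {set 'I_K}) N%:R ^- #|A| *
    \sum_(B : {set 'I_K} | B \subset A) (-1) ^+ (#|A| - #|B|) * v B.
Proof.
move=> N0; have Nn0 : N%:R != 0 :> R by rewrite pnatr_eq0 -lt0n.
have -> : \sum_(n : {ffun 'I_K -> 'I_N}) \sum_m v (agree n m) =
   \sum_C v C * (N%:R ^+ K * \prod_k (if k \in C then 1 else N.-1%:R)).
  under eq_bigr => n _ do rewrite (partition_big (agree n) xpredT)//=.
  rewrite exchange_big /=; apply: eq_bigr => C _.
  rewrite -card_agree// mulr_sumr; apply: eq_bigr => n _.
  by rewrite mulr_sumr; apply: eq_bigr => m /eqP ->; rewrite mulr1.
rewrite mulr_sumr mulr_sumr.
have -> : \sum_(A : {set 'I_K}) N%:R ^- #|A| *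
    \sum_(B : {set 'I_K} | B \subset A) (-1) ^+ (#|A| - #|B|) * v B =
  \sum_(B : {set 'I_K}) v B * \sum_(A : {set 'I_K} | B \subset A)
     N%:R ^- #|A| * (-1) ^+ (#|A| - #|B|).
  under eq_bigr do rewrite mulr_sumr.
  rewrite (exchange_big_dep xpredT)//=; apply: eq_bigr => B _.
  by rewrite mulr_sumr; apply: eq_bigr => A _; ring.
apply: eq_bigr => C _.
set p := \prod_k _.
have -> : N%:R ^- K * (N%:R ^- K * (v C * (N%:R ^+ K * p))) =
    v C * (N%:R ^- K * (N%:R ^- K * N%:R ^+ K * p)) by ring.
rewrite mulVf ?expf_neq0// mul1r /p {p}; congr (_ * _).
transitivity (\prod_(k < K) (if k \in C then N%:R^-1 else 1 - N%:R^-1) : R).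
  rewrite -exprVn -[X in _ ^+ X]card_ord -prodr_const -big_split /=.
  apply: eq_bigr => k _; case: ifP => _; first by rewrite mulr1.
  have -> : N.-1%:R = N%:R - 1 :> R by rewrite -[in RHS](prednK N0) -natr1 addrK.
  by rewrite mulrBr mulVf// mulr1.
transitivity (\prod_(k < K) ((if k \in C then N%:R^-1 else - N%:R^-1) +
   (if k \in C then 0 else 1)) : R).
  by apply: eq_bigr => k _; case: ifP => _; [rewrite addr0|rewrite addrC].
rewrite bigA_distr (bigID (fun A : {set 'I_K} => C \subset A)) /=.
rewrite [X in _ + X]big1 ?addr0 => [|A CA]; last first.
  have [k kC kA] := fintype.subsetPn CA.
  by rewrite (bigD1 k)//= kC (negbTE kA) mul0r.
apply: eq_bigr => A CA.
rewrite (bigID (mem A)) /= [X in _ * X]big1 ?mulr1 => [|k kA]; last first.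
  by rewrite (negbTE kA); case: ifP => // /(fintype.subsetP CA); rewrite (negbTE kA).
under eq_bigr => k kA do rewrite kA.
rewrite (bigID (mem C)) /=.
rewrite (eq_bigr (fun=> N%:R^-1)); last by move=> k /andP[_ ->].
rewrite [X in _ * X](eq_bigr (fun=> - N%:R^-1)); last by move=> k /andP[_ /negbTE ->].
rewrite !prodr_const.
have -> : #|[pred k in A | k \in C]| = #|C|.
  apply: eq_card => k; rewrite !inE; have /implyP := fintype.subsetP CA k.
  by case: (k \in C) => /= [->|_]; rewrite ?andbF.
have -> : #|[pred k in A | k \notin C]| = (#|A| - #|C|)%N.
  rewrite -cardsDS//; apply: eq_card => k; rewrite !inE andbC//.
rewrite [X in _ * X]exprNn mulrCA -exprVn -exprD subnKC ?subset_leq_card//.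
by rewrite mulrC.
Qed.

End counting.

(** * Mean and variance of the estimator *)

Section estimator.
Context (R : realType) (K : nat) (d : 'I_K -> measure_display).
Context (S : forall k, measurableType (d k)).
Variable mu : forall k, probability (S k) R.
Context (dO : measure_display) (Omega : measurableType dO).
Context (P : probability Omega R) (X : nat -> {RV P >-> prod_space S}).
Hypothesis hX : iid_with_law X (prod_prob mu).
Variable phi : prod_space S -> R.
Hypothesis iphi : rintegrable (prod_prob mu) phi.

Let mphi : measurable_fun setT phi. Proof. exact: rintegrable_measurable iphi. Qed.

Let nat_index N (n : {ffun 'I_K -> 'I_N}) : 'I_K -> nat := fun k => n k.

Let estimatorE N : prod_estimator X N phi = fun omega =>
  N%:R ^- K * \sum_(n : {ffun 'I_K -> 'I_N})
    phi (sample_point X (nat_index n) omega).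
Proof. by []. Qed.

Lemma rintegrable_sample_point (n : 'I_K -> nat) :
  rintegrable P (fun omega => phi (sample_point X n omega)).
Proof.
apply: (same_law_integrable (same_law_sym (same_law_sample_point hX n))
  (f := EFin \o phi)) => //; exact/measurable_EFinP.
Qed.

Lemma Rintegral_sample_point (n : 'I_K -> nat) :
  \int[P]_omega phi (sample_point X n omega) = \int[prod_prob mu]_x phi x.
Proof. exact: (same_law_Rintegral (same_law_sample_point hX n) mphi). Qed.

Lemma rintegrable_estimator N : rintegrable P (prod_estimator X N phi).
Proof.
rewrite estimatorE.
apply: rintegrableZl; apply: rintegrable_sum => n _.
exact: rintegrable_sample_point.
Qed.

Lemma Rintegral_estimator N : (0 < N)%N ->
  \int[P]_omega prod_estimator X N phi omega = \int[prod_prob mu]_x phi x.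
Proof.
move=> N0; rewrite estimatorE.
rewrite RintegralZl//; last first.
  by apply: rintegrable_sum => n _; exact: rintegrable_sample_point.
rewrite Rintegral_sum; last by move=> n; exact: rintegrable_sample_point.
under eq_bigr do rewrite Rintegral_sample_point.
rewrite sumr_const card_ffun !card_ord -[_ *+ (N ^ K)%N]mulr_natl mulrA natrX.
by rewrite mulVf ?mul1r// expf_neq0// pnatr_eq0 -lt0n.
Qed.

Lemma expectation_estimator N : (0 < N)%N ->
  ('E_P[prod_estimator X N phi] = \int[prod_prob mu]_x (phi x)%:E)%E.
Proof.
move=> N0; rewrite unlock EFin_Rintegral; last exact: rintegrable_estimator.
by rewrite Rintegral_estimator// EFin_Rintegral.
Qed.

Hypothesis phi2 : square_integrable (prod_prob mu) phi.

Lemma square_integrable_sample_point (n : 'I_K -> nat) :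
  square_integrable P (fun omega => phi (sample_point X n omega)).
Proof.
exact: (same_law_square_integrable (same_law_sym (same_law_sample_point hX n))
  mphi phi2).
Qed.

Lemma square_integrable_estimator N :
  square_integrable P (prod_estimator X N phi).
Proof.
rewrite estimatorE.
apply: square_integrableZl; apply: square_integrable_sum => n.
exact: square_integrable_sample_point.
Qed.

Hypothesis pphi : partially_integrable mu phi.

(** This is where the covariance is seen to depend on [n] and [m] through their
    agreement set only. *)
Lemma Rintegral_sample_pair N (n m : {ffun 'I_K -> 'I_N}) :
  \int[P]_omega (phi (sample_point X (nat_index n) omega) *
    phi (sample_point X (nat_index m) omega)) =
  block_variance mu phi (agree n m) + (\int[prod_prob mu]_x phi x) ^+ 2.
Proof.
have [_ H] := marginal_sqr mphi pphi phi2 (agree n m).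
rewrite /block_variance subrK -H.
apply: (same_law_Rintegral (same_law_sample_pair hX (nat_index n) (nat_index m))
  (f := fun u => phi (pair_proj true u) * phi (pair_proj false u))).
by apply: measurable_funM; apply: measurableT_comp => //;
  exact: measurable_pair_proj.
Qed.

Lemma Rintegral_estimator_sqr N : (0 < N)%N ->
  \int[P]_omega prod_estimator X N phi omega ^+ 2 -
    (\int[prod_prob mu]_x phi x) ^+ 2 =
  \sum_(A : {set 'I_K} | A != finset.set0) N%:R ^- #|A| *
    \sum_(B : {set 'I_K} | B \subset A)
      (-1) ^+ (#|A| - #|B|) * block_variance mu phi B.
Proof.
move=> N0; set a := \int[prod_prob mu]_x phi x.
have Nn0 : N%:R ^+ K != 0 :> R by rewrite expf_neq0// pnatr_eq0 -lt0n.
have -> : \int[P]_omega prod_estimator X N phi omega ^+ 2 =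
    \int[P]_omega (N%:R ^- K * (N%:R ^- K * \sum_(n : {ffun 'I_K -> 'I_N})
      \sum_(m : {ffun 'I_K -> 'I_N})
        phi (sample_point X (nat_index n) omega) *
        phi (sample_point X (nat_index m) omega))).
  apply: eq_Rintegral => omega _; rewrite estimatorE expr2 mulrACA -mulrA.
  by congr (_ * (_ * _)); rewrite mulr_suml; apply: eq_bigr => n _; rewrite mulr_sumr.
have i1 (n m : {ffun 'I_K -> 'I_N}) : rintegrable P (fun omega =>
    phi (sample_point X (nat_index n) omega) *
    phi (sample_point X (nat_index m) omega)).
  by apply: square_integrableM; exact: square_integrable_sample_point.
have i2 (n : {ffun 'I_K -> 'I_N}) : rintegrable P (fun omega =>
    \sum_(m : {ffun 'I_K -> 'I_N})
    phi (sample_point X (nat_index n) omega) *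
    phi (sample_point X (nat_index m) omega)).
  by apply: rintegrable_sum => m _.
have i3 : rintegrable P (fun omega => \sum_(n : {ffun 'I_K -> 'I_N})
    \sum_(m : {ffun 'I_K -> 'I_N})
    phi (sample_point X (nat_index n) omega) *
    phi (sample_point X (nat_index m) omega)).
  by apply: rintegrable_sum => n _.
rewrite RintegralZl//; last exact: rintegrableZl.
rewrite RintegralZl// Rintegral_sum//.
under eq_bigr => n _.
  rewrite Rintegral_sum//.
  under eq_bigr do rewrite Rintegral_sample_pair.
  rewrite big_split /= sumr_const card_ffun !card_ord.
  over.
rewrite big_split /= sumr_const card_ffun !card_ord -/a.
rewrite -[a ^+ 2 *+ _ *+ _]mulr_natl -[a ^+ 2 *+ _]mulr_natl !natrX.
set V := \sum_n _.
have -> : N%:R ^- K * (N%:R ^- K * (V + N%:R ^+ K * (N%:R ^+ K * a ^+ 2))) - a ^+ 2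
  = N%:R ^- K * (N%:R ^- K * V) by field.
rewrite /V sum_agree// (bigD1 finset.set0)//= [X in X + _](_ : _ = 0) ?add0r//.
rewrite big1 ?mulr0// => B; rewrite finset.subset0 => /eqP ->.
by rewrite block_variance_set0 ?mulr0.
Qed.

Lemma variance_estimator N : (0 < N)%N ->
  'V_P[prod_estimator X N phi] =
  (\sum_(A : {set 'I_K} | A != finset.set0) N%:R ^- #|A| *
    \sum_(B : {set 'I_K} | B \subset A) (-1) ^+ (#|A| - #|B|) *
      sigma2_block mu B (marginal mu phi : block S A -> R))%:E.
Proof.
move=> N0; rewrite variance_EFin; last exact: square_integrable_estimator.
rewrite Rintegral_estimator// Rintegral_estimator_sqr//; congr _%:E.
apply: eq_bigr => A _; congr (_ * _); apply: eq_bigr => B BA.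
by rewrite sigma2_blockE.
Qed.

Lemma mean_square_estimator N : (0 < N)%N ->
  \int[P]_omega (prod_estimator X N phi omega - \int[prod_prob mu]_x phi x) ^+ 2 =
  \sum_(A : {set 'I_K} | A != finset.set0) N%:R ^- #|A| *
    \sum_(B : {set 'I_K} | B \subset A)
      (-1) ^+ (#|A| - #|B|) * block_variance mu phi B.
Proof.
move=> N0; rewrite -Rintegral_estimator_sqr// -(Rintegral_estimator N0).
by rewrite variance_Rintegral//; exact: square_integrable_estimator.
Qed.

End estimator.

(** * Almost sure convergence tools *)

(** The term [1 / n ^ 2] is at most [2 / n - 2 / (n + 1)], which telescopes. *)
Lemma sum_inv_sqr_le (R : realType) n :
  \sum_(0 <= j < n) (j.+1%:R ^- 2 : R) <= 2 - 2 / n.+1%:R.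
Proof.
elim: n => [|n IHn]; first by rewrite big_nil divr1 subrr.
rewrite big_nat_recr//= (le_trans (lerD IHn (lexx _)))//.
have n0 : 0 < n.+1%:R :> R by rewrite ltr0n.
have -> : n.+2%:R = n.+1%:R + 1 :> R by rewrite natr1.
have n1 : 1 <= n.+1%:R :> R by rewrite ler1n.
set x : R := n.+1%:R in n0 n1 *.
rewrite -subr_ge0.
have -> : 2 - 2 / (x + 1) - (2 - 2 / x + x ^- 2) = (x - 1) / (x ^+ 2 * (x + 1)).
  by field; rewrite !gt_eqF//; lra.
by apply: divr_ge0; [lra|apply: mulr_ge0; [exact: sqr_ge0|lra]].
Qed.

Section ae_cvg.
Context (R : realType) d (T : measurableType d) (P : probability T R).

(** The sum of the squares has a finite integral, hence is almost everywhere
    finite, and the terms of a convergent series tend to zero. *)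
Lemma ae_cvg0_of_summable (Y : nat -> T -> R) (C : R) :
  (forall j, square_integrable P (Y j)) ->
  (forall n, \sum_(0 <= j < n) \int[P]_x Y j x ^+ 2 <= C) ->
  {ae P, forall x, Y j x @[j --> \oo] --> (0 : R)}.
Proof.
move=> Y2 YC.
pose f j x := (Y j x ^+ 2)%:E.
have f0 j x : (0 <= f j x)%E by rewrite lee_fin sqr_ge0.
have mf j : measurable_fun setT (f j).
  by case: (Y2 j) => mY _; apply/measurable_EFinP; exact: measurable_funX.
have ms : measurable_fun setT (fun x => \sum_(j <oo) f j x)%E.
  by apply: (ge0_emeasurable_sum (P := xpredT)) => *; [exact: f0|exact: mf].
have si : P.-integrable setT (fun x => \sum_(j <oo) f j x)%E.
  apply/integrableP; split => //.
  under eq_integral => x _.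
    rewrite gee0_abs; last by apply: nneseries_ge0 => *; exact: f0.
    over.
  rewrite integral_nneseries//.
  apply: (@le_lt_trans _ _ C%:E); last exact: ltry.
  apply: lime_le.
    by apply: is_cvg_nneseries => n _ _; apply: integral_ge0 => x _; exact: f0.
  apply: nearW => n.
  rewrite (eq_bigr (fun j => (\int[P]_x Y j x ^+ 2)%:E)); last first.
    by move=> j _; rewrite -EFin_Rintegral//; case: (Y2 j).
  by rewrite sumEFin lee_fin.
have := integrable_ae measurableT si.
apply: filterS => x /(_ Logic.I) fin.
have sq0 : (fun j => Y j x ^+ 2) @ \oo --> (0 : R).
  apply: cvg_series_cvg_0; apply: nondecreasing_is_cvgn.
    apply/nondecreasing_seqP => n; rewrite /series /= big_nat_recr//=.
    by rewrite lerDl sqr_ge0.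
  exists (fine (\sum_(j <oo) f j x)%E) => _ [n _ <-].
  rewrite -lee_fin fineK// /series /= -sumEFin.
  by apply: nneseries_lim_ge => *; exact: f0.
apply/cvgrPdist_lt => e e0.
have e20 : 0 < e ^+ 2 by rewrite exprn_gt0.
move/cvgrPdist_lt : sq0 => /(_ _ e20).
apply: filterS => j; rewrite !sub0r !normrN normrX.
by rewrite ltr_pXn2r// nnegrE ltW.
Qed.

End ae_cvg.

Section monotone_averages.
Context (R : realType) (K : nat) (t : nat -> R) (a : R).
Hypothesis t_nd : {homo t : m n / (m <= n)%N >-> m <= n}.
Hypothesis t0 : 0 <= t 0.

(** With s the integer square root of N, monotony gives
    t(s^2) / (s+1)^(2K) <= t(N) / N^K <= t((s+1)^2) / s^(2K),
    and ((s+1) / s)^(2K) tends to 1. *)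
Lemma cvg_monotone_averages :
  t (j.+1 ^ 2)%N / (j.+1 ^ 2)%N%:R ^+ K @[j --> \oo] --> a ->
  t N / N%:R ^+ K @[N --> \oo] --> a.
Proof.
move=> ua.
pose u j := t (j ^ 2)%N / (j ^ 2)%N%:R ^+ K.
pose r j : R := ((j.+1%:R / j%:R) ^+ 2) ^+ K.
have {}ua : u j @[j --> \oo] --> a by rewrite -cvg_shiftS.
have r1 : r j @[j --> \oo] --> (1 : R).
  rewrite -cvg_shiftS.
  have -> : [sequence r n.+1]_n = (fun n => ((1 + @harmonic R n) ^+ 2) ^+ K).
    apply/funext => n; rewrite /r /=; congr (_ ^+ _ ^+ _).
    by rewrite -[n.+2%:R]natr1 mulrDl divff ?pnatr_eq0// mul1r.
  suff : (fun n => ((1 + @harmonic R n) ^+ 2) ^+ K) @ \oo -->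
      ((1 + (0 : R)) ^+ 2) ^+ K by rewrite addr0 !expr1n.
  have h1 : (fun n => 1 + @harmonic R n) @ \oo --> 1 + (0 : R).
    by apply: cvgD; [exact: cvg_cst|exact: cvg_harmonic].
  have h2 := cvg_comp _ _ h1 (@exprn_continuous R 2 _).
  exact: (cvg_comp _ _ h2 (@exprn_continuous R K _)).
pose s := PeanoNat.Nat.sqrt.
have sP N : (s N ^ 2 <= N < (s N).+1 ^ 2)%N.
  have [h1 h2] := PeanoNat.Nat.sqrt_spec N (PeanoNat.Nat.le_0_l N).
  by rewrite -!mulnn; apply/andP; split; [exact/ssrnat.leP|exact/ssrnat.ltP].
have s_oo : s N @[N --> \oo] --> \oo.
  apply/cvgnyPge => M; exists (M ^ 2)%N => // N /= MN.
  have /andP[_ h] := sP N; have := leq_ltn_trans MN h.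
  by rewrite ltn_exp2r.
have lo : u (s N) / r (s N) @[N --> \oo] --> a.
  rewrite -[a in _ --> a]divr1; apply: cvgM.
    exact: (cvg_comp _ _ s_oo ua).
  apply: cvgV; first exact: oner_neq0.
  exact: (cvg_comp _ _ s_oo r1).
have hi : u (s N).+1 * r (s N) @[N --> \oo] --> a.
  rewrite -[a in _ --> a]mulr1; apply: cvgM.
    have uaS : (fun j => u j.+1) @ \oo --> a by rewrite cvg_shiftS.
    exact: (cvg_comp _ _ s_oo uaS).
  exact: (cvg_comp _ _ s_oo r1).
apply: (squeeze_cvgr _ lo hi).
exists 1%N => // N /= N0.
have /andP[sN Ns] := sP N.
have s0 : (0 < s N)%N by move: Ns; case: (s N) => // /leq_trans /(_ N0); rewrite ltnn.
have tge0 m : 0 <= t m by rewrite (le_trans t0)// t_nd.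
have sR : 0 < (s N)%:R :> R by rewrite ltr0n.
have NR : 0 < N%:R :> R by rewrite ltr0n.
have SR : 0 < (s N).+1%:R :> R by rewrite ltr0n.
have -> : u (s N) / r (s N) = t (s N ^ 2)%N * ((s N).+1 ^ 2)%N%:R ^- K.
  rewrite /u /r !natrX !expr_div_n.
  have p0 : (s N)%:R ^+ 2 ^+ K != 0 :> R by rewrite !expf_neq0 ?gt_eqF.
  have q0 : (s N).+1%:R ^+ 2 ^+ K != 0 :> R by rewrite !expf_neq0 ?gt_eqF.
  move: (_ ^+ 2 ^+ K) (_ ^+ 2 ^+ K) p0 q0 => p q p0 q0.
  by field; rewrite p0 q0.
have -> : u (s N).+1 * r (s N) = t ((s N).+1 ^ 2)%N * (s N ^ 2)%N%:R ^- K.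
  rewrite /u /r !natrX !expr_div_n.
  have p0 : (s N)%:R ^+ 2 ^+ K != 0 :> R by rewrite !expf_neq0 ?gt_eqF.
  have q0 : (s N).+1%:R ^+ 2 ^+ K != 0 :> R by rewrite !expf_neq0 ?gt_eqF.
  move: (_ ^+ 2 ^+ K) (_ ^+ 2 ^+ K) p0 q0 => p q p0 q0.
  by field; rewrite p0 q0.
have pos m : (0 < m)%N -> 0 < m%:R ^+ K :> R by move=> m0; rewrite exprn_gt0 ?ltr0n.
have s20 : (0 < s N ^ 2)%N by rewrite expn_gt0 s0.
apply/andP; split; apply: ler_pM => //; rewrite ?invr_ge0 ?exprn_ge0//.
- exact: t_nd.
- by rewrite lef_pV2 ?posrE ?pos// lerXn2r ?nnegrE// ler_nat ltnW.
- by apply: t_nd; exact: ltnW.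
- by rewrite lef_pV2 ?posrE ?pos// lerXn2r ?nnegrE// ler_nat.
Qed.

End monotone_averages.

(** * Strong consistency *)

Section strong_law.
Context (R : realType) (K : nat) (d : 'I_K -> measure_display).
Context (S : forall k, measurableType (d k)).
Variable mu : forall k, probability (S k) R.
Context (dO : measure_display) (Omega : measurableType dO).
Context (P : probability Omega R) (X : nat -> {RV P >-> prod_space S}).
Hypothesis hX : iid_with_law X (prod_prob mu).

(** The order of the mean square error is the size of the smallest set with a
    nonzero term in the variance formula: [r] is 0 for a general function and 1
    for the residual of the projection. *)
Lemma mean_square_estimator_le (phi : prod_space S -> R) (r : nat) :
  square_integrable (prod_prob mu) phi -> partially_integrable mu phi ->
  (forall A : {set 'I_K}, (0 < #|A| <= r)%N ->
     \sum_(B : {set 'I_K} | B \subset A)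
        (-1) ^+ (#|A| - #|B|) * block_variance mu phi B = 0) ->
  exists2 C : R, 0 <= C & forall N, (0 < N)%N ->
    \int[P]_omega
      (prod_estimator X N phi omega - \int[prod_prob mu]_x phi x) ^+ 2 <=
    C / N%:R ^+ r.+1.
Proof.
move=> phi2 pphi w0.
pose w (A : {set 'I_K}) := \sum_(B : {set 'I_K} | B \subset A)
  (-1) ^+ (#|A| - #|B|) * block_variance mu phi B.
exists (\sum_(A : {set 'I_K} | A != finset.set0) `|w A|).
  by apply: sumr_ge0 => A _; exact: normr_ge0.
move=> N N0; rewrite (mean_square_estimator hX (square_integrable_rintegrable phi2) phi2 pphi)//.
rewrite mulr_suml; apply: ler_sum => A A0; rewrite -/(w A).
have [Ar|rA] := leqP #|A| r.
  by rewrite /w w0 ?Ar ?card_gt0 ?A0// mulr0 mulr_ge0// invr_ge0 exprn_ge0.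
rewrite mulrC (le_trans (ler_norm _))// normrM ler_wpM2l//.
have NR : 0 < N%:R :> R by rewrite ltr0n.
rewrite ger0_norm ?invr_ge0 ?exprn_ge0// lef_pV2 ?posrE ?exprn_gt0//.
by rewrite ler_weXn2l// ler1n.
Qed.

Let strong_law_ge0 (phi : prod_space S -> R) : (forall x, 0 <= phi x) ->
  square_integrable (prod_prob mu) phi -> partially_integrable mu phi ->
  {ae P, forall omega, prod_estimator X N phi omega @[N --> \oo] -->
     \int[prod_prob mu]_x phi x}.
Proof.
move=> phi0 phi2 pphi; set a := \int[prod_prob mu]_x phi x.
have [|C C0 HC] := @mean_square_estimator_le phi 0 phi2 pphi.
  by move=> A; case: #|A|.
have iphi := square_integrable_rintegrable phi2.
pose Y j omega := prod_estimator X (j.+1 ^ 2) phi omega - a.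
have Y2 j : square_integrable P (Y j).
  apply: square_integrableB; last exact: square_integrable_cst.
  exact: (square_integrable_estimator hX).
have YC n : \sum_(0 <= j < n) \int[P]_omega Y j omega ^+ 2 <= C * 2.
  apply: (@le_trans _ _ (C * \sum_(0 <= j < n) (j.+1%:R ^- 2))).
    rewrite mulr_sumr; apply: ler_sum => j _.
    by rewrite (le_trans (HC _ _)) ?expn_gt0// expr1 natrX.
  rewrite ler_wpM2l// (le_trans (sum_inv_sqr_le _ _))//.
  by rewrite gerBl divr_ge0.
have := ae_cvg0_of_summable Y2 YC; apply: filterS => omega Yo.
pose t N := \sum_(n : {ffun 'I_K -> 'I_N})
  phi (fun k => X (n k) omega k).
have tE N : prod_estimator X N phi omega = t N / N%:R ^+ K by rewrite mulrC.
under eq_fun do rewrite tE.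
apply: cvg_monotone_averages.
- move=> m n mn; rewrite /t.
  pose h (f : {ffun 'I_K -> 'I_m}) : {ffun 'I_K -> 'I_n} :=
    [ffun k => widen_ord mn (f k)].
  have h_inj : injective h.
    move=> f g /ffunP fg; apply/ffunP => k; apply: val_inj.
    by have := fg k; rewrite !ffunE => /(congr1 val).
  pose G (f : {ffun 'I_K -> 'I_n}) := phi (fun k => X (f k) omega k).
  have -> : \sum_(f : {ffun 'I_K -> 'I_m}) phi (fun k => X (f k) omega k) =
      \sum_(f in [set h f | f in [set: {ffun 'I_K -> 'I_m}]]%SET) G f.
    rewrite big_imset /=; last by move=> f g _ _; exact: h_inj.
    apply: eq_big => [f|f _]; rewrite ?inE// /G; congr phi.
    by apply: functional_extensionality_dep => k; rewrite /h ffunE.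
  by rewrite big_mkcond; apply: ler_sum => f _; case: ifP.
- by apply: sumr_ge0.
have : (fun j => Y j omega + a) @ \oo --> 0 + a.
  by apply: cvgD => //; exact: cvg_cst.
rewrite add0r; apply: cvg_trans.
suff -> : (fun j => Y j omega + a) =
  (fun j => t (j.+1 ^ 2)%N / (j.+1 ^ 2)%N%:R ^+ K) by [].
by apply/funext => j; rewrite /Y subrK tE.
Qed.

Lemma strong_law (phi : prod_space S -> R) :
  square_integrable (prod_prob mu) phi -> partially_integrable mu phi ->
  {ae P, forall omega, prod_estimator X N phi omega @[N --> \oo] -->
     \int[prod_prob mu]_x phi x}.
Proof.
move=> phi2 pphi.
pose p x := Num.max (phi x) 0; pose q x := Num.max (- phi x) 0.
have mphi : measurable_fun setT phi by case: phi2.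
have p0 x : 0 <= p x by rewrite /p le_max lexx orbT.
have q0 x : 0 <= q x by rewrite /q le_max lexx orbT.
have pqE x : phi x = p x - q x.
  rewrite /p /q; case/orP: (le_total 0 (phi x)) => h.
    by rewrite max_l// max_r ?oppr_le0// subr0.
  by rewrite max_r// max_l ?oppr_ge0// sub0r opprK.
have pn x : `|p x| <= `|phi x|.
  by rewrite ger0_norm// ge_max ler_norm normr_ge0.
have qn x : `|q x| <= `|phi x|.
  by rewrite ger0_norm// ge_max normr_ge0 -normrN ler_norm.
have mp : measurable_fun setT p by exact: measurable_maxr.
have mq : measurable_fun setT q.
  by apply: measurable_maxr => //; exact: measurableT_comp.
have psi2 (psi : prod_space S -> R) : measurable_fun setT psi ->
    (forall x, `|psi x| <= `|phi x|) ->
    square_integrable (prod_prob mu) psi /\ partially_integrable mu psi.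
  move=> mpsi psin; split; first exact: square_integrable_le phi2.
  move=> A x; apply: (rintegrable_le _ _ (rintegrable_norm (pphi A x))) => //.
  by apply: measurableT_comp => //; apply: measurable_merge.
have [p2 pp] := psi2 _ mp pn; have [q2 pq] := psi2 _ mq qn.
have := strong_law_ge0 p0 p2 pp; have := strong_law_ge0 q0 q2 pq.
apply: filterS2 => omega cq cp.
have -> : (fun N => prod_estimator X N phi omega) =
   (fun N => prod_estimator X N p omega - prod_estimator X N q omega).
  apply/funext => N; rewrite /prod_estimator -mulrBr -sumrB.
  by congr (_ * _); apply: eq_bigr => n _.
have -> : \int[prod_prob mu]_x phi x =
    \int[prod_prob mu]_x p x - \int[prod_prob mu]_x q x.
  rewrite -RintegralB//; last 2 first.
  - exact: square_integrable_rintegrable.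
  - exact: square_integrable_rintegrable.
  by apply: eq_Rintegral => x _; exact: pqE.
exact: cvgB.
Qed.

End strong_law.

(** * Averaging operators *)

Section averaging_operators.
Context (R : realType).
Local Notation RT := (measurableTypeR R).
Implicit Types (m : probability RT R) (f g : R -> R) (c M x e : R).

Definition bounded_measurable (M : R) (f : R -> R) :=
  measurable_fun [set: R] f /\ forall x, `|f x| <= M.

(** The law of [x + c * t] with [t] of law [m], seen as an operator on
    functions: convolution of laws becomes composition of operators. *)
Definition smear m c f : R -> R := fun x => \int[m]_t f (x + c * t).

Let measurable_affine2 c (f : R -> R) : measurable_fun setT f ->
  measurable_fun setT (fun u : (RT * RT)%type => f (u.1 + c * u.2)).
Proof.
move=> mf; apply: (measurableT_comp mf); apply: measurable_funD.
  exact: measurable_fst.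
by apply: measurable_funM => //; exact: measurable_snd.
Qed.

Let measurable_section m c f x : measurable_fun setT f ->
  measurable_fun [set: R] (fun t => f (x + c * t)).
Proof.
by move=> mf; apply: (measurableT_comp mf); exact: measurable_funD.
Qed.

Lemma rintegrable_smear m c M f x : bounded_measurable M f ->
  rintegrable m (fun t => f (x + c * t)).
Proof.
by move=> [mf fM]; apply: (@rintegrable_bounded _ _ _ _ _ M) => //; exact: measurable_section.
Qed.

Lemma bounded_measurable_smear m c M f : bounded_measurable M f ->
  bounded_measurable M (smear m c f).
Proof.
move=> fM; have [mf f_le] := fM; split.
  pose F (u : RT * RT) := f (u.1 + c * u.2).
  have Fi : rintegrable (m \x m)%E F.
    apply: (@rintegrable_bounded _ _ _ _ _ M); last by move=> u; exact: f_le.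
    exact: (measurable_affine2 c mf).
  have [+ _] := Rintegral_fubini Fi (fun x => rintegrable_smear m c x fM).
  exact: rintegrable_measurable.
by move=> x; apply: le_Rintegral_bound => //; exact: measurable_section.
Qed.

Lemma smearB m c M f g x : bounded_measurable M f -> bounded_measurable M g ->
  smear m c f x - smear m c g x = \int[m]_t (f (x + c * t) - g (x + c * t)).
Proof.
move=> fM gM; rewrite RintegralB//.
  exact: (rintegrable_smear m c x fM).
exact: (rintegrable_smear m c x gM).
Qed.

Lemma smear_contraction m c M f g e :
  bounded_measurable M f -> bounded_measurable M g ->
  (forall x, `|f x - g x| <= e) ->
  forall x, `|smear m c f x - smear m c g x| <= e.
Proof.
move=> fM gM fg x; rewrite (smearB _ _ _ fM gM).
apply: le_Rintegral_bound => //; apply: measurable_funB.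
  by apply: measurable_section; case: fM.
by apply: measurable_section; case: gM.
Qed.

Lemma smearC m m' c c' M f : bounded_measurable M f ->
  smear m c (smear m' c' f) = smear m' c' (smear m c f).
Proof.
move=> fM; apply/funext => x; have [mf f_le] := fM.
have mF : measurable_fun setT (fun u : (RT * RT)%type => f (x + c * u.1 + c' * u.2)).
  have mF1 : measurable_fun setT (fun u : (RT * RT)%type => x + c * u.1).
    by apply: measurable_funD => //; apply: measurable_funM => //; exact: measurable_fst.
  have mF2 : measurable_fun setT (fun u : (RT * RT)%type => c' * u.2).
    by apply: measurable_funM => //; exact: measurable_snd.
  exact: (measurableT_comp mf (measurable_funD mF1 mF2)).
have Fi : rintegrable (m \x m')%E (fun u => f (x + c * u.1 + c' * u.2)).
  exact: (@rintegrable_bounded _ _ _ _ _ M).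
have F' y : rintegrable m' (fun v => f (x + c * y + c' * v)).
  exact: (rintegrable_smear m' c' _ fM).
have F'' y : rintegrable m (fun u => f (x + c * u + c' * y)).
  have := rintegrable_smear m c (x + c' * y) fM.
  by apply: eq_integrable => // t _; rewrite /= addrAC.
have E1 : (\int[m]_u \int[m']_v (f (x + c * u + c' * v))%:E =
    (smear m c (smear m' c' f) x)%:E)%E.
  under eq_integral do rewrite EFin_Rintegral//.
  rewrite EFin_Rintegral//.
  by case: (Rintegral_fubini Fi F').
have := Fubini Fi; rewrite /fubini_F /fubini_G /= E1 => E2.
apply: EFin_inj; rewrite E2.
have -> : (\int[m']_v \int[m]_u (f (x + c * u + c' * v))%:E =
  \int[m']_v (smear m c f (x + c' * v))%:E)%E.
  apply: eq_integral => v _; rewrite EFin_Rintegral//; congr _%:E.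
  by apply: eq_Rintegral => u _; rewrite addrAC.
rewrite EFin_Rintegral//.
by have := rintegrable_smear m' c' x (bounded_measurable_smear m c fM).
Qed.

Lemma bounded_measurable_iter m c M n f : bounded_measurable M f ->
  bounded_measurable M (iter n (smear m c) f).
Proof. by move=> fM; elim: n => //= n; exact: bounded_measurable_smear. Qed.

Lemma iter_smearC m m' c c' M n f : bounded_measurable M f ->
  smear m c (iter n (smear m' c') f) = iter n (smear m' c') (smear m c f).
Proof.
move=> fM; elim: n => //= n IHn.
rewrite (smearC _ _ _ _ (bounded_measurable_iter m' c' n fM)) IHn.
by [].
Qed.

Lemma iter_smear_contraction m c M n f g e :
  bounded_measurable M f -> bounded_measurable M g ->
  (forall x, `|f x - g x| <= e) ->
  forall x, `|iter n (smear m c) f x - iter n (smear m c) g x| <= e.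
Proof.
move=> fM gM fg; elim: n => //= n IHn.
exact: (smear_contraction m c (bounded_measurable_iter m c n fM)
  (bounded_measurable_iter m c n gM) IHn).
Qed.

(** Telescoping T^n - T'^n: the operators commute and are contractions, so
    each of the n terms costs at most [e]. *)
Lemma iter_smear_dist m m' c c' M n f e : bounded_measurable M f ->
  (forall x, `|smear m c f x - smear m' c' f x| <= e) ->
  forall x, `|iter n (smear m c) f x - iter n (smear m' c') f x| <= e *+ n.
Proof.
move=> fM fe; elim: n => [|n IHn] x /=; first by rewrite subrr normr0.
rewrite -(subrKA (smear m c (iter n (smear m' c') f) x)).
rewrite (le_trans (ler_normD _ _))// mulrSr lerD//.
  exact: (smear_contraction m c (bounded_measurable_iter m c n fM)
    (bounded_measurable_iter m' c' n fM) IHn).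
rewrite (iter_smearC m m' c c' n fM).
have -> : smear m' c' (iter n (smear m' c') f) =
    iter n (smear m' c') (smear m' c' f) by rewrite -iterS iterSr.
exact: (iter_smear_contraction m' c' n (bounded_measurable_smear m c fM)
  (bounded_measurable_smear m' c' fM) fe).
Qed.

End averaging_operators.

Section product_sums.
Context (R : realType) (I : finType).
Variable m : probability (measurableTypeR R) R.
Local Notation RI := (prod_space (fun _ : I => measurableTypeR R)).

Lemma measurable_sum_coord (s : seq I) :
  measurable_fun setT (fun y : RI => \sum_(i <- s) (y i : R)).
Proof.
apply: measurable_sum => i.
exact: (measurable_coord (T := fun _ : I => measurableTypeR R)).
Qed.

(** Stated for [prod_prob_seq], which draws the coordinates one at a time, so
    that each of them contributes one application of [smear]. *)
Lemma Rintegral_prod_prob_sum (s : seq I) c M (f : R -> R) x :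
  uniq s -> bounded_measurable M f ->
  \int[prod_prob_seq (fun _ : I => m) s]_y f (x + c * \sum_(i <- s) y i) =
  iter (size s) (smear m c) f x.
Proof.
move=> + fM; have [mf f_le] := fM.
have mF x' s' : measurable_fun setT
    (fun y : RI => f (x' + c * \sum_(i <- s') (y i : R))).
  apply: (measurableT_comp mf); apply: measurable_funD => //.
  by apply: measurable_funM => //; exact: measurable_sum_coord.
elim: s x => [|i s IHs] x.
  move=> _; under eq_Rintegral do rewrite big_nil mulr0 addr0.
  exact: Rintegral_prob_cst.
move=> /= /andP[iNs us].
have sl : same_law (m \x prod_prob_seq (fun _ : I => m) s)%E
   (distribution (m \x prod_prob_seq (fun _ : I => m) s)%E
     (@update _ _ (fun _ : I => measurableTypeR R) i))
   (@update _ _ (fun _ : I => measurableTypeR R) i) id.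
  by split => //; exact: measurable_update.
rewrite -(same_law_Rintegral sl (mF x (i :: s))).
have E (u : (measurableTypeR R * RI)%type) :
   x + c * \sum_(j <- i :: s) (@update _ _ (fun _ : I => measurableTypeR R) i u j : R) =
   x + c * u.1 + c * \sum_(j <- s) u.2 j.
  rewrite big_cons /update dfwithin mulrDr addrA; congr (_ + _ + _ * _).
  rewrite [LHS]big_seq [RHS]big_seq; apply: eq_bigr => j js.
  by rewrite dfwithout//; apply: contraNneq iNs => ->.
under eq_Rintegral do rewrite E.
have Fi : rintegrable (m \x prod_prob_seq (fun _ : I => m) s)%E
    (fun u => f (x + c * u.1 + c * \sum_(j <- s) u.2 j)).
  apply: (@rintegrable_bounded _ _ _ _ _ M) => //.
  have [m1 _ _] := sl.
  have := measurableT_comp (mF x (i :: s)) m1.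
  by apply: eq_measurable_fun => u _; rewrite /= E.
have [t|_ ->] := Rintegral_fubini Fi.
  apply: (@rintegrable_bounded _ _ _ _ _ M); first exact: (mF (x + c * t) s).
  by move=> y; exact: f_le.
by apply: eq_Rintegral => t _; rewrite /= IHs.
Qed.

End product_sums.

(** * Smooth test functions *)

Section smoothing.
Context (R : realType).
Implicit Types (u f : R -> R).

Definition uniformly_continuous u := forall e : R, 0 < e ->
  exists2 D : R, 0 < D & forall x y, `|x - y| < D -> `|u x - u y| <= e.

Lemma heine u (a b : R) : continuous u -> forall e : R, 0 < e ->
  exists2 D : R, 0 < D & forall x y, x \in `[a, b] -> `|x - y| < D -> `|u x - u y| <= e.
Proof.
move=> cu e e0.
have /compact_near_coveringP cov := @segment_compact R a b.
pose P (D : R) x := forall y, `|x - y| < D -> `|u x - u y| <= e.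
have : \forall D \near (0 : R)^'+, `[a, b]%classic `<=` P D.
  apply: cov => x _.
  have e20 : 0 < e / 2 by rewrite divr_gt0.
  have := cu x; move/cvgrPdist_lt => /(_ _ e20) /nbhs_ballP[D /= D0 xD].
  have D20 : 0 < D / 2 by rewrite divr_gt0.
  exists (ball x (D / 2), [set E | E < D / 2]) => /=.
    by split; [exact: nbhsx_ballx|exact: nbhs_right_lt].
  move=> [z E] /= [xz Ez] y zy.
  have xz' : `|x - z| < D / 2 by move: xz; rewrite /ball.
  have h1 : `|u x - u z| < e / 2.
    by apply: xD; rewrite /ball /= (lt_trans xz')// ltr_pdivrMr// ltr_pMr// ltr1n.
  have h2 : `|u x - u y| < e / 2.
    apply: xD; rewrite /ball /= -(subrKA z) (le_lt_trans (ler_normD _ _))//.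
    by rewrite [ltRHS]splitr ltrD// (lt_trans zy).
  rewrite -(subrKA (u x)) (le_trans (ler_normD _ _))// [leRHS]splitr.
  by rewrite lerD// ltW// distrC.
move=> H; near (0 : R)^'+ => D.
exists D; first by near: D; exact: nbhs_right_gt.
move=> x y xab; have abD : `[a, b]%classic `<=` P D by near: D.
by apply: abD.
Unshelve. all: by end_near. Qed.

(** The integral of [u] from 0 to [x], written with two cases because the
    integral is over a set; near [x] it differs by a constant from the integral
    from a point to the left of both 0 and [x]. *)
Lemma antiderivative u : continuous u ->
  exists F : R -> R, forall x : R, is_derive x 1 F (u x).
Proof.
move=> cu; pose mu := @lebesgue_measure R.
have ui (a b : R) : mu.-integrable `[a, b] (EFin \o u).
  apply: continuous_compact_integrable; first exact: segment_compact.
  exact: continuous_subspaceT.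
pose F x := if 0 <= x then \int[mu]_(t in `]0, x]) u t else - \int[mu]_(t in `]x, 0]) u t.
exists F => x.
pose a := Num.min x 0 - 1.
have a0 : a < 0 by rewrite /a ltrBlDr add0r gt_min ltr01 orbT.
have ax : a < x by rewrite /a ltrBlDr gt_min ltrDl ltr01.
pose G y := \int[mu]_(t in `[a, y]) u t.
have FG y : a < y -> F y = G y - G 0.
  move=> ay; rewrite /F; case: ifPn => [y0|].
    by rewrite /G Rintegral_itvB// bnd_simp// ltW.
  rewrite -ltNge => y0.
  by rewrite -opprB; congr (- _); rewrite /G Rintegral_itvB// bnd_simp// ltW.
have [dG GE] : derivable G x 1 /\ G^`()%classic x = u x.
  by apply: (@continuous_FTC1_closed _ u a x (x + 1)) => //; [rewrite ltrDl|exact: cu].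
have dGc : is_derive x 1 (fun y => G y - G 0) (u x).
  have : is_derive x 1 G (u x) by apply: (DeriveDef dG); rewrite -GE derive1E.
  by move=> dGx; apply: is_derive_eq; rewrite subr0.
apply: near_eq_is_derive dGc.
near=> y; rewrite FG//; near: y.
exact: lt_nbhsr.
Unshelve. all: by end_near. Qed.

Lemma is_derive1_continuous f f1 : (forall x : R, is_derive x 1 f (f1 x)) ->
  continuous f.
Proof.
move=> df z; apply: differentiable_continuous; apply/derivable1_diffP.
by have := df z => -[].
Qed.

(** The bound on [c - x] covers both signs of [y] at once. *)
Lemma mean_value f f1 : (forall x : R, is_derive x 1 f (f1 x)) ->
  forall x y, exists2 c, `|c - x| <= `|y| & f (x + y) - f x = f1 c * y.
Proof.
move=> df x y.
have cf := is_derive1_continuous df.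
have [y0|y0] := leP 0 y.
  have [||c] := @MVT_segment _ f f1 x (x + y) _ (fun z _ => df z).
  - by rewrite lerDl.
  - exact: continuous_subspaceT.
  rewrite in_itv /= => /andP[xc cy] fE; exists c; last by rewrite fE addrAC subrr add0r.
  by rewrite !ger0_norm ?subr_ge0// lerBlDl.
have [||c] := @MVT_segment _ f f1 (x + y) x _ (fun z _ => df z).
- by rewrite gerDl ltW.
- exact: continuous_subspaceT.
rewrite in_itv /= => /andP[xc cy] fE; exists c.
  by rewrite distrC ger0_norm ?subr_ge0// ltr0_norm// lerBlDl -lerBlDr opprK.
by rewrite -opprB fE opprD addNKr mulrN opprK.
Qed.

Lemma is_derive_difference_quotient F u h :
  (forall x : R, is_derive x 1 F (u x)) -> forall x : R,
  is_derive x 1 (fun y => (F (y + h) - F y) / h) ((u (x + h) - u x) / h).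
Proof.
move=> dF x.
have dFh : is_derive x 1 (F \o shift h) (u (x + h)).
  have := @is_derive1_comp R F (shift h) x (u (x + h)) 1 (dF _) (is_derive_shift _ _ _).
  by rewrite mulr1.
have -> : (fun y => (F (y + h) - F y) / h) = h^-1 \*: ((F \o shift h) - F).
  by apply/funext => y; rewrite /= mulrC.
have -> : (u (x + h) - u x) / h = h^-1 *: (u (x + h) - u x) by rewrite mulrC.
exact: is_deriveZ.
Qed.

(** [v x] is the mean value of [u] over [x, x + h], which is attained. *)
Lemma moving_average u M h : continuous u -> 0 < h -> (forall x, `|u x| <= M) ->
  exists v : R -> R, [/\ forall x : R, is_derive x 1 v ((u (x + h) - u x) / h),
    forall x, `|v x| <= M &
    forall x, exists2 c, `|c - x| <= h & v x = u c].
Proof.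
move=> cu h0 uM; have [F dF] := antiderivative cu.
have vE x : exists2 c, `|c - x| <= h & (F (x + h) - F x) / h = u c.
  have [c xc FE] := mean_value dF x h.
  exists c; first by rewrite (le_trans xc)// gtr0_norm.
  by rewrite FE mulfK// gt_eqF.
exists (fun x => (F (x + h) - F x) / h); split => //.
- exact: is_derive_difference_quotient.
- by move=> x; have [c _ ->] := vE x.
Qed.

(** A class of functions for which the second order Taylor remainder is uniformly
    o(y^2). *)
Definition test_function M g g1 g2 :=
  [/\ forall x : R, is_derive x 1 g (g1 x),
      forall x : R, is_derive x 1 g1 (g2 x),
      (forall x : R, `|g x| <= M), (forall x : R, `|g2 x| <= M) &
      uniformly_continuous g2].

(** Each moving average gains one derivative, and these derivatives are
    difference quotients, which inherit the bounds and the uniform continuity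
    of [u]; two averages are thus enough. *)
Lemma smoothing u M e : continuous u -> uniformly_continuous u ->
  (forall x, `|u x| <= M) -> 0 < e ->
  exists g g1 g2 M', [/\ test_function M' g g1 g2,
    forall x, `|g1 x| <= M' & forall x, `|u x - g x| <= e].
Proof.
move=> cu ucu uM e0.
have M0 : 0 <= M by exact: le_trans (uM 0).
have e40 : 0 < e / 4 by rewrite divr_gt0.
have [D D0 uD] := ucu _ e40.
pose h := D / 2; have h0 : 0 < h by rewrite divr_gt0.
have hD : h < D by rewrite ltr_pdivrMr// ltr_pMr// ltr1n.
have {}uD x y : `|x - y| <= h -> `|u x - u y| <= e / 4.
  by move=> xy; apply: uD; rewrite (le_lt_trans xy).
have [v [dv vM vE]] := moving_average cu h0 uM.
have cv := is_derive1_continuous dv.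
have [g [dg gM gE]] := moving_average cv h0 vM.
have uv x : `|u x - v x| <= e / 4.
  by have [c xc ->] := vE x; apply: uD; rewrite distrC.
pose g1 x := (v (x + h) - v x) / h.
pose v1 x := (u (x + h) - u x) / h.
pose g2 x := (v1 (x + h) - v1 x) / h.
exists g, g1, g2, (M + 2 * M / h + 2 * (2 * M / h) / h).
have hM : 0 <= 2 * M / h by rewrite divr_ge0 ?mulr_ge0// ltW.
have hM2 : 0 <= 2 * (2 * M / h) / h by apply: divr_ge0; [exact: mulr_ge0|exact: ltW].
have diff_le (w : R -> R) W : (forall x, `|w x| <= W) ->
    forall x, `|(w (x + h) - w x) / h| <= 2 * W / h.
  move=> wW x; rewrite normrM [`|h^-1|]gtr0_norm ?invr_gt0// ler_pM2r ?invr_gt0//.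
  by rewrite (le_trans (ler_normB _ _))// mulr_natl mulr2n lerD.
have diff_uc (w : R -> R) : uniformly_continuous w ->
    uniformly_continuous (fun x => (w (x + h) - w x) / h).
  move=> ucw E E0; have Eh0 : 0 < E * h / 2 by rewrite divr_gt0// mulr_gt0.
  have [B B0 wB] := ucw _ Eh0; exists B => // x y xy.
  rewrite -mulrBl normrM [`|h^-1|]gtr0_norm ?invr_gt0// ler_pdivrMr//.
  have -> : w (x + h) - w x - (w (y + h) - w y) =
    (w (x + h) - w (y + h)) - (w x - w y) by ring.
  rewrite (le_trans (ler_normB _ _))// [leRHS]splitr lerD//; last exact: wB.
  by apply: wB; have -> : x + h - (y + h) = x - y by ring.
split; first split.
- exact: dg.
- exact: is_derive_difference_quotient.
- by move=> x; rewrite (le_trans (gM x))// -addrA lerDl addr_ge0.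
- move=> x; rewrite (le_trans (diff_le _ _ (diff_le _ _ uM) x))//.
  by rewrite lerDr addr_ge0.
- exact/diff_uc/diff_uc.
- move=> x; rewrite (le_trans (diff_le _ _ vM x))//.
  by rewrite -addrA addrC -addrA lerDl addr_ge0.
move=> x; have [c xc ->] := gE x.
have -> : u x - v c = (u x - u c) + (u c - v c) by ring.
rewrite (le_trans (ler_normD _ _))//.
have h1 : `|u x - u c| <= e / 4 by apply: uD; rewrite distrC.
have := uv c; lra.
Qed.

(** Composing [f] with a clamping to a large interval makes it uniformly
    continuous, and the error made outside of the interval is absorbed by
    [x ^+ 2]. *)
Lemma test_function_approx f M e : continuous f -> (forall x, `|f x| <= M) ->
  0 < e -> exists g g1 g2 M', [/\ test_function M' g g1 g2,
    forall x, `|g1 x| <= M' & forall x, `|f x - g x| <= e * (1 + x ^+ 2)].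
Proof.
move=> cf fM e0.
have M0 : 0 <= M by exact: le_trans (fM 0).
have e20 : 0 < e / 2 by rewrite divr_gt0.
(* outside of [-B, B], the deviation 2 M is at most (e / 2) x ^ 2 *)
pose B := Num.sqrt (4 * M / e) + 1.
have B0 : 0 < B by rewrite /B ltr_wpDl// sqrtr_ge0.
have B2 : 4 * M / e <= B ^+ 2.
  have A0 : 0 <= 4 * M / e by rewrite divr_ge0 ?mulr_ge0// ltW.
  rewrite -[leLHS]sqr_sqrtr// /B lerXn2r ?nnegrE ?addr_ge0 ?sqrtr_ge0//.
  by rewrite lerDl.
pose clamp (x : R) := Num.max (- B) (Num.min x B).
pose u := f \o clamp.
have clampB x : clamp x \in `[- B, B].
  rewrite in_itv /=; apply/andP; split; first by rewrite /clamp le_max lexx.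
  by rewrite /clamp ge_max ge_min lexx orbT andbT; lra.
have clampL x y : `|clamp x - clamp y| <= `|x - y|.
  have clampE z : [\/ z <= - B /\ clamp z = - B, - B <= z <= B /\ clamp z = z |
      B <= z /\ clamp z = B].
    rewrite /clamp; have [zB|/ltW zB] := leP z B; last first.
      by apply: Or33; split => //; rewrite max_r//; lra.
    have [Bz|/ltW zB'] := leP (- B) z; last by apply: Or31.
    by apply: Or32; split => //; apply/andP; split.
  have := normr_ge0 (x - y); have := ler_norm (x - y).
  have := ler_norm (y - x); rewrite (distrC y) => h1 h2 h3.
  by case: (clampE x) => -[hx ->]; case: (clampE y) => -[hy ->];
    rewrite ler_norml; apply/andP; split; lra.
have cu : continuous u.
  move=> x; apply: (@continuous_comp _ _ _ clamp f); last exact: cf.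
  apply/cvgrPdist_lt => E E0; apply/nbhs_ballP; exists E => // y xy.
  exact: le_lt_trans (clampL x y) xy.
have ucu : uniformly_continuous u.
  move=> E E0; have [D D0 fD] := heine (- B) B cf E0; exists D => // x y xy.
  by apply: fD => //; exact: le_lt_trans xy.
have uM x : `|u x| <= M by exact: fM.
have [g [g1 [g2 [M' [tg g1M ug]]]]] := smoothing cu ucu uM e20.
exists g, g1, g2, M'; split => // x.
have -> : f x - g x = (f x - u x) + (u x - g x) by ring.
rewrite (le_trans (ler_normD _ _))// addrC.
have [xB|xB] := leP `|x| B.
  have -> : `|f x - u x| = 0.
    rewrite /u /= /clamp; move: xB; rewrite ler_norml => /andP[Bx xB].
    by rewrite min_l// max_r// subrr normr0.
  rewrite addr0 (le_trans (ug x))//.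
  have : 0 <= e * x ^+ 2 by rewrite mulr_ge0 ?sqr_ge0// ltW.
  by lra.
have fu : `|f x - u x| <= 2 * M.
  by rewrite (le_trans (ler_normB _ _))// mulr_natl mulr2n lerD.
have x2 : B ^+ 2 <= x ^+ 2.
  rewrite -[leRHS]real_normK ?num_real//; apply: lerXn2r; rewrite ?nnegrE//.
    exact: ltW.
  exact: ltW.
have : 4 * M <= x ^+ 2 * e by rewrite -ler_pdivrMr// (le_trans B2).
have := ug x; lra.
Qed.

End smoothing.

(** * Comparison of sums by Trotter's method *)

Section trotter.
Context (R : realType).
Local Notation RT := (measurableTypeR R).
Implicit Types (m : probability RT R).

Definition centered m (s2 : R) := [/\ square_integrable m (id : RT -> R),
  \int[m]_t (t : R) = 0 & \int[m]_t (t : R) ^+ 2 = s2].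

Lemma measurable_sqr_tail (a : R) :
  measurable_fun [set: RT] (fun t : RT => if a <= `|t| then t ^+ 2 else 0 : R).
Proof.
apply: (@measurable_fun_ifT _ _ RT RT).
- apply: measurable_fun_ler => //; exact: (@measurableT_comp _ _ _ _ _ _ normr).
- exact: (@measurable_funX _ RT R setT id).
- exact: measurable_cst.
Qed.

Lemma sqr_tail_le (a t : R) : `|if a <= `|t| then t ^+ 2 else 0| <= t ^+ 2.
Proof.
by case: ifP => _; rewrite ?normr0 ?sqr_ge0// ger0_norm// sqr_ge0.
Qed.

(** The Lindeberg condition for identically distributed variables, by
    dominated convergence. *)
Lemma second_moment_tail m (D : R) : 0 < D -> square_integrable m (id : RT -> R) ->
  \int[m]_t (if D * Num.sqrt n%:R <= `|t| then t ^+ 2 else 0) @[n --> \oo] --> (0 : R).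
Proof.
move=> D0 [_ id2].
pose F n (t : RT) : R := if D * Num.sqrt n%:R <= `|t| then t ^+ 2 else 0.
have F_le n t : `|F n t| <= t ^+ 2 by exact: sqr_tail_le.
have mF n : measurable_fun setT (F n) by exact: measurable_sqr_tail.
have Fi n : rintegrable m (F n) by exact: rintegrable_le id2.
have cvg0 : ((\int[m]_t (F n t)%:E)%E @[n --> \oo] --> (\int[m]_t (0%:E : \bar R))%E).
  apply: (@dominated_cvg _ _ _ m setT measurableT (fun n t => (F n t)%:E)
    (fun=> 0%:E) (fun t => (t ^+ 2)%:E)) => //.
  - by move=> n; exact/measurable_EFinP.
  - move=> t _; apply/cvg_EFin; first exact: nearW.
    apply/cvgrPdist_lt => e e0.
    exists (Num.truncn ((`|t| / D) ^+ 2)).+1 => // n /= hn.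
    rewrite /F ifF ?subrr ?normr0//; apply/negbTE; rewrite -ltNge.
    rewrite -ltr_pdivrMl// mulrC.
    have td0 : 0 <= `|t| / D by rewrite divr_ge0// ltW.
    rewrite -[ltLHS]ger0_norm// -sqrtr_sqr ltr_sqrt ?ltr0n; last exact: leq_trans hn.
    apply: lt_le_trans (truncnS_gt _) _; by rewrite ler_nat.
  - by move=> n t _; rewrite /= lee_fin.
rewrite integral0 in cvg0.
exact: (fine_cvg cvg0).
Qed.

(** For small [y] the remainder is controlled by the continuity of [g2], for
    large [y] by its boundedness. *)
Lemma taylor2 M g g1 g2 (e D : R) : test_function M g g1 g2 -> 0 <= M -> 0 <= e ->
  (forall x y, `|x - y| < D -> `|g2 x - g2 y| <= e) ->
  forall x y, `|g (x + y) - (g x + y * g1 x + y ^+ 2 / 2 * g2 x)| <=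
    e * y ^+ 2 + 2 * M * (if D <= `|y| then y ^+ 2 else 0).
Proof.
move=> [dg dg1 gM g2M _] M0 e0 g2e x y.
pose f z := g (x + z) - (g x + z * g1 x + z ^+ 2 / 2 * g2 x).
pose f1 z := g1 (x + z) - g1 x - z * g2 x.
have df z : is_derive (z : R) 1 f (f1 z).
  have dgx : is_derive z 1 (g \o shift x) (g1 (x + z)).
    have := @is_derive1_comp R g (shift x) z (g1 (z + x)) 1 (dg _) (is_derive_shift _ _ _).
    by rewrite mulr1 addrC.
  have h1 := @is_deriveX R R (id : R -> R) 2 z 1 1 (is_derive_id z 1).
  have h2 := is_deriveD (is_deriveZ (g1 x) (is_derive_id z (1 : R)))
    (is_deriveZ (g2 x / 2) h1).
  have H := is_deriveB (is_deriveB dgx (is_derive_cst (g x) z (1 : R))) h2.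
  set F := (X in is_derive _ _ X _) in H; set F' := (X in is_derive _ _ _ X) in H.
  have -> : f = F.
    by apply/funext => t; rewrite /f /F !fctE /= [t + x]addrC /GRing.scale /=; ring.
  have -> : f1 z = F' by rewrite /f1 /F' /GRing.scale /=; field.
  exact: H.
have [c cy fE] := mean_value df 0 y.
have -> : g (x + y) - (g x + y * g1 x + y ^+ 2 / 2 * g2 x) = f1 c * y.
  by rewrite -fE add0r /f addr0; ring.
have [d dc g1E] := mean_value dg1 x c.
have -> : f1 c = c * (g2 d - g2 x) by rewrite /f1 g1E; ring.
rewrite subr0 in cy.
have cy2 : `|c| * `|y| <= y ^+ 2.
  by rewrite -[leRHS]real_normK ?num_real// expr2 ler_wpM2r.
rewrite !normrM mulrAC.
have [Dy|yD] := leP D `|y|.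
  have : `|g2 d - g2 x| <= 2 * M.
    by rewrite (le_trans (ler_normB _ _))// mulr_natl mulr2n lerD.
  move=> h; have : `|c| * `|y| * `|g2 d - g2 x| <= y ^+ 2 * (2 * M).
    by apply: ler_pM => //; rewrite mulr_ge0.
  have : 0 <= e * y ^+ 2 by rewrite mulr_ge0// sqr_ge0.
  by lra.
have h : `|g2 d - g2 x| <= e.
  by apply: g2e; rewrite (le_lt_trans dc)// (le_lt_trans cy).
rewrite mulr0 addr0 [leRHS]mulrC; apply: ler_pM => //; by rewrite mulr_ge0.
Qed.

(** One step of the sum acts on [g] as [1 + (s2 / 2n) d^2/dx^2] up to o(1/n),
    whatever the law: the first order term vanishes as the law is centered. *)
Lemma generator m s2 M g g1 g2 : centered m s2 -> test_function M g g1 g2 ->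
  forall e : R, 0 < e -> \forall n \near \oo, forall x,
    `|smear m (Num.sqrt n%:R)^-1 g x - (g x + n%:R^-1 * (s2 / 2 * g2 x))| <= e / n%:R.
Proof.
move=> [id2 m1 m2] tg e e0; have [dg dg1 gM g2M ucg2] := tg.
have M0 : 0 <= M by exact: le_trans (gM 0).
have s20 : 0 <= s2 by rewrite -m2; apply: Rintegral_ge0 => t _; exact: sqr_ge0.
(* the two terms of the Taylor remainder contribute at most e / 2 each; the
   summands 1 keep the denominators positive *)
pose e' := e / (2 * (s2 + 1)).
have e'0 : 0 < e' by rewrite divr_gt0// mulr_gt0// ltr_wpDl.
have [D D0 gD] := ucg2 _ e'0.
have e''0 : 0 < e / (2 * (2 * M + 1)).
  by rewrite divr_gt0// mulr_gt0// ltr_wpDl// mulr_ge0.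
have := second_moment_tail D0 id2 => /cvgrPdist_lt /(_ _ e''0) tl.
near=> n => x.
have n0 : 0 < n%:R :> R by rewrite ltr0n; near: n; exists 1%N.
pose c := (Num.sqrt n%:R)^-1 : R.
have c0 : 0 < c by rewrite invr_gt0 sqrtr_gt0.
have c2 : c ^+ 2 = n%:R^-1 by rewrite exprVn sqr_sqrtr// ltW.
pose T (t : RT) : R := if D * Num.sqrt n%:R <= `|t| then t ^+ 2 else 0.
pose tau := \int[m]_t T t.
have tau_le : tau <= e / (2 * (2 * M + 1)).
  have : `|0 - \int[m]_t (if D * Num.sqrt n%:R <= `|t| then t ^+ 2 else 0)| <
      e / (2 * (2 * M + 1)) by near: n; exact: tl.
  by rewrite sub0r normrN => /ltW; apply: le_trans; exact: ler_norm.
have mg : measurable_fun [set: R] g.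
  apply: continuous_measurable_fun; exact: is_derive1_continuous dg.
have iid := square_integrable_rintegrable id2; case: (id2) => mid id2'.
have ig : rintegrable m (fun t : RT => g (x + c * t)).
  by apply: (@rintegrable_smear _ m c M).
have ip : rintegrable m (fun t : RT => g x + c * t * g1 x + (c * t) ^+ 2 / 2 * g2 x).
  have -> : (fun t : RT => g x + c * t * g1 x + (c * t) ^+ 2 / 2 * g2 x) =
    (fun t : RT => g x + (c * g1 x) * t + (c ^+ 2 / 2 * g2 x) * t ^+ 2).
    by apply/funext => t; ring.
  apply: rintegrableD; last exact: rintegrableZl.
  by apply: rintegrableD; [exact: rintegrable_cst|exact: rintegrableZl].
have pE : \int[m]_t (g x + c * t * g1 x + (c * t) ^+ 2 / 2 * g2 x) =
    g x + n%:R^-1 * (s2 / 2 * g2 x).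
  have -> : \int[m]_t (g x + c * t * g1 x + (c * t) ^+ 2 / 2 * g2 x) =
    \int[m]_t (g x + (c * g1 x) * t + (c ^+ 2 / 2 * g2 x) * t ^+ 2).
    by apply: eq_Rintegral => t _; ring.
  have i1 := rintegrableZl (c * g1 x) iid.
  have i2 := rintegrableZl (c ^+ 2 / 2 * g2 x) id2'.
  have i0 := rintegrable_cst m (g x).
  rewrite RintegralD//; last exact: rintegrableD.
  rewrite RintegralD// Rintegral_prob_cst RintegralZl// RintegralZl//.
  by rewrite m1 m2 c2; ring.
rewrite /smear -pE -/c -RintegralB//.
have Ti : rintegrable m T.
  apply: (rintegrable_le _ _ id2'); first exact: measurable_sqr_tail.
  by move=> t; exact: sqr_tail_le.
have ir := rintegrableB ig ip.
apply: (le_trans (le_normr_Rintegral measurableT ir)).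
apply: (@le_trans _ _ (\int[m]_t (e' * c ^+ 2 * t ^+ 2 + 2 * M * c ^+ 2 * T t))).
  apply: le_Rintegral => //.
  - exact: rintegrable_norm.
  - by apply: rintegrableD; exact: rintegrableZl.
  move=> t _; rewrite (le_trans (taylor2 tg M0 (ltW e'0) gD x (c * t)))//.
  rewrite le_eqVlt; apply/orP; left; apply/eqP.
  have -> : (D <= `|c * t|) = (D * Num.sqrt n%:R <= `|t|).
    by rewrite normrM gtr0_norm// mulrC ler_pdivlMr// sqrtr_gt0.
  by rewrite /T; case: ifP => _; ring.
rewrite RintegralD//; try exact: rintegrableZl.
rewrite RintegralZl// RintegralZl// m2 -/tau c2.
have -> : e' / n%:R * s2 + 2 * M / n%:R * tau = (e' * s2 + 2 * M * tau) / n%:R by ring.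
rewrite ler_pM2r ?invr_gt0//.
have h1 : e' * s2 <= e / 2.
  have -> : e / 2 = e' * (s2 + 1) by rewrite /e'; field; lra.
  by rewrite ler_pM2l//; lra.
have h2 : 2 * M * tau <= e / 2.
  have -> : e / 2 = (2 * M + 1) * (e / (2 * (2 * M + 1))) by field; lra.
  have tau0 : 0 <= tau.
    by apply: Rintegral_ge0 => t _; rewrite /T; case: ifP => // _; exact: sqr_ge0.
  apply: ler_pM => //; first exact: mulr_ge0.
  by lra.
lra.
Unshelve. all: by end_near. Qed.

Lemma iid_test_function_cvg m m' s2 M g g1 g2 x : centered m s2 -> centered m' s2 ->
  test_function M g g1 g2 ->
  (forall n, (0 < n)%N -> iter n (smear m' (Num.sqrt n%:R)^-1) g x = smear m' 1 g x) ->
  iter n (smear m (Num.sqrt n%:R)^-1) g x @[n --> \oo] --> smear m' 1 g x.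
Proof.
move=> cm cm' tg stable; have [dg dg1 gM g2M ucg2] := tg.
have bg : bounded_measurable M g.
  split => //; apply: continuous_measurable_fun; exact: is_derive1_continuous dg.
apply/cvgrPdist_le => e e0.
have e20 : 0 < e / 2 by rewrite divr_gt0.
have G1 := generator cm tg e20; have G2 := generator cm' tg e20.
near=> n.
have n0 : (0 < n)%N by near: n; exists 1%N.
rewrite -(stable _ n0) distrC.
have nR : n%:R != 0 :> R by rewrite pnatr_eq0 -lt0n.
have -> : e = (e / n%:R) *+ n by rewrite -mulr_natr divfK.
apply: (iter_smear_dist n bg) => y.
rewrite -(subrKA (g y + n%:R^-1 * (s2 / 2 * g2 y))).
rewrite (le_trans (ler_normD _ _))//.
have -> : e / n%:R = e / 2 / n%:R + e / 2 / n%:R by field.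
by apply: lerD; last rewrite distrC; [move: y; near: n; exact: G1
  |move: y; near: n; exact: G2].
Unshelve. all: by end_near. Qed.

End trotter.

(** * Convolution and moments of normal laws *)

Section density.
Import HBNNSimple.

(** The formula is linear in [h] and passes to nondecreasing limits, so simple
    functions are enough. *)
Lemma density_ge0_integral (R : realType) d (T : measurableType d)
    (m nu : {measure set T -> \bar R}) (p : T -> R) :
  measurable_fun setT p -> (forall t, 0 <= p t) ->
  (forall A, measurable A -> m A = \int[nu]_(t in A) (p t)%:E)%E ->
  forall h : T -> \bar R, measurable_fun setT h -> (forall t, 0 <= h t)%E ->
  (\int[m]_t h t = \int[nu]_t (h t * (p t)%:E))%E.
Proof.
move=> /measurable_EFinP mp p0 mE h mh h0.
pose h_ := nnsfun_approx measurableT mh.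
have h_cvg t : (h_ n t)%:E @[n --> \oo] --> h t.
  by apply: cvg_nnsfun_approx => // x _; exact: h0.
have -> : (\int[m]_t h t = limn (fun n => \int[m]_t (h_ n t)%:E))%E.
  rewrite -monotone_convergence//.
  - by apply: eq_integral => t _; apply/esym/cvg_lim => //; exact: h_cvg.
  - by move=> n; exact/measurable_EFinP.
  - by move=> n t _; rewrite lee_fin.
  - by move=> t _ a b ab; rewrite lee_fin; exact/lefP/nd_nnsfun_approx.
have -> : (\int[nu]_t (h t * (p t)%:E) =
    limn (fun n => \int[nu]_t ((h_ n t)%:E * (p t)%:E)))%E.
  rewrite -monotone_convergence//.
  - apply: eq_integral => t _; apply/esym/cvg_lim => //.
    by apply: cvgeZr => //; exact: h_cvg.
  - by move=> n; apply: emeasurable_funM => //; exact/measurable_EFinP.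
  - by move=> n t _; rewrite mule_ge0 ?lee_fin.
  - move=> t _ a b ab; rewrite lee_wpmul2r ?lee_fin//; exact/lefP/nd_nnsfun_approx.
congr (limn _); apply/funext => n.
under [LHS]eq_integral do rewrite fimfunE -fsumEFin//.
under [RHS]eq_integral => t _.
  rewrite fimfunE -fsumEFin// ge0_mule_fsuml; last first.
    by move=> y; exact: nnfun_muleindic_ge0.
  over.
rewrite [LHS]ge0_integral_fsum//; last 2 first.
- by move=> y; exact/measurable_EFinP/measurable_funM.
- by move=> y t _; exact: nnfun_muleindic_ge0.
rewrite [RHS]ge0_integral_fsum//; last 2 first.
- by move=> y; apply: emeasurable_funM => //; exact/measurable_EFinP/measurable_funM.
- by move=> y t _; rewrite mule_ge0 ?lee_fin//; exact: nnfun_muleindic_ge0.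
apply: eq_fsbigr => y yh.
under [LHS]eq_integral do rewrite EFinM.
rewrite integralZl_indic_nnsfun//.
under [RHS]eq_integral do rewrite EFinM -muleA.
rewrite ge0_integralZl//; first last.
- by rewrite lee_fin; move: yh; rewrite inE => -[t _ <-].
- by move=> t _; rewrite mule_ge0 ?lee_fin.
- by apply: emeasurable_funM => //; exact/measurable_EFinP.
congr (_ * _)%E; rewrite integral_indic// setIT mE//.
rewrite [LHS]integral_mkcond; apply: eq_integral => t _.
by rewrite epatch_indic muleC.
Qed.

End density.

Section affine.
Context (R : realType).
Local Notation RT := (measurableTypeR R).
Local Notation mu := (@lebesgue_measure R).

Definition affine_map (a c : R) (t : RT) : RT := a * t + c.

Lemma measurable_affine_map a c : measurable_fun setT (affine_map a c).
Proof. by apply: measurable_funD => //; exact: measurable_funM. Qed.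

HB.instance Definition _ a c := isMeasurableFun.Build _ _ _ _ (affine_map a c)
  (measurable_affine_map a c).

(** The image of Lebesgue measure, multiplied by [a], agrees with Lebesgue
    measure on intervals, which characterizes it. *)
Lemma lebesgue_measure_affine (a c : R) A : 0 < a -> measurable (A : set RT) ->
  mu (affine_map a c @^-1` A) = (a^-1%:E * mu A)%E.
Proof.
move=> a0 mA.
pose nu : {measure set RT -> \bar R} := pushforward mu (affine_map a c).
pose m : {measure set RT -> \bar R} :=
  mscale (NngNum (ltW a0)) (nu (measurable_affine_map a c)).
have mE : forall A, measurable A -> mu A = m A.
  apply: lebesgue_measure_unique => _ [[u v] _ <-].
  pose J : set RT := `](u - c) / a, (v - c) / a]%classic.
  transitivity (a%:E * mu J)%E; last first.
    congr (_ * mu _)%E; apply/seteqP; split => t;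
      rewrite /J /affine_map /= !in_itv /= ltr_pdivrMr// ler_pdivlMr//;
      by rewrite ltrBlDr lerBrDr mulrC.
  rewrite /J !lebesgue_measure_itv /= !lte_fin ltr_pM2r ?invr_gt0// ltrD2r.
  case: ifP => _; last by rewrite mule0.
  rewrite -!EFinB -EFinM; congr _%:E; field; lra.
rewrite [in RHS]mE//.
transitivity (a^-1%:E * (a%:E * mu (affine_map a c @^-1` A)))%E; last by [].
by rewrite muleA -EFinM mulVf ?mul1e ?gt_eqF.
Qed.

Lemma ge0_integral_affine (a c : R) (f : RT -> \bar R) : 0 < a ->
  measurable_fun setT f -> (forall t, 0 <= f t)%E ->
  (\int[mu]_t f (a * t + c)%R = \int[mu]_t (f t * a^-1%:E))%E.
Proof.
move=> a0 mf f0.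
pose nu : {measure set RT -> \bar R} := pushforward mu (affine_map a c).
rewrite -(@density_ge0_integral _ _ _ (nu (measurable_affine_map a c)) mu (fun=> a^-1))//.
- by rewrite ge0_integral_pushforward.
- by move=> t; rewrite invr_ge0 ltW.
- move=> A mA; rewrite integral_cst//; exact: lebesgue_measure_affine.
Qed.

End affine.

Section gaussian.
Context (R : realType).
Local Notation RT := (measurableTypeR R).
Local Notation mu := (@lebesgue_measure R).
Implicit Types s t : R.

Lemma ge0_integral_normal_prob (m s : R) (h : RT -> \bar R) :
  measurable_fun setT h -> (forall t, 0 <= h t)%E ->
  (\int[normal_prob m s]_t h t = \int[mu]_t (h t * (normal_pdf m s t)%:E))%E.
Proof.
move=> mh h0; apply: (@density_ge0_integral R _ RT (normal_prob m s) mu (normal_pdf m s)) => //.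
- exact: measurable_normal_pdf.
- by move=> t; exact: normal_pdf_ge0.
Qed.

Lemma normal_pdf_affine (a c s : R) t : 0 < a -> 0 < s ->
  normal_pdf c (a * s) (a * t + c) * a = normal_pdf 0 s t.
Proof.
move=> a0 s0; have as0 : 0 < a * s by rewrite mulr_gt0.
rewrite !normal_pdfE ?gt_eqF// /normal_peak /normal_fun.
have -> : (a * s) ^+ 2 * pi *+ 2 = a ^+ 2 * (s ^+ 2 * pi *+ 2) by rewrite !mulr2n; ring.
rewrite sqrtrM ?sqr_ge0// sqrtr_sqr gtr0_norm// invfM.
have -> : - (a * t + c - c) ^+ 2 / ((a * s) ^+ 2 *+ 2) = - (t - 0) ^+ 2 / (s ^+ 2 *+ 2).
  rewrite !mulr2n; field.
  by apply/andP; split; rewrite gt_eqF// addr_gt0// exprn_gt0.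
move: (Num.sqrt _)^-1 (expR _) => x y.
by field; rewrite gt_eqF.
Qed.

Lemma normal_prob_affine (a c s : R) A : 0 < a -> 0 < s -> measurable (A : set RT) ->
  normal_prob 0 s (affine_map a c @^-1` A) = normal_prob c (a * s) A.
Proof.
move=> a0 s0 mA; rewrite /normal_prob [LHS]integral_mkcond [RHS]integral_mkcond.
pose f (w : RT) : \bar R := (((fun w => (normal_pdf c (a * s) w)%:E) \_ A) w * a%:E)%E.
transitivity (\int[mu]_t f (a * t + c)%R)%E.
  apply: eq_integral => t _; rewrite /f !patchE.
  have -> : (t \in affine_map a c @^-1` A) = (a * t + c \in A).
    by apply/idP/idP; rewrite !inE.
  case: ifP => _; last by rewrite mul0e.
  by rewrite -EFinM normal_pdf_affine.
have mpdf : measurable_fun setT ((fun w => (normal_pdf c (a * s) w)%:E) \_ A).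
  apply/(measurable_restrictT _ mA)/measurable_funTS/measurable_EFinP.
  exact: measurable_normal_pdf.
have pdf0 w : (0 <= ((fun w => (normal_pdf c (a * s) w)%:E) \_ A) w)%E.
  by rewrite patchE; case: ifP => // _; rewrite lee_fin normal_pdf_ge0.
rewrite ge0_integral_affine//; first last.
- by move=> w; rewrite /f mule_ge0// lee_fin ltW.
- by apply: emeasurable_funM.
by apply: eq_integral => w _; rewrite /f -muleA -EFinM divff ?mule1 ?gt_eqF.
Qed.

Lemma normal_peakE (s : R) : 0 < s -> normal_peak s = (s * Num.sqrt (pi *+ 2))^-1.
Proof.
move=> s0; rewrite /normal_peak -mulrnAr sqrtrM ?sqr_ge0// sqrtr_sqr.
by rewrite gtr0_norm.
Qed.

(** Completing the square: the joint density of (u, u + v) for independent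
    centered normal u and v is the density of the sum times a conditional
    density of u, which is normal. *)
Lemma normal_pdf_mul (s t u w : R) : 0 < s -> 0 < t ->
  normal_pdf u t w * normal_pdf 0 s u =
  normal_pdf 0 (Num.sqrt (s ^+ 2 + t ^+ 2)) w *
  normal_pdf (w * s ^+ 2 / (s ^+ 2 + t ^+ 2))
    (s * t / Num.sqrt (s ^+ 2 + t ^+ 2)) u.
Proof.
move=> s0 t0.
have r20 : 0 < s ^+ 2 + t ^+ 2 by rewrite addr_gt0// exprn_gt0.
set r := Num.sqrt _.
have r0 : 0 < r by rewrite sqrtr_gt0.
have rE : r ^+ 2 = s ^+ 2 + t ^+ 2 by rewrite sqr_sqrtr// ltW.
have q0 : 0 < s * t / r by rewrite divr_gt0// mulr_gt0.
have qE : (s * t / r) ^+ 2 = s ^+ 2 * t ^+ 2 / (s ^+ 2 + t ^+ 2).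
  by rewrite expr_div_n exprMn rE.
have p0 : 0 < Num.sqrt (pi *+ 2 : R) by rewrite sqrtr_gt0 mulrn_wgt0// pi_gt0.
rewrite !normal_pdfE ?gt_eqF// !normal_peakE// /normal_fun.
rewrite mulrACA [RHS]mulrACA; congr (_ * _).
  by field; rewrite !gt_eqF.
rewrite -!expRD; congr expR; rewrite rE qE !mulr2n; field.
have s20 : 0 < s ^+ 2 by rewrite exprn_gt0.
have t20 : 0 < t ^+ 2 by rewrite exprn_gt0.
have st20 : 0 < (s * t) ^+ 2 by rewrite exprn_gt0// mulr_gt0.
by rewrite !gt_eqF//; lra.
Qed.

Lemma measurable_normal_pdf2 (t : R) : 0 < t ->
  measurable_fun setT (fun z : (RT * RT)%type => normal_pdf z.1 t z.2).
Proof.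
move=> t0.
have -> : (fun z : (RT * RT)%type => normal_pdf z.1 t z.2) =
    normal_pdf 0 t \o (fun z : (RT * RT)%type => z.2 - z.1).
  apply/funext => z; rewrite /= !normal_pdfE ?gt_eqF// /normal_fun subr0.
  by [].
apply: measurableT_comp; first exact: measurable_normal_pdf.
by apply: measurable_funB; [exact: measurable_snd|exact: measurable_fst].
Qed.

(** The conditional density of [normal_pdf_mul] integrates to 1, which leaves
    the density of the sum. *)
Lemma same_law_normal_add (s t : R) : 0 < s -> 0 < t ->
  same_law (normal_prob 0 s \x normal_prob 0 t)%E
    (normal_prob 0 (Num.sqrt (s ^+ 2 + t ^+ 2)))
    (fun z : (RT * RT)%type => z.1 + z.2 : RT) id.
Proof.
move=> s0 t0.
have madd : measurable_fun setT (fun z : (RT * RT)%type => z.1 + z.2 : RT).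
  by apply: measurable_funD; [exact: measurable_fst|exact: measurable_snd].
have r20 : 0 < s ^+ 2 + t ^+ 2 by rewrite addr_gt0// exprn_gt0.
have r0 : 0 < Num.sqrt (s ^+ 2 + t ^+ 2) by rewrite sqrtr_gt0.
have q0 : 0 < s * t / Num.sqrt (s ^+ 2 + t ^+ 2) by rewrite divr_gt0// mulr_gt0.
split => // B mB; rewrite preimage_id.
pose g (u w : RT) : \bar R := ((normal_pdf u t w * normal_pdf 0 s u)%:E * (\1_B w)%:E)%E.
have mg : measurable_fun setT (fun z : (RT * RT)%type => g z.1 z.2).
  apply: emeasurable_funM.
    apply/measurable_EFinP; apply: measurable_funM; first exact: measurable_normal_pdf2.
    exact: (measurableT_comp (measurable_normal_pdf 0 s) measurable_fst).
  apply/measurable_EFinP.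
  apply: (@measurableT_comp _ _ _ _ _ _ (\1_B : RT -> R) _ (snd : RT * RT -> RT)).
    exact: measurable_indic.
  exact: measurable_snd.
have g0 z : (0 <= g z.1 z.2)%E.
  by rewrite /g -EFinM lee_fin !mulr_ge0 ?normal_pdf_ge0.
have sec u : (normal_prob 0%R t (xsection ((fun z : (RT * RT)%type => (z.1 + z.2)%R : RT) @^-1` B) u)
    = \int[mu]_w ((\1_B w)%:E * (normal_pdf u t w)%:E))%E.
  have -> : xsection ((fun z : (RT * RT)%type => z.1 + z.2 : RT) @^-1` B) u =
      affine_map 1 u @^-1` B.
    by apply/seteqP; split => v; rewrite /xsection /affine_map /= mul1r addrC inE.
  rewrite normal_prob_affine// mul1r /normal_prob integral_mkcond.
  by apply: eq_integral => w _; rewrite epatch_indic muleC.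
transitivity (\int[mu]_u \int[mu]_w g u w)%E.
  transitivity (\int[normal_prob 0 s]_u
      \int[mu]_w ((\1_B w)%:E * (normal_pdf u t w)%:E))%E.
    by apply: eq_integral => u _ /=; rewrite sec.
  rewrite ge0_integral_normal_prob; last 2 first.
  - under eq_fun do rewrite -sec.
    apply: measurable_fun_xsection.
    by have := madd measurableT _ mB; rewrite setTI.
  - by move=> u; apply: integral_ge0 => w _; rewrite mule_ge0// lee_fin normal_pdf_ge0.
  apply: eq_integral => u _; rewrite -ge0_integralZr//; last 3 first.
  - apply: emeasurable_funM; apply/measurable_EFinP.
      exact: measurable_indic.
    exact: measurable_normal_pdf.
  - by move=> w _; rewrite mule_ge0// lee_fin normal_pdf_ge0.
  - by rewrite lee_fin normal_pdf_ge0.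
  by apply: eq_integral => w _; rewrite /g EFinM [RHS]muleC muleA.
rewrite (fubini_tonelli (fun z : (RT * RT)%type => g z.1 z.2) mg g0) /fubini_G /=.
rewrite /normal_prob [RHS]integral_mkcond; apply: eq_integral => w _.
rewrite /g epatch_indic.
under eq_integral do rewrite normal_pdf_mul// EFinM muleAC.
rewrite ge0_integralZl//; last 3 first.
- by apply/measurable_EFinP; exact: measurable_normal_pdf.
- by move=> u _; rewrite lee_fin normal_pdf_ge0.
- by rewrite mule_ge0// lee_fin normal_pdf_ge0.
by rewrite integral_normal_pdf mule1.
Qed.

Lemma measurable_translate (f : R -> R) (x : R) : measurable_fun [set: R] f ->
  measurable_fun [set: RT] (fun u : RT => f (x + u)).
Proof.
move=> mf; have mx : measurable_fun [set: RT] (fun u : RT => x + u : RT).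
  exact: (@measurable_funD _ RT R setT (cst x) id).
exact: (measurableT_comp mf mx).
Qed.

Lemma smear_normal (s a M : R) (f : R -> R) (x : R) : 0 < s -> 0 < a ->
  bounded_measurable M f ->
  smear (normal_prob 0 s) a f x = \int[normal_prob 0 (a * s)]_u f (x + u).
Proof.
move=> s0 a0 [mf _].
have sl : same_law (normal_prob 0 s) (normal_prob 0 (a * s)) (affine_map a 0) id.
  split; [exact: measurable_affine_map|exact: measurable_id|].
  by move=> B mB; rewrite preimage_id; exact: normal_prob_affine.
have mf' : measurable_fun [set: RT] (fun u : RT => f (x + u)).
  exact: measurable_translate.
rewrite -(same_law_Rintegral sl mf').
by apply: eq_Rintegral => t _; rewrite /affine_map addr0.
Qed.

Lemma smear_smear_normal (s a b M : R) (f : R -> R) : 0 < s -> 0 < a -> 0 < b ->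
  bounded_measurable M f ->
  smear (normal_prob 0 s) a (smear (normal_prob 0 s) b f) =
  smear (normal_prob 0 s) (Num.sqrt (a ^+ 2 + b ^+ 2)) f.
Proof.
move=> s0 a0 b0 fM; have [mf f_le] := fM; apply/funext => x.
have ab0 : 0 < a ^+ 2 + b ^+ 2 by rewrite addr_gt0// exprn_gt0.
have r0 : 0 < Num.sqrt (a ^+ 2 + b ^+ 2) by rewrite sqrtr_gt0.
rewrite [LHS](smear_normal x s0 a0 (bounded_measurable_smear (normal_prob 0 s) b fM)).
rewrite [RHS](smear_normal x s0 r0 fM).
under eq_Rintegral do rewrite (smear_normal _ s0 b0 fM).
have as0 : 0 < a * s by rewrite mulr_gt0.
have bs0 : 0 < b * s by rewrite mulr_gt0.
have sl := same_law_normal_add as0 bs0.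
have -> : Num.sqrt (a ^+ 2 + b ^+ 2) * s = Num.sqrt ((a * s) ^+ 2 + (b * s) ^+ 2).
  by rewrite !exprMn -mulrDl sqrtrM ?ltW// sqrtr_sqr gtr0_norm.
have mf' y : measurable_fun [set: RT] (fun u : RT => f (y + u)).
  exact: measurable_translate.
rewrite -(same_law_Rintegral sl (mf' x)).
have [madd _ _] := sl.
have Fi : rintegrable (normal_prob 0 (a * s) \x normal_prob 0 (b * s))%E
    (fun z : (RT * RT)%type => f (x + (z.1 + z.2))).
  apply: (@rintegrable_bounded _ _ _ _ _ M).
    exact: (measurableT_comp (mf' x) madd).
  by move=> z; exact: f_le.
have [u|_ ->] := Rintegral_fubini Fi.
  apply: (@rintegrable_bounded _ _ _ _ _ M); last by move=> z; exact: f_le.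
  have := mf' (x + u); apply: eq_measurable_fun => v _; by rewrite /= addrA.
by apply: eq_Rintegral => u _; apply: eq_Rintegral => v _; rewrite addrA.
Qed.

Lemma iter_smear_normal (s c M : R) (f : R -> R) n : 0 < s -> 0 < c ->
  bounded_measurable M f ->
  iter n.+1 (smear (normal_prob 0 s) c) f =
  smear (normal_prob 0 s) (c * Num.sqrt n.+1%:R) f.
Proof.
move=> s0 c0 fM; elim: n => [|n IHn]; first by rewrite sqrtr1 mulr1.
have cn0 : 0 < c * Num.sqrt n.+1%:R by rewrite mulr_gt0// sqrtr_gt0 ltr0n.
rewrite iterS IHn (smear_smear_normal s0 c0 cn0 fM); congr (smear _ _ f).
rewrite exprMn sqr_sqrtr//.
have -> : c ^+ 2 + c ^+ 2 * n.+1%:R = c ^+ 2 * n.+2%:R.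
  by rewrite -[in RHS]natr1; ring.
by rewrite sqrtrM ?sqr_ge0// sqrtr_sqr gtr0_norm.
Qed.

Lemma normal_stable (s M : R) (f : R -> R) n (x : R) : 0 < s -> bounded_measurable M f ->
  (0 < n)%N ->
  iter n (smear (normal_prob 0 s) (Num.sqrt n%:R)^-1) f x = smear (normal_prob 0 s) 1 f x.
Proof.
case: n => // n s0 fM _.
have n0 : 0 < Num.sqrt n.+1%:R :> R by rewrite sqrtr_gt0 ltr0n.
have c0 : 0 < (Num.sqrt n.+1%:R)^-1 :> R by rewrite invr_gt0.
by rewrite (iter_smear_normal n s0 c0 fM) mulVf// gt_eqF.
Qed.

(** It gives the mean of a centered normal law by symmetry. *)
Lemma normal_prob_opp (s : R) : 0 < s ->
  same_law (normal_prob 0 s) (normal_prob 0 s) (-%R : RT -> RT) id.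
Proof.
have mopp : measurable_fun setT (-%R : RT -> RT).
  exact: (@measurable_funN _ RT R setT id).
move=> s0; split; [exact: mopp|exact: measurable_id|].
move=> B mB; rewrite preimage_id.
rewrite /normal_prob [LHS]integral_mkcond [RHS]integral_mkcond.
have sl : same_law mu mu (-%R : RT -> RT) id.
  by split; [exact: mopp|exact: measurable_id|move=> A mA; exact: lebesgue_measureN].
have mpdf : measurable_fun setT ((fun w => (normal_pdf 0 s w)%:E) \_ B).
  apply/(measurable_restrictT _ mB)/measurable_funTS/measurable_EFinP.
  exact: measurable_normal_pdf.
have pdf0 w : (0 <= ((fun w => (normal_pdf 0 s w)%:E) \_ B) w)%E.
  by rewrite patchE; case: ifP => // _; rewrite lee_fin normal_pdf_ge0.
rewrite -(same_law_ge0_integral sl mpdf pdf0).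
apply: eq_integral => t _; rewrite !patchE.
have -> : (t \in -%R @^-1` B) = (- t \in B) by apply/idP/idP; rewrite !inE.
case: ifP => // _; congr _%:E.
by rewrite !normal_pdfE ?gt_eqF// /normal_fun !subr0 sqrrN.
Qed.

Lemma is_derive_normal_pdf (s x : R) : 0 < s ->
  is_derive (x : R) 1 (normal_pdf 0 s) (- (x / s ^+ 2) * normal_pdf 0 s x).
Proof.
move=> s0; rewrite !normal_pdfE ?gt_eqF//.
have -> : (fun x : R => normal_peak s * normal_fun 0 s x) =
    normal_peak s \*: (expR \o ((- (s ^+ 2 *+ 2)^-1) \*: (id ^+ 2))).
  apply/funext => t; rewrite /= /normal_fun /GRing.scale /= !fctE /= subr0.
  by congr (_ * expR _); rewrite mulNr mulrC mulNr.
have h1 := is_deriveZ (- (s ^+ 2 *+ 2)^-1)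
  (@is_deriveX R R (id : R -> R) 2 x 1 1 (is_derive_id x 1)).
have h2 := @is_derive1_comp R expR _ x _ _ (is_derive_expR _) h1.
have H := is_deriveZ (normal_peak s) h2.
set F' := (X in is_derive _ _ _ X) in H.
have -> : - (x / s ^+ 2) * (normal_peak s * normal_fun 0 s x) = F'.
  rewrite /F' /normal_fun !fctE /= subr0 /GRing.scale /=.
  have -> : - (s ^+ 2 *+ 2)^-1 * x ^+ 2 = - x ^+ 2 / (s ^+ 2 *+ 2) by rewrite mulNr mulrC mulNr.
  rewrite !mulr2n; move: (normal_peak s) (expR _) => c e; field.
  have s20 : 0 < s ^+ 2 by rewrite exprn_gt0.
  by rewrite !gt_eqF//; lra.
exact: H.
Qed.

(** Integration by parts: the derivative of [t * p t] is
    [p t - (t / s) ^ 2 * p t], and [t * p t] vanishes at infinity. *)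
Lemma second_moment_normal (s : R) : 0 < s ->
  (\int[normal_prob 0 s]_t (t ^+ 2)%:E = (s ^+ 2)%:E)%E.
Proof.
move=> s0; pose p := normal_pdf 0 s.
have mp : measurable_fun setT p by exact: measurable_normal_pdf.
have p0 t : 0 <= p t by exact: normal_pdf_ge0.
have cp : continuous p by apply: continuous_normal_pdf; rewrite gt_eqF.
rewrite ge0_integral_normal_prob; last 2 first.
- by apply/measurable_EFinP; exact: (@measurable_funX _ RT R setT id).
- by move=> t; rewrite lee_fin sqr_ge0.
pose I (n : nat) : set RT := `[- n.+1%:R, n.+1%:R]%classic.
have ndI : nondecreasing_seq I.
  move=> n m nm; apply/subsetPset; apply: subset_itv; rewrite bnd_simp ?lerN2 ler_nat ltnS//.
have UI : \bigcup_n I n = setT.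
  apply/seteqP; split => // t _; exists (Num.truncn `|t|) => //.
  by rewrite /I /= in_itv /= -ler_norml ltW// truncnS_gt.
have mI n : measurable (I n) by exact: measurable_itv.
(* the antiderivative of (t ^ 2 - s ^ 2) p is - s ^ 2 t p *)
pose q t := t ^+ 2 * p t.
have q0 t : 0 <= q t by rewrite mulr_ge0// sqr_ge0.
have mq : measurable_fun setT q.
  by apply: measurable_funM => //; exact: (@measurable_funX _ RT R setT id).
have cq : continuous q.
  by move=> x; apply: cvgM; [exact: exprn_continuous|exact: cp].
pose G t := - s ^+ 2 * (t * p t).
have dG t : is_derive t 1 G (q t - s ^+ 2 * p t).
  have H := is_deriveZ (- s ^+ 2) (is_deriveM (is_derive_id t (1 : R)) (is_derive_normal_pdf t s0)).
  set F' := (X in is_derive _ _ _ X) in H.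
  have -> : q t - s ^+ 2 * p t = F'.
    by rewrite /F' /q /p /GRing.scale /=; field; rewrite gt_eqF.
  exact: H.
have FTC n : (\int[mu]_(t in I n) (q t)%:E =
    (s ^+ 2)%:E * \int[mu]_(t in I n) (p t)%:E + (G n.+1%:R - G (- n.+1%:R))%:E)%E.
  have n0 : - n.+1%:R < n.+1%:R :> R by rewrite gtrN // ltr0n.
  have cqp : continuous (fun t => q t - s ^+ 2 * p t).
    by move=> x; apply: cvgB; [exact: cq|apply: cvgM; [exact: cvg_cst|exact: cp]].
  have cG := is_derive1_continuous dG.
  have /(_ _) := @continuous_FTC2 R (fun t => q t - s ^+ 2 * p t) G _ _ n0.
  move=> FTC2.
  have {}FTC2 : (\int[mu]_(t in I n) (q t - s ^+ 2 * p t)%:E =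
      (G n.+1%:R)%:E - (G (- n.+1%:R))%:E)%E.
    apply: FTC2.
    - exact: continuous_subspaceT.
    - split; first by move=> x _; have := dG x => -[].
        by apply: cvg_at_right_filter; exact: cG.
      by apply: cvg_at_left_filter; exact: cG.
    - by move=> x _; rewrite derive1E; have := dG x => -[_].
  have iq : mu.-integrable (I n) (EFin \o q).
    apply: continuous_compact_integrable; first exact: segment_compact.
    exact: continuous_subspaceT.
  have ip : mu.-integrable (I n) (EFin \o p).
    apply: continuous_compact_integrable; first exact: segment_compact.
    exact: continuous_subspaceT.
  have isp := integrableZl (mI n) (s ^+ 2) ip.
  have E : (\int[mu]_(t in I n) (q t - s ^+ 2 * p t)%:E =
      \int[mu]_(t in I n) (q t)%:E - (s ^+ 2)%:E * \int[mu]_(t in I n) (p t)%:E)%E.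
    transitivity (\int[mu]_(t in I n) ((q t)%:E - (s ^+ 2)%:E * (p t)%:E))%E => //.
    by rewrite integralB// integralZl.
  rewrite EFinB -FTC2 E.
  have pf : (\int[mu]_(t in I n) (p t)%:E)%E \is a fin_num by exact: integrable_fin_num.
  have qf : (\int[mu]_(t in I n) (q t)%:E)%E \is a fin_num by exact: integrable_fin_num.
  by rewrite -(fineK pf) -(fineK qf) -EFinM -EFinB -EFinD addrC subrK.
have G_to0 : (G n.+1%:R - G (- n.+1%:R)) @[n --> \oo] --> (0 : R).
  pose c := 2 * s ^+ 2 * (normal_peak s * (s ^+ 2 *+ 2)).
  have pk0 : 0 < normal_peak s by rewrite normal_peak_gt0// gt_eqF.
  apply: (@squeeze_cvgr _ _ _ _ (fun n => - (c * @harmonic R n)) (fun=> 0)).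
  - near=> n.
    have pN : p (- n.+1%:R) = p n.+1%:R.
      by rewrite /p !normal_pdfE ?gt_eqF// /normal_fun !subr0 sqrrN.
    have -> : G n.+1%:R - G (- n.+1%:R) = - (2 * s ^+ 2 * (n.+1%:R * p n.+1%:R)).
      by rewrite /G pN; ring.
    have s20 : 0 <= s ^+ 2 by exact: sqr_ge0.
    apply/andP; split => /=; last by rewrite oppr_le0 ?mulr_ge0// ltW.
    rewrite lerN2.
    have -> : c / n.+1%:R = 2 * s ^+ 2 * (normal_peak s * (s ^+ 2 *+ 2 / n.+1%:R)).
      by rewrite /c !mulrA.
    apply: ler_wpM2l; first by rewrite mulr_ge0.
    have n0 : 0 < n.+1%:R :> R by rewrite ltr0n.
    rewrite -ler_pdivlMl// /p normal_pdfE ?gt_eqF// [leRHS]mulrCA ler_pM2l//.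
    (* e ^ (- y) is at most 1 / y *)
    rewrite /normal_fun subr0 mulNr expRN.
    have y0 : 0 < n.+1%:R ^+ 2 / (s ^+ 2 *+ 2) :> R.
      by rewrite divr_gt0 ?exprn_gt0// mulrn_wgt0// exprn_gt0.
    have -> : n.+1%:R^-1 * (s ^+ 2 *+ 2 / n.+1%:R) =
        (n.+1%:R ^+ 2 / (s ^+ 2 *+ 2))^-1 :> R.
      by rewrite invf_div expr2 invfM; ring.
    rewrite lef_pV2 ?posrE ?expR_gt0// (le_trans _ (expR_ge1Dx _))// lerDr//.
  - rewrite -[X in _ --> X]oppr0 -[X in _ --> - X](mulr0 c).
    by apply: cvgN; apply: cvgM; [exact: cvg_cst|exact: cvg_harmonic].
  - exact: cvg_cst.
have L1 : ((\int[mu]_(t in I n) (q t)%:E)%E @[n --> \oo] --> (\int[mu]_t (q t)%:E)%E).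
  rewrite -UI; apply: ge0_nondecreasing_set_cvg_integral => //.
  - by move=> n; apply/measurable_funTS/measurable_EFinP.
  - by move=> n t _; rewrite lee_fin.
have L2 : ((\int[mu]_(t in I n) (p t)%:E)%E @[n --> \oo] --> (1 : \bar R)%E).
  rewrite -(integral_normal_pdf 0 s) -UI; apply: ge0_nondecreasing_set_cvg_integral => //.
  - by move=> n; apply/measurable_funTS/measurable_EFinP.
  - by move=> n t _; rewrite lee_fin.
have -> : (\int[mu]_t ((t ^+ 2)%:E * (normal_pdf 0 s t)%:E) = \int[mu]_t (q t)%:E)%E by [].
have FTCf : (fun n => \int[mu]_(t in I n) (q t)%:E)%E = (fun n => (s ^+ 2)%:E *
    \int[mu]_(t in I n) (p t)%:E + (G n.+1%:R - G (- n.+1%:R))%:E)%E.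
  by apply/funext => n; exact: FTC.
rewrite FTCf in L1.
have L3 : (((s ^+ 2)%:E * \int[mu]_(t in I n) (p t)%:E +
    (G n.+1%:R - G (- n.+1%:R))%:E)%E @[n --> \oo] -->
    ((s ^+ 2)%:E * 1 + 0%:E)%E).
  apply: cvgeD => //; first exact: cvgeZl.
  by apply: cvg_EFin => //; exact: nearW.
have := cvg_unique _ L1 L3; rewrite mule1 adde0; apply.
exact: ereal_hausdorff.
Unshelve. all: by end_near. Qed.

Lemma centered_normal (s : R) : 0 < s -> centered (normal_prob 0 s) (s ^+ 2).
Proof.
move=> s0; have mid2 : measurable_fun [set: RT] (fun t : RT => t ^+ 2 : R).
  exact: (@measurable_funX _ RT R setT id).
have sq : square_integrable (normal_prob 0 s) (id : RT -> R).
  split; first exact: measurable_id.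
  apply/integrableP; split; first exact/measurable_EFinP.
  under eq_integral => t _ do rewrite /= ger0_norm ?sqr_ge0//.
  by rewrite second_moment_normal// ltry.
split => //; last by rewrite /Rintegral second_moment_normal.
have i1 := square_integrable_rintegrable sq.
have H := same_law_Rintegral (normal_prob_opp s0) (f := id : RT -> R) (@measurable_id _ RT setT).
have : \int[normal_prob 0 s]_t (- t) = - \int[normal_prob 0 s]_t t.
  have := RintegralZl (-1) measurableT i1; rewrite mulN1r => <-.
  by apply: eq_Rintegral => t _; rewrite mulN1r.
rewrite [LHS]H /= => /eqP; rewrite -subr_eq0 opprK -mulr2n mulrn_eq0 /=.
by move/eqP.
Qed.

End gaussian.

(** * Sums of independent identically distributed variables *)

Section coordinate_laws.
Context (R : realType) (I : finType) (d : I -> measure_display).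
Context (T : forall i, measurableType (d i)).
Variable nu : forall i, probability (T i) R.

Lemma same_law_coord i :
  same_law (prod_prob nu) (nu i) (fun x : prod_space T => x i) id.
Proof.
split; [exact: measurable_coord|exact: measurable_id|].
move=> B mB; rewrite preimage_id.
pose A : forall j, set (T j) := dfwith (fun j => [set: T j]) i B.
have mA j : measurable (A j) by rewrite /A; case: dfwithP.
have -> : (fun x : prod_space T => x i) @^-1` B = rectangle A.
  apply/seteqP; split => x /=.
    by move=> Bx j; rewrite /A; case: dfwithP.
  by move=> /(_ i); rewrite /A dfwithin.
rewrite [LHS]prod_probE// (bigD1 i)//= /A dfwithin big1 ?mule1// => j ji.
by rewrite dfwithout ?probability_setT// eq_sym.
Qed.

Lemma same_law_coord2 i j : i != j ->
  same_law (nu i \x nu j)%E (prod_prob nu) id (fun x : prod_space T => (x i, x j)).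
Proof.
move=> ij.
have m2 : measurable_fun setT (fun x : prod_space T => (x i, x j)).
  by apply/measurable_fun_pairP; split; exact: measurable_coord.
split; [exact: measurable_id|exact: m2|].
move=> C mC; rewrite preimage_id.
pose b2 := isMeasurableFun.Build _ _ _ _ (fun x : prod_space T => (x i, x j)) m2.
pose p2 : {mfun prod_space T >-> (T i * T j)%type} := HB.pack (fun x : prod_space T => (x i, x j)) b2.
apply: (@product_measure_unique _ _ _ _ _ (nu i) (nu j) (distribution (prod_prob nu) p2)) => //.
move=> B B' mB mB'.
pose A : forall k, set (T k) := dfwith (dfwith (fun k => [set: T k]) i B) j B'.
have mA k : measurable (A k).
  by rewrite /A; case: dfwithP => // k' _; case: dfwithP.
transitivity (prod_prob nu ((fun x : prod_space T => (x i, x j)) @^-1` (B `*` B'))).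
  by [].
have -> : (fun x : prod_space T => (x i, x j)) @^-1` (B `*` B') = rectangle A.
  apply/seteqP; split => x /=.
    by move=> [Bx Bx'] k; rewrite /A; case: dfwithP => // k' _; case: dfwithP.
  move=> Ax; split; last by have := Ax j; rewrite /A dfwithin.
  by have := Ax i; rewrite /A dfwithout 1?eq_sym// dfwithin.
rewrite [LHS]prod_probE// (bigD1 i)//= (bigD1 j)/=; last by rewrite eq_sym.
rewrite /A dfwithout 1?eq_sym// !dfwithin big1 ?mule1// => k /andP[ki kj].
by rewrite !dfwithout ?probability_setT// eq_sym.
Qed.

End coordinate_laws.

Section iid_sums.
Context (R : realType) (dO : measure_display) (Omega : measurableType dO).
Context (P : probability Omega R) d (T : measurableType d).
Context (X : nat -> {RV P >-> T}) (nu : probability T R).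
Hypothesis hX : iid_with_law X nu.
Local Notation RT := (measurableTypeR R).
Variable G : {mfun T >-> RT}.

Lemma same_law_distribution : same_law nu (distribution nu G) G id.
Proof. by split. Qed.

Lemma same_law_iid N :
  same_law P (prod_prob (fun _ : 'I_N => distribution nu G))
    (fun omega => (fun i : 'I_N => G (X i omega)) : prod_space (fun _ : 'I_N => RT)) id.
Proof.
apply: same_law_rectangle; [|exact: measurable_id|].
  apply: measurable_to_prod => i.
  by apply: (@measurableT_comp _ _ _ _ _ _ G _ (X i)).
move=> A mA; rewrite preimage_id [RHS]prod_probE//; case: hX => law indep.
pose B (n : nat) : set T := if insub n is Some i then G @^-1` A i else setT.
have mG (C : set RT) : measurable C -> measurable (G @^-1` C).
  by move=> mC; rewrite -[X in measurable X]setTI; exact: measurable_funP.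
have mB n : measurable (B n).
  by rewrite /B; case: insubP => // i _ _; exact: mG.
have BE (i : 'I_N) : B i = G @^-1` A i by rewrite /B valK.
transitivity (P (\bigcap_(n in [set` iota 0 N]) (X n @^-1` B n))).
  congr (P _); apply/seteqP; split => w /=.
    move=> H n /=; rewrite mem_iota add0n => /andP[_ nN].
    by have := H (Ordinal nN); rewrite /= -[X in X -> _]/((G @^-1` A (Ordinal nN)) (X n w)) -BE.
  move=> H i; have := H i; rewrite /= mem_iota add0n BE; apply.
  exact: ltn_ord.
rewrite indep ?iota_uniq// -{1}[N]subn0 -/(index_iota 0 N) big_mkord.
by apply: eq_bigr => i _; rewrite BE; exact: (law i _ (mG _ (mA i))).
Qed.

Lemma Rintegral_iid_sum N c M (f : R -> R) : bounded_measurable M f ->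
  \int[P]_omega f (c * \sum_(i < N) (G (X i omega) : R)) =
  iter N (smear (distribution nu G) c) f 0.
Proof.
move=> fM; have [mf _] := fM.
have := @Rintegral_prod_prob_sum R 'I_N (distribution nu G) (enum 'I_N) c M f 0
  (enum_uniq _) fM.
rewrite size_enum_ord => <-.
pose F (y : prod_space (fun _ : 'I_N => RT)) : R := f (0 + c * \sum_(i <- enum 'I_N) (y i : R)).
have mF : measurable_fun setT F.
  apply: (measurableT_comp mf); apply: measurable_funD => //.
  by apply: measurable_funM => //; exact: measurable_sum_coord.
rewrite -(same_law_Rintegral (same_law_iid N) mF).
by apply: eq_Rintegral => w _; rewrite /F add0r big_enum.
Qed.

Lemma centered_distribution (s2 : R) : square_integrable nu G ->
  \int[nu]_x (G x : R) = 0 -> \int[nu]_x (G x : R) ^+ 2 = s2 ->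
  centered (distribution nu G) s2.
Proof.
move=> G2 G0 Gs.
have mid2 : measurable_fun [set: RT] (fun t : RT => t ^+ 2 : R).
  exact: (@measurable_funX _ RT R setT id).
split.
- exact: (same_law_square_integrable same_law_distribution (@measurable_id _ RT setT) G2).
- by rewrite -G0; rewrite -(same_law_Rintegral same_law_distribution (f := id : RT -> R)).
- by rewrite -Gs -(same_law_Rintegral same_law_distribution mid2).
Qed.

End iid_sums.

Section normal_laws.
Context (R : realType).
Local Notation RT := (measurableTypeR R).

Lemma centered_normal_law (v : R) : 0 <= v -> centered (normal_law 0 v) v.
Proof.
move=> v0; rewrite /normal_law; have [->|vn0] := eqVneq v 0.
  have dint (f : RT -> R) : measurable_fun setT f ->
      (\int[\d_(0%R : RT)]_t (f t)%:E = (f 0%R)%:E)%E.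
    by move=> /measurable_EFinP mf; rewrite integral_dirac// diracT mul1e.
  have mid2 : measurable_fun [set: RT] (fun t : RT => t ^+ 2 : R).
    exact: (@measurable_funX _ RT R setT id).
  split.
  - split; first exact: measurable_id.
    apply/integrableP; split; first exact/measurable_EFinP.
    under eq_integral => t _ do rewrite /= ger0_norm ?sqr_ge0//.
    by rewrite [X in (X < _)%E](dint _ mid2) ltry.
  - by rewrite /Rintegral [X in fine X](dint id)//; exact: measurable_id.
  - by rewrite /Rintegral [X in fine X](dint _ mid2) expr0n.
have vp : 0 < v by rewrite lt_neqAle eq_sym vn0.
have := @centered_normal R (Num.sqrt v); rewrite sqr_sqrtr// sqrtr_gt0.
by apply.
Qed.

(** For [v = 0] the law is a Dirac mass at 0 and averaging does nothing, so that
    degenerate limits need no separate treatment. *)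
Lemma normal_law_stable (v M : R) (f : R -> R) n (x : R) : 0 <= v ->
  bounded_measurable M f -> (0 < n)%N ->
  iter n (smear (normal_law 0 v) (Num.sqrt n%:R)^-1) f x = smear (normal_law 0 v) 1 f x.
Proof.
move=> v0 fM n0; rewrite /normal_law; have [_|vn0] := eqVneq v 0; last first.
  have vp : 0 < v by rewrite lt_neqAle eq_sym vn0.
  by apply: normal_stable fM n0; rewrite sqrtr_gt0.
have E c g : measurable_fun [set: R] g -> smear (\d_(0 : RT)) c g = g.
  move=> mg; apply/funext => y; rewrite /smear /Rintegral integral_dirac//.
    by rewrite diracT mul1e mulr0 addr0.
  apply/measurable_EFinP.
  have mc : measurable_fun [set: RT] (fun t : RT => c * t : RT).
    exact: (@measurable_funM _ RT R setT (cst c) id).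
  exact: (measurableT_comp (measurable_translate y mg) mc).
have [mf _] := fM.
have iterE k c : iter k (smear (\d_(0 : RT)) c) f = f.
  by elim: k => //= k ->; exact: E.
by rewrite E// iterE.
Qed.

End normal_laws.

(** * Convergence in distribution by test functions *)

Section weak_convergence.
Context (R : realType) (dO : measure_display) (Omega : measurableType dO).
Variable P : probability Omega R.
Local Notation RT := (measurableTypeR R).

Lemma test_function_bounded M g g1 g2 :
  test_function M g g1 g2 -> bounded_measurable (R := R) M g.
Proof.
move=> [dg _ gM _ _]; split => //; apply: continuous_measurable_fun.
exact: is_derive1_continuous dg.
Qed.

(** Bounded second moments make an error of [e * (1 + x ^+ 2)] on the function
    uniformly small after integration: they play the role of tightness. *)
Lemma cvg_in_distribution_test_functions (Y : nat -> Omega -> R)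
    (nu : probability RT R) (C : R) :
  (forall n, square_integrable P (Y n)) ->
  (forall n, (0 < n)%N -> \int[P]_omega Y n omega ^+ 2 <= C) ->
  square_integrable nu (id : RT -> R) ->
  (forall M g g1 g2, test_function M g g1 g2 -> (forall x, `|g1 x| <= M) ->
     \int[P]_omega g (Y n omega) @[n --> \oo] --> \int[nu]_t g t) ->
  cvg_in_distribution P Y nu.
Proof.
move=> Y2 YC nu2 tcvg f cf [M fM].
have mf : measurable_fun [set: R] f by exact: continuous_measurable_fun.
have mY n : measurable_fun setT (Y n) by case: (Y2 n).
have ifY n : rintegrable P (fun omega => f (Y n omega)).
  apply: (@rintegrable_bounded _ _ _ _ _ M) => //.
  exact: (measurableT_comp mf (mY n)).
have ifnu : rintegrable nu (f : RT -> R).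
  exact: (@rintegrable_bounded _ _ _ _ _ M).
pose s2 := \int[nu]_t (t : R) ^+ 2.
have s20 : 0 <= s2 by apply: Rintegral_ge0 => t _; exact: sqr_ge0.
have C0 : 0 <= C.
  by apply: le_trans (YC 1%N isT); apply: Rintegral_ge0 => w _; exact: sqr_ge0.
have main : \int[P]_omega f (Y n omega) @[n --> \oo] --> \int[nu]_t f t.
  apply/cvgrPdist_le => E E0.
  (* the integrals of 1 + x ^+ 2 for the two laws add up to at most K *)
  pose K := 1 + C + (1 + s2); have K0 : 0 < K by rewrite /K; lra.
  have e0 : 0 < E / 2 / K by rewrite !divr_gt0.
  set e := E / 2 / K in e0.
  have [g [g1 [g2 [M' [tg g1M fg]]]]] := test_function_approx cf fM e0.
  have [mg gM] := test_function_bounded tg.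
  have igY n : rintegrable P (fun omega => g (Y n omega)).
    apply: (@rintegrable_bounded _ _ _ _ _ M') => //.
    exact: (measurableT_comp mg (mY n)).
  have ignu : rintegrable nu (g : RT -> R).
    exact: (@rintegrable_bounded _ _ _ _ _ M').
  (* the error of replacing f by g is controlled by the second moment *)
  have dist d' (U : measurableType d') (m : probability U R) (Z : U -> R) :
      square_integrable m Z -> rintegrable m (f \o Z) -> rintegrable m (g \o Z) ->
      `|\int[m]_u f (Z u) - \int[m]_u g (Z u)| <= e * (1 + \int[m]_u Z u ^+ 2).
    move=> [mZ Z2] i1 i2; rewrite -RintegralB//.
    have ib := rintegrableB i1 i2.
    apply: (le_trans (le_normr_Rintegral measurableT ib)).
    have i3 := rintegrableD (rintegrable_cst m 1) Z2.
    have -> : e * (1 + \int[m]_u Z u ^+ 2) = \int[m]_u (e * (1 + Z u ^+ 2)).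
      by rewrite RintegralZl// RintegralD// ?Rintegral_prob_cst//; exact: rintegrable_cst.
    apply: le_Rintegral => //; first exact: rintegrable_norm.
      exact: rintegrableZl.
    by move=> u _; exact: fg.
  have E20 : 0 < E / 2 by rewrite divr_gt0.
  have := tcvg _ _ _ _ tg g1M => /cvgrPdist_le /(_ _ E20) gcvg.
  near=> n.
  have n0 : (0 < n)%N by near: n; exists 1%N.
  have h1 := dist _ _ P (Y n) (Y2 n) (ifY n) (igY n).
  have h2 := dist _ _ nu (id : RT -> R) nu2 ifnu ignu.
  have h3 : `|\int[nu]_t g t - \int[P]_omega g (Y n omega)| <= E / 2.
    by near: n; exact: gcvg.
  have -> : \int[nu]_t f t - \int[P]_omega f (Y n omega) =
    (\int[nu]_t f t - \int[nu]_t g t) +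
    (\int[nu]_t g t - \int[P]_omega g (Y n omega)) +
    - (\int[P]_omega f (Y n omega) - \int[P]_omega g (Y n omega)) by ring.
  rewrite (le_trans (ler_normD _ _))// normrN.
  have h4 := ler_normD (\int[nu]_t f t - \int[nu]_t g t)
    (\int[nu]_t g t - \int[P]_omega g (Y n omega)).
  have h5 : e * (1 + \int[P]_omega Y n omega ^+ 2) <= e * (1 + C).
    by rewrite ler_pM2l// lerD2l YC.
  have h6 : e * (1 + C) + e * (1 + s2) = E / 2.
    by rewrite -mulrDr -/K /e divfK// gt_eqF.
  rewrite /s2 /= in h6 h2; move: h1 h2 h3 h4 h5 h6.
  lra.
have -> : (\int[nu]_x (f x)%:E = (\int[nu]_x f x)%:E)%E by rewrite EFin_Rintegral.
have -> : (fun n => 'E_P[f \o Y n])%E = (fun n => (\int[P]_omega f (Y n omega))%:E).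
  by apply/funext => n; rewrite unlock -EFin_Rintegral.
by apply: cvg_EFin => //; exact: nearW.
Unshelve. all: by end_near. Qed.

(** The function [g] is Lipschitz, and the mean is at most the root mean
    square. *)
Lemma test_function_slutsky M g g1 g2 (Y L : Omega -> R) :
  test_function M g g1 g2 -> (forall x, `|g1 x| <= M) ->
  square_integrable P Y -> square_integrable P L ->
  `|\int[P]_omega g (Y omega) - \int[P]_omega g (L omega)| <=
  M * Num.sqrt (\int[P]_omega (Y omega - L omega) ^+ 2).
Proof.
move=> tg g1M Y2 L2; have [mg gM] := test_function_bounded tg.
have M0 : 0 <= M by exact: le_trans (gM 0).
have YL2 := square_integrableB Y2 L2.
have [mY _] := Y2; have [mL _] := L2; have [mYL _] := YL2.
have i1 : rintegrable P (fun omega => g (Y omega)).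
  by apply: (@rintegrable_bounded _ _ _ _ _ M) => //; exact: (measurableT_comp mg mY).
have i2 : rintegrable P (fun omega => g (L omega)).
  by apply: (@rintegrable_bounded _ _ _ _ _ M) => //; exact: (measurableT_comp mg mL).
rewrite -RintegralB//.
have ib := rintegrableB i1 i2.
apply: (le_trans (le_normr_Rintegral measurableT ib)).
have nYL : square_integrable P (fun omega => `|Y omega - L omega|).
  apply: square_integrable_le YL2; first exact: measurableT_comp.
  by move=> w; rewrite normr_id.
have in1 := square_integrable_rintegrable nYL.
apply: (@le_trans _ _ (\int[P]_omega (M * `|Y omega - L omega|))).
  apply: le_Rintegral => //; first exact: rintegrable_norm.
    exact: rintegrableZl.
  move=> w _; case: tg => dg _ _ _ _.
  have [c _] := mean_value dg (L w) (Y w - L w).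
  by rewrite [L w + _]addrC subrK => ->; rewrite normrM ler_wpM2r.
rewrite RintegralZl// ler_wpM2l//.
have s0 : 0 <= \int[P]_omega `|Y omega - L omega| by exact: Rintegral_ge0.
rewrite -[leLHS]ger0_norm// -sqrtr_sqr ler_sqrt; last first.
  by apply: Rintegral_ge0 => w _; exact: sqr_ge0.
apply: (le_trans (sqr_Rintegral_le nYL)).
rewrite le_eqVlt; apply/orP; left; apply/eqP; apply: eq_Rintegral => w _.
by rewrite real_normK ?num_real.
Qed.

End weak_convergence.

(** * Projection onto sums of functions of one coordinate *)

Section projection.
Context (R : realType) (K : nat) (d : 'I_K -> measure_display).
Context (S : forall k, measurableType (d k)).
Variable mu : forall k, probability (S k) R.
Variable phi : prod_space S -> R.
Hypothesis phi2 : square_integrable (prod_prob mu) phi.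
Hypothesis pphi : partially_integrable mu phi.
Local Notation RT := (measurableTypeR R).

Let mphi : measurable_fun setT phi. Proof. by case: phi2. Qed.
Let iphi : rintegrable (prod_prob mu) phi.
Proof. exact: square_integrable_rintegrable. Qed.

Let a := \int[prod_prob mu]_x phi x.

(** The projection is the first order part of the Hoeffding decomposition of
    [phi], and [main_effect k] its component on the coordinate [k]. *)
Definition main_effect k (t : S k) : R := marginal mu phi (block1 t) - a.

Let kin (k : 'I_K) : k \in [set k]%SET. Proof. by rewrite inE. Qed.

Let sub_set1 (k : 'I_K) (j : {j | j \in [set k]%SET}) : j = exist _ k (kin k).
Proof. by apply: val_inj; case: j => j /=; rewrite inE => /eqP. Qed.

Lemma block1_coord (k : 'I_K) (x : block S [set k]%SET) : block1 (x (exist _ k (kin k))) = x.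
Proof.
apply: functional_extensionality_dep => j; rewrite (sub_set1 j) /block1 /restr /=.
by rewrite dfwithin.
Qed.

Lemma measurable_block1 (k : 'I_K) : measurable_fun setT (@block1 _ _ S k).
Proof.
apply: measurable_to_prod => j; rewrite (sub_set1 j) /block1 /restr /=.
have -> : (fun t : S k => dfwith (point : prod_space S) k t k) = id.
  by apply/funext => t; rewrite dfwithin.
exact: measurable_id.
Qed.

Let law1 (k : 'I_K) : same_law (block_prob mu [set k]%SET) (mu k)
  (fun x : block S [set k]%SET => x (exist _ k (kin k))) id.
Proof. exact: (same_law_coord (fun j : {j | j \in [set k]%SET} => mu (val j))). Qed.

Let measurable_marginal_block1 k :
  measurable_fun setT (fun t : S k => marginal mu phi (block1 t)).
Proof.
have im := rintegrable_marginal mphi pphi iphi [set k]%SET.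
exact: (measurableT_comp (rintegrable_measurable im) (@measurable_block1 k)).
Qed.

Lemma square_integrable_main_effect k : square_integrable (mu k) (@main_effect k).
Proof.
apply: square_integrableB; last exact: square_integrable_cst.
apply: (same_law_square_integrable (law1 k) (@measurable_marginal_block1 k)).
have := square_integrable_marginal mphi pphi iphi phi2 [set k]%SET.
by congr square_integrable; apply/funext => x; rewrite /= block1_coord.
Qed.

Lemma Rintegral_main_effect k : \int[mu k]_t main_effect t = 0.
Proof.
rewrite -(same_law_Rintegral (law1 k) (f := @main_effect k)); last first.
  by case: (square_integrable_main_effect k).
under eq_Rintegral do rewrite /main_effect block1_coord.
have im := rintegrable_marginal mphi pphi iphi [set k]%SET.
rewrite RintegralB//; last exact: rintegrable_cst.
by rewrite Rintegral_prob_cst Rintegral_marginal// subrr.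
Qed.

Definition projection (x : prod_space S) : R := \sum_(k < K) main_effect (x k).

Let square_integrable_coord k :
  square_integrable (prod_prob mu) (fun x : prod_space S => main_effect (x k)).
Proof.
have h2 := square_integrable_main_effect k; have [mh _] := h2.
exact: (same_law_square_integrable (same_law_sym (same_law_coord mu k)) mh h2).
Qed.

Lemma square_integrable_projection : square_integrable (prod_prob mu) projection.
Proof. by apply: square_integrable_sum => k; exact: square_integrable_coord. Qed.

Let Rintegral_coord k : \int[prod_prob mu]_x main_effect (x k) = 0.
Proof.
rewrite -(Rintegral_main_effect k); apply: (same_law_Rintegral (same_law_coord mu k)).
by case: (square_integrable_main_effect k).
Qed.

Lemma Rintegral_projection : \int[prod_prob mu]_x projection x = 0.
Proof.
rewrite Rintegral_sum; last first.
  by move=> k; apply: square_integrable_rintegrable; exact: square_integrable_coord.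
by rewrite big1// => k _; exact: Rintegral_coord.
Qed.

Let Rintegral_coord2 j k : j != k ->
  \int[prod_prob mu]_x (main_effect (x j) * main_effect (x k)) = 0.
Proof.
move=> jk; have [mj _] := square_integrable_main_effect j.
have [mk _] := square_integrable_main_effect k.
have ij := square_integrable_rintegrable (square_integrable_main_effect j).
have ik := square_integrable_rintegrable (square_integrable_main_effect k).
pose F (u : (S j * S k)%type) : R := main_effect u.1 * main_effect u.2.
have mF : measurable_fun setT F.
  apply: measurable_funM; first exact: (measurableT_comp mj measurable_fst).
  exact: (measurableT_comp mk measurable_snd).
rewrite -(same_law_Rintegral (same_law_coord2 mu jk) mF).
have Fi := rintegrable_tensor ij ik.
have [u|_ ->] := Rintegral_fubini Fi; first exact: (rintegrableZl (main_effect u) ik).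
rewrite -(Rintegral_eq0 (mu j) (f := fun=> 0))//; apply: eq_Rintegral => u _.
by rewrite /= RintegralZl// Rintegral_main_effect mulr0.
Qed.

(** The components are orthogonal: they are centered functions of independent
    coordinates. *)
Lemma Rintegral_projection_sqr :
  \int[prod_prob mu]_x projection x ^+ 2 = sigma2_prod mu phi.
Proof.
have i2 j k : rintegrable (prod_prob mu)
    (fun x : prod_space S => main_effect (x j) * main_effect (x k)).
  by apply: square_integrableM; exact: square_integrable_coord.
transitivity (\int[prod_prob mu]_x
    \sum_(j < K) \sum_(k < K) main_effect (x j) * main_effect (x k)).
  apply: eq_Rintegral => x _; rewrite expr2 mulr_suml.
  by apply: eq_bigr => j _; rewrite mulr_sumr.
rewrite Rintegral_sum; last by move=> j; exact: rintegrable_sum.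
apply: eq_bigr => j _; rewrite Rintegral_sum// (bigD1 j)//= big1 ?addr0; last first.
  by move=> k kj; rewrite Rintegral_coord2// eq_sym.
have [mj _] := square_integrable_main_effect j.
rewrite /sigma2_coord.
have := same_law_Rintegral (same_law_coord mu j) (f := fun t => main_effect t ^+ 2).
by apply; exact: measurable_funX.
Qed.

Definition residual (x : prod_space S) : R := phi x - a - projection x.

Lemma square_integrable_residual : square_integrable (prod_prob mu) residual.
Proof.
apply: square_integrableB; last exact: square_integrable_projection.
by apply: square_integrableB => //; exact: square_integrable_cst.
Qed.

Let main_effect_section (A B : {set 'I_K}) (x : block S B) k :
  rintegrable (block_prob mu A) (fun y => main_effect (merge y x k)).
Proof.
have [kA|kA] := boolP (k \in A).
  have [mk _] := square_integrable_main_effect k.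
  have ik := square_integrable_rintegrable (square_integrable_main_effect k).
  have law := same_law_coord (fun j : {j | j \in A} => mu (val j)) (exist _ k kA).
  have := same_law_integrable (same_law_sym law) (f := fun t => (main_effect t)%:E) _ ik.
  move=> H; have {}H := H (proj2 (measurable_EFinP _ _) mk).
  by apply: eq_rintegrable H => y; rewrite /= mergeL.
have [kB|kB] := boolP (k \in B).
  have := rintegrable_cst (block_prob mu A) (main_effect (x (exist _ k kB))).
  by apply: eq_rintegrable => y; rewrite (mergeR _ _ kB).
have := rintegrable_cst (block_prob mu A) (main_effect (point : S k)).
by apply: eq_rintegrable => y; rewrite mergeN.
Qed.

Lemma partially_integrable_residual : partially_integrable mu residual.
Proof.
move=> A x; apply: rintegrableB.
  by apply: rintegrableB; [exact: pphi|exact: rintegrable_cst].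
by apply: rintegrable_sum => k _; exact: main_effect_section.
Qed.

Lemma Rintegral_residual : \int[prod_prob mu]_x residual x = 0.
Proof.
have ip := square_integrable_rintegrable square_integrable_projection.
have ia := rintegrable_cst (prod_prob mu) a.
rewrite RintegralB//; last exact: rintegrableB.
by rewrite RintegralB// Rintegral_prob_cst -/a Rintegral_projection !subrr.
Qed.

(** When all the coordinates but [k] are integrated out, the other components
    of the projection vanish and the remaining one is the marginal of
    [phi - a]. *)
Lemma marginal_residual (k : 'I_K) (x : block S [set k]%SET) : marginal mu residual x = 0.
Proof.
rewrite /marginal /residual.
have i1 : rintegrable (block_prob mu (~: [set k])) (fun y => phi (merge y x)).
  exact: rintegrable_section.
have i2 j : rintegrable (block_prob mu (~: [set k]))
    (fun y => main_effect (merge y x j)) by exact: main_effect_section.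
have ia := rintegrable_cst (block_prob mu (~: [set k])) a.
have i3 : rintegrable (block_prob mu (~: [set k])) (fun y => projection (merge y x)).
  by apply: rintegrable_sum => j _.
rewrite RintegralB//; last exact: rintegrableB.
rewrite RintegralB// Rintegral_prob_cst Rintegral_sum//.
rewrite (bigD1 k)//= big1 ?addr0 => [|j jk]; last first.
  have jN : j \in (~: [set k])%SET by rewrite !inE.
  rewrite -(Rintegral_main_effect j).
  have law := same_law_coord (fun i : {i | i \in (~: [set k])%SET} => mu (val i)) (exist _ j jN).
  rewrite -(same_law_Rintegral law (f := @main_effect j)); last first.
    by case: (square_integrable_main_effect j).
  by apply: eq_Rintegral => y _; rewrite (mergeL _ _ jN).
have -> : \int[block_prob mu (~: [set k])]_y main_effect (merge y x k) =
    main_effect (x (exist _ k (kin k))).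
  rewrite -[RHS](Rintegral_prob_cst (block_prob mu (~: [set k]))).
  apply: eq_Rintegral => y _; rewrite (mergeR _ _ (kin k))//.
  by rewrite !inE eqxx.
by rewrite /main_effect block1_coord -/(marginal mu phi x) subrr.
Qed.

Lemma block_variance_residual (A : {set 'I_K}) : (0 < #|A| <= 1)%N ->
  \sum_(B : {set 'I_K} | B \subset A)
    (-1) ^+ (#|A| - #|B|) * block_variance mu residual B = 0.
Proof.
move=> /andP[A0 A1]; have /cards1P[k ->] : #|A| == 1%N by rewrite eqn_leq A1 A0.
have mres : measurable_fun setT residual by case: square_integrable_residual.
have ires := square_integrable_rintegrable square_integrable_residual.
apply: big1 => B; rewrite finset.subset1 => /orP[/eqP ->|/eqP ->].
  rewrite /block_variance Rintegral_residual expr0n subr0 Rintegral_eq0 ?mulr0// => x.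
  by rewrite marginal_residual expr0n.
rewrite block_variance_set0 ?mulr0//; exact: partially_integrable_residual.
Qed.

End projection.

(** * Asymptotic normality *)

(** The [K - 1] other coordinates of [n] are free. *)
Lemma sum_ffun_coord (R : numFieldType) (K N : nat) (k : 'I_K) (F : 'I_N -> R) :
  \sum_(n : {ffun 'I_K -> 'I_N}) F (n k) = N%:R ^+ K.-1 * \sum_(i < N) F i.
Proof.
transitivity (\sum_(n : {ffun 'I_K -> 'I_N}) \prod_j (if j == k then F (n j) else 1)).
  apply: eq_bigr => n _; rewrite (bigD1 k)//= eqxx big1 ?mulr1// => j /negbTE ->.
  by [].
rewrite -(bigA_distr_bigA (fun j i => if j == k then F i else 1)) /=.
rewrite (bigD1 k)//= eqxx mulrC; congr (_ * _).
rewrite (eq_bigr (fun=> N%:R)) => [|j /negbTE ->].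
  by rewrite prodr_const cardC1 card_ord.
by rewrite sumr_const card_ord.
Qed.

Section central_limit.
Context (R : realType) (K : nat) (d : 'I_K -> measure_display).
Context (S : forall k, measurableType (d k)).
Variable mu : forall k, probability (S k) R.
Context (dO : measure_display) (Omega : measurableType dO).
Context (P : probability Omega R) (X : nat -> {RV P >-> prod_space S}).
Hypothesis hX : iid_with_law X (prod_prob mu).
Variable phi : prod_space S -> R.
Hypothesis phi2 : square_integrable (prod_prob mu) phi.
Hypothesis pphi : partially_integrable mu phi.
Local Notation RT := (measurableTypeR R).
Local Notation a := (\int[prod_prob mu]_x phi x).

Lemma estimator_projection N omega : (0 < N)%N ->
  prod_estimator X N (projection mu phi) omega =
  N%:R^-1 * \sum_(i < N) projection mu phi (X i omega).
Proof.
move=> N0; have Nn0 : N%:R != 0 :> R by rewrite pnatr_eq0 -lt0n.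
rewrite /prod_estimator /projection exchange_big [in RHS]exchange_big /=.
rewrite !mulr_sumr; apply: eq_bigr => k _.
rewrite (sum_ffun_coord k (fun i : 'I_N => main_effect mu phi (X i omega k))).
rewrite mulrA; congr (_ * _).
have K0 : (0 < K)%N by exact: leq_ltn_trans (ltn_ord k).
by rewrite -[in X in X * _](prednK K0) exprS invfM -mulrA mulVf ?mulr1// expf_neq0.
Qed.

Lemma estimator_residual N omega : (0 < N)%N ->
  prod_estimator X N phi omega - a =
  N%:R^-1 * \sum_(i < N) projection mu phi (X i omega) +
  prod_estimator X N (residual mu phi) omega.
Proof.
move=> N0; have Nn0 : N%:R != 0 :> R by rewrite pnatr_eq0 -lt0n.
rewrite -estimator_projection// /prod_estimator -mulrDr -big_split /=.
have {1}-> : a = N%:R ^- K * \sum_(n : {ffun 'I_K -> 'I_N}) a.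
  rewrite sumr_const card_ffun !card_ord -[_ *+ (N ^ K)%N]mulr_natl natrX.
  by rewrite mulrA mulVf ?mul1r// expf_neq0.
rewrite -mulrBr -sumrB; congr (_ * _); apply: eq_bigr => n _.
by rewrite /residual; ring.
Qed.

(** The sequence [L] of normalized sums of the projection is compared with the
    normal law by [iid_test_function_cvg]; the mean square distance of [L] to the
    normalized error [Y] is N times the mean square of the estimator of the
    residual, hence O(1/N). *)
Lemma central_limit : cvg_in_distribution P
  (fun N omega => Num.sqrt N%:R * (prod_estimator X N phi omega - a))
  (normal_law 0 (sigma2_prod mu phi)).
Proof.
have iphi := square_integrable_rintegrable phi2.
have proj2 := square_integrable_projection phi2 pphi.
have [mproj _] := proj2.
pose b := isMeasurableFun.Build _ _ _ _ (projection mu phi : prod_space S -> RT) mproj.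
pose G : {mfun prod_space S >-> RT} := HB.pack (projection mu phi : prod_space S -> RT) b.
have s20 : 0 <= sigma2_prod mu phi.
  by rewrite -(Rintegral_projection_sqr phi2 pphi); apply: Rintegral_ge0 => x _; exact: sqr_ge0.
have cG : centered (distribution (prod_prob mu) G) (sigma2_prod mu phi).
  apply: centered_distribution => //.
    exact: (Rintegral_projection phi2 pphi).
  exact: (Rintegral_projection_sqr phi2 pphi).
have cN := centered_normal_law s20.
have res2 := square_integrable_residual phi2 pphi.
have pres := partially_integrable_residual phi2 pphi.
have ires := square_integrable_rintegrable res2.
have [|C C0 HC] := @mean_square_estimator_le _ _ _ _ mu _ _ P X hX phi 0 phi2 pphi.
  by move=> A; case: #|A|.
have [C' C'0 HC'] := mean_square_estimator_le hX res2 pres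
  (block_variance_residual phi2 pphi).
rewrite (Rintegral_residual phi2 pphi) in HC'.
pose Y N omega := Num.sqrt N%:R * (prod_estimator X N phi omega - a).
pose L N omega := (Num.sqrt N%:R)^-1 * \sum_(i < N) (G (X i omega) : R).
have Y2 N : square_integrable P (Y N).
  apply: square_integrableZl; apply: square_integrableB; last exact: square_integrable_cst.
  exact: (square_integrable_estimator hX).
have L2 N : square_integrable P (L N).
  apply: square_integrableZl; apply: square_integrable_sum => i.
  have law : same_law P (prod_prob mu) (X i) id.
    split; [exact: measurable_funP|exact: measurable_id|].
    by move=> B mB; case: hX => h _; exact: h.
  exact: (same_law_square_integrable (same_law_sym law) mproj proj2).
apply: (@cvg_in_distribution_test_functions _ _ _ P Y _ C) => //.
- move=> N N0; have NR : 0 < N%:R :> R by rewrite ltr0n.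
  have e2 : rintegrable P (fun omega => (prod_estimator X N phi omega - a) ^+ 2).
    have [_ +] := square_integrableB (square_integrable_estimator hX iphi phi2 N)
      (square_integrable_cst P a).
    by [].
  have -> : \int[P]_omega Y N omega ^+ 2 =
      N%:R * \int[P]_omega (prod_estimator X N phi omega - a) ^+ 2.
    rewrite -RintegralZl//; apply: eq_Rintegral => w _.
    by rewrite /Y exprMn sqr_sqrtr// ltW.
  by have := HC _ N0; rewrite expr1 ler_pdivlMr// mulrC.
- by case: cN.
move=> M g g1 g2 tg g1M.
have bg := test_function_bounded tg.
have Lcvg : \int[P]_omega g (L N omega) @[N --> \oo] -->
    \int[normal_law 0 (sigma2_prod mu phi)]_t g t.
  have := iid_test_function_cvg cG cN tg
    (fun n => normal_law_stable (n := n) 0 s20 bg).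
  have -> : smear (normal_law 0 (sigma2_prod mu phi)) 1 g 0 =
      \int[normal_law 0 (sigma2_prod mu phi)]_t g t.
    by apply: eq_Rintegral => t _; rewrite add0r mul1r.
  apply: cvg_trans; apply: near_eq_cvg; near=> N.
  by rewrite (Rintegral_iid_sum hX G N _ bg).
have diff : \int[P]_omega g (Y N omega) - \int[P]_omega g (L N omega) @[N --> \oo]
    --> (0 : R).
  have M0 : 0 <= M := le_trans (normr_ge0 _) (g1M 0).
  apply/cvgrPdist_le => e e0; near=> N.
  have N0 : (0 < N)%N by near: N; exact: nbhs_infty_gt.
  have NR : 0 < N%:R :> R by rewrite ltr0n.
  have NC : M ^+ 2 * C' / e ^+ 2 <= N%:R by near: N; exact: nbhs_infty_ger.
  rewrite sub0r normrN; apply: (le_trans (test_function_slutsky tg g1M (Y2 N) (L2 N))).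
  have est2 := square_integrable_estimator hX ires res2 N.
  have -> : \int[P]_omega (Y N omega - L N omega) ^+ 2 =
      N%:R * \int[P]_omega prod_estimator X N (residual mu phi) omega ^+ 2.
    rewrite -RintegralZl//; last by case: est2.
    apply: eq_Rintegral => omega _.
    rewrite -[in X in X * _](sqr_sqrtr (ltW NR)) -exprMn; congr (_ ^+ 2).
    rewrite /Y estimator_residual// /L mulrDr mulrA.
    have -> : Num.sqrt N%:R * N%:R^-1 = (Num.sqrt N%:R)^-1 :> R.
      rewrite -[in X in _ * X](sqr_sqrtr (ltW NR)) expr2 invfM mulrA.
      by rewrite mulfV ?mul1r// gt_eqF// sqrtr_gt0.
    by rewrite addrAC subrr add0r.
  have := HC' N N0; under eq_Rintegral do rewrite subr0.
  move=> le2.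
  have {}le2 : N%:R * \int[P]_omega prod_estimator X N (residual mu phi) omega ^+ 2
      <= C' / N%:R.
    by rewrite mulrC -ler_pdivlMr// (le_trans le2)// expr2 invfM mulrA.
  apply: (@le_trans _ _ (M * Num.sqrt (C' / N%:R))); first by rewrite ler_wpM2l// ler_wsqrtr.
  have -> : M = Num.sqrt (M ^+ 2) by rewrite sqrtr_sqr ger0_norm.
  have -> : e = Num.sqrt (e ^+ 2) by rewrite sqrtr_sqr gtr0_norm.
  rewrite -sqrtrM ?sqr_ge0// ler_wsqrtr// mulrA ler_pdivrMr//.
  by rewrite -ler_pdivrMl ?exprn_gt0// mulrC.
rewrite -[X in _ --> X]add0r.
have -> : (fun N => \int[P]_omega g (Y N omega)) =
    (fun N => \int[P]_omega g (Y N omega) - \int[P]_omega g (L N omega)) \+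
    (fun N => \int[P]_omega g (L N omega)).
  by apply/funext => N /=; rewrite subrK.
exact: cvgD diff Lcvg.
Unshelve. all: by end_near. Qed.

End central_limit.

(** * The product-form estimator *)

Theorem theorem1 (R : realType) (K : nat) (hK : (1 < K)%N)
  (d : 'I_K -> measure_display) (S : forall k, measurableType (d k))
  (mu : forall k, probability (S k) R)
  (dO : measure_display) (Omega : measurableType dO)
  (P : probability Omega R) (X : nat -> {RV P >-> prod_space S})
  (hX : iid_with_law X (prod_prob mu))
  (phi : prod_space S -> R)
  (hphi : (prod_prob mu).-integrable setT (EFin \o phi)) :
  (forall N : nat, (0 < N)%N ->
     ('E_P[prod_estimator X N phi] = \int[prod_prob mu]_x (phi x)%:E)%E) /\
  (phi \in Lfun (prod_prob mu) 2%:E -> partially_integrable mu phi ->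
     (forall A : {set 'I_K},
        (marginal mu phi : block S A -> R) \in Lfun (block_prob mu A) 2%:E) /\
     (forall N : nat, (0 < N)%N ->
        ('V_P[prod_estimator X N phi] =
         (\sum_(A : {set 'I_K} | A != finset.set0)
            N%:R ^- #|A| *
            \sum_(B : {set 'I_K} | B \subset A)
               (-1) ^+ (#|A| - #|B|) *
               sigma2_block mu B (marginal mu phi : block S A -> R))%R%:E)%E) /\
     {ae P, forall omega,
        prod_estimator X N phi omega @[N --> \oo]
          --> \int[prod_prob mu]_x phi x} /\
     cvg_in_distribution P
       (fun N omega => Num.sqrt N%:R *
          (prod_estimator X N phi omega - \int[prod_prob mu]_x phi x))
       (normal_law 0 (sigma2_prod mu phi))).

Proof.
split; first by move=> N N0; exact: (expectation_estimator hX).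
move=> /Lfun2P phi2 pphi; have [mphi iphi2] := phi2.
split.
  by move=> A; apply/Lfun2P; exact: square_integrable_marginal.
split; first by move=> N N0; exact: variance_estimator.
by split; [exact: strong_law|exact: central_limit].
Qed.
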